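(* Let $\Delta,c_1,c_2,c_3>0$ with $\frac{c_2}{c_1}\Delta^2\le5/3$, and let $\nu$ be the measure supported in $[-\Delta,\Delta]$ given by $d\nu(\alpha)=c_1\boldsymbol\delta(\alpha)+c_2|\alpha|e^{-c_3|\alpha|}d\alpha$. Let $\eta_1,\eta_2$ be solutions of $\eta^4+2\left(\frac{c_2}{c_1}-c_3^2\right)\eta^2+c_3^2\left(2\frac{c_2}{c_1}+c_3^2\right)=0$ with $\eta_1+\eta_2\ne0$. Then the reproducing kernel of $\mathcal H_\nu$ satisfies $$\begin{aligned}K_\nu(0,z)=&\left(\frac1{c_1}-A(0)\mu\right)\frac{C(\eta_1,z)B(\eta_2)-C(\eta_2,z)B(\eta_1)}{A(\eta_1)B(\eta_2)-A(\eta_2)B(\eta_1)}\\&+\left(\frac{c_3^2}{c_1}+B(0)\mu\right)\frac{C(\eta_1,z)A(\eta_2)-C(\eta_2,z)A(\eta_1)}{A(\eta_1)B(\eta_2)-A(\eta_2)B(\eta_1)}+\mu\frac{\sin(\pi\Delta z)}{\pi z},\end{aligned}$$ where the expression is interpreted as a limit whenever $\eta_1=\eta_2$.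
   Context: $\mu=\frac{c_3^2}{2c_2+c_3^2c_1}$; $A(\eta)=1+\frac{c_2}{c_1}\int_{-\Delta/2}^{\Delta/2}\cosh(\eta\alpha)|\alpha|e^{-c_3|\alpha|}d\alpha$; $B(\eta)=\eta^2+2\frac{c_2}{c_1}-c_3^2+2\frac{c_2c_3}{c_1}\int_{-\Delta/2}^{\Delta/2}\cosh(\eta\alpha)e^{-c_3|\alpha|}d\alpha$; $C(\eta,z)=\dfrac{4\pi z\sin(\pi\Delta z)\cosh\frac{\Delta\eta}2+2\eta\cos(\pi\Delta z)\sinh\frac{\Delta\eta}2}{4\pi^2z^2+\eta^2}$, with $C(\eta,\pm i\frac\eta{2\pi})$ understood as the limit. $\widehat\nu(x)=\int e^{-2\pi ix\alpha}d\nu(\alpha)$. $\mathcal H_\nu$ is the space of entire functions of exponential type at most $\pi\Delta$ with $\|f\|_\nu^2=\int_{\mathbb R}|f|^2\widehat\nu\,dx<\infty$ and inner product $\int f\bar g\widehat\nu\,dx$; it is a reproducing kernel Hilbert space and $K_\nu(w,\cdot)\in\mathcal H_\nu$ satisfies $f(w)=\langle f,K_\nu(w,\cdot)\rangle$.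
   Formalization: In B(η) the integral term carries a minus sign instead of the printed plus, with which the formula is false; and η₁=η₂ is allowed only when every solution of the quartic is ±η₁ (a double root), the limit being taken as η₂→η₁ with η₁ fixed. *)

(* Defs.v *)
From HB Require Import structures.
From mathcomp Require Import all_boot all_order all_algebra.
From mathcomp Require Import complex.
From mathcomp Require Import all_classical all_reals all_analysis.

Set Implicit Arguments.
Unset Strict Implicit.
Unset Printing Implicit Defensive.

Import Order.TTheory GRing.Theory Num.Theory.
Import numFieldNormedType.Exports.

Local Open Scope classical_set_scope.
Local Open Scope ring_scope.
Local Open Scope complex_scope.

Section ComplexAnalysis.
Context {R : realType}.
Implicit Types (z w : R[i]) (f g : R[i] -> R[i]).

Definition cexp z : R[i] :=
  (expR (complex.Re z))%:C * (cos (complex.Im z) +i* sin (complex.Im z)).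

Definition ccosh z : R[i] := (cexp z + cexp (- z)) / 2.

Definition csinh z : R[i] := (cexp z - cexp (- z)) / 2.

Definition ccos z : R[i] := (cexp ('i * z) + cexp (- ('i * z))) / 2.

Definition csin z : R[i] := (cexp ('i * z) - cexp (- ('i * z))) / (2 * 'i).

Definition cintegrable d (T : measurableType d)
    (m : {measure set T -> \bar R}) (D : set T) (f : T -> R[i]) : Prop :=
  m.-integrable D (fun x => (complex.Re (f x))%:E) /\
  m.-integrable D (fun x => (complex.Im (f x))%:E).

Definition cintegral d (T : measurableType d)
    (m : {measure set T -> \bar R}) (D : set T) (f : T -> R[i]) : R[i] :=
  Rintegral m D (fun x => complex.Re (f x))
    +i* Rintegral m D (fun x => complex.Im (f x)).

(* [R[i]^o] is [R[i]] seen as a normed module over itself, so [derivable]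
   is complex differentiability. *)
Definition entire f : Prop :=
  forall z, derivable (f : R[i]^o -> R[i]^o) z 1.

Definition cabs z : R := complex.Re `|z|.

Definition exp_type_le (tau : R) f : Prop :=
  forall e : R, 0 < e ->
    exists M : R, forall z,
      cabs (f z) <= M * expR ((tau + e) * cabs z).

Definition limit_at f z : R[i] :=
  lim ((f : R[i]^o -> R[i]^o) w @[w --> (z : R[i]^o)^']).

End ComplexAnalysis.

Section HilbertSpace.
Context {R : realType}.
Variables (Delta : R) (nu : {measure set (measurableTypeR R) -> \bar R}).
Implicit Types (f g : R[i] -> R[i]) (K : R[i] -> R[i] -> R[i]).

Definition nu_hat (x : R) : R[i] :=
  cintegral nu setT (fun a : R => cexp (- (2 * 'i * (pi * x * a)%:C))).

Definition inH f : Prop :=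
  [/\ entire f, exp_type_le (pi * Delta) f &
      cintegrable (@lebesgue_measure R) setT
        (fun x : R => `|f x%:C| ^+ 2 * nu_hat x)].

Definition inner f g : R[i] :=
  cintegral (@lebesgue_measure R) setT
    (fun x : R => f x%:C * (g x%:C)^* * nu_hat x).

Definition is_reproducing_kernel K : Prop :=
  forall w, inH (K w) /\ forall f, inH f -> f w = inner f (K w).

End HilbertSpace.

Section Kernel.
Context {R : realType}.
Variables Delta c1 c2 c3 : R.
Implicit Types (eta z : R[i]).

Definition is_nu (nu : {measure set (measurableTypeR R) -> \bar R}) : Prop :=
  forall X : set (measurableTypeR R), measurable X ->
    nu X = (c1%:E * \d_(0%R : measurableTypeR R) X +
      \int[@lebesgue_measure R]_(a in X `&` [set` `[(- Delta)%R, Delta]%R])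
        (c2 * `|a| * expR (- (c3 * `|a|)))%:E)%E.

Definition char_eq eta : Prop :=
  eta ^+ 4 + (2 * (c2 / c1 - c3 ^+ 2))%:C * eta ^+ 2
    + (c3 ^+ 2 * (2 * (c2 / c1) + c3 ^+ 2))%:C = 0.

Definition mu_coef : R := c3 ^+ 2 / (2 * c2 + c3 ^+ 2 * c1).

Definition int_half (h : R -> R[i]) : R[i] :=
  cintegral (@lebesgue_measure R) [set` `[- (Delta / 2), Delta / 2]] h.

Definition Afun eta : R[i] :=
  1 + (c2 / c1)%:C * int_half (fun a =>
        ccosh (eta * a%:C) * (`|a| * expR (- (c3 * `|a|)))%:C).

(* Let [k a = `|a| * expR (- (c3 * `|a|))], let [*] be convolution on
   [[- Delta / 2, Delta / 2]] and [F = u + (c2 / c1) (k * u)] with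
   [u a = ccosh (eta * a)].  Then [Afun eta = F 0] and
   [Bfun eta = F'' 0 - c3^2 F 0].  Since
   [k'' = 2 delta_0 - 2 c3 expR (- (c3 * `|a|)) + c3^2 k], the integral enters
   [Bfun] with a minus sign.  The source of this definition prints a plus sign,
   with which [kernel_formula] below is not the reproducing kernel. *)
Definition Bfun eta : R[i] :=
  eta ^+ 2 + (2 * (c2 / c1) - c3 ^+ 2)%:C
    - (2 * (c2 * c3 / c1))%:C * int_half (fun a =>
        ccosh (eta * a%:C) * (expR (- (c3 * `|a|)))%:C).

Definition Cfun_quot eta z : R[i] :=
  (4 * pi%:C * z * csin ((pi * Delta)%:C * z) * ccosh ((Delta / 2)%:C * eta)
   + 2 * eta * ccos ((pi * Delta)%:C * z) * csinh ((Delta / 2)%:C * eta))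
  / (4 * pi%:C ^+ 2 * z ^+ 2 + eta ^+ 2).

Definition Cfun eta z : R[i] :=
  if 4 * pi%:C ^+ 2 * z ^+ 2 + eta ^+ 2 == 0 then limit_at (Cfun_quot eta) z
  else Cfun_quot eta z.

Definition sinc_quot z : R[i] := csin ((pi * Delta)%:C * z) / (pi%:C * z).

Definition sinc z : R[i] :=
  if z == 0 then limit_at sinc_quot 0 else sinc_quot z.

Definition kernel_denom eta1 eta2 : R[i] :=
  Afun eta1 * Bfun eta2 - Afun eta2 * Bfun eta1.

Definition kernel_formula eta1 eta2 z : R[i] :=
  ((1 / c1)%:C - Afun 0 * mu_coef%:C)
    * ((Cfun eta1 z * Bfun eta2 - Cfun eta2 z * Bfun eta1)
       / kernel_denom eta1 eta2)
  + ((c3 ^+ 2 / c1)%:C + Bfun 0 * mu_coef%:C)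
    * ((Cfun eta1 z * Afun eta2 - Cfun eta2 z * Afun eta1)
       / kernel_denom eta1 eta2)
  + mu_coef%:C * sinc z.

End Kernel.

(* Main.v *)
(** Let T phi be the Fourier transform of phi restricted to
    I = [-Delta/2, Delta/2].  The bound on c2/c1 * Delta^2 makes the transform of
    nu bounded below, so that H is a space of square integrable functions of type
    pi * Delta.  Such an f is orthogonal to every frequency outside I, hence
    <f, T phi> is the integral of f times the conjugate of T (phi * nu), where only
    the values of phi * nu on I matter.  If phi * nu = 1 on I, this integral is
    f(0), whence K(0, .) = T phi.

    On I the function cosh(eta x) * nu is c1 times
      A(eta) cosh(c3 x) + B(eta) x sinh(c3 x) / (2 c3) + chi(eta) R(eta, x),
    chi being the characteristic polynomial.  A combination of cosh(eta1 x),
    cosh(eta2 x) and 1 therefore has phi * nu = 1, provided that its coefficients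
    solve a 2 x 2 linear system; Cramer's rule gives the formula.  The same
    identity, applied to combinations that annihilate cosh(c3 x) or
    x sinh(c3 x) and evaluated at points where sin or cos of pi Delta z vanishes,
    bounds the determinant below by a multiple of |eta2^2 - eta1^2|; this settles
    both its nonvanishing and the limit at a double root, where
    chi(eta) = (eta^2 - eta1^2)^2. *)

(* Orthogonality is obtained by rotating contours, not from a Paley-Wiener representation. With a
   damping exp(- eps |x|), each half line is turned onto an imaginary ray along which the
   oscillating factor beats the type. A direct rotation needs a damping above the type; analyticity
   in the damping carries it to every positive one, and as eps tends to 0 the two rotated integrals
   cancel. Poisson kernels then yield f(0). The edge of I corresponds exactly to the type pi *
   Delta, so the limiting case of the orthogonality is the one used. The constant 5/3 is the
   reciprocal of the 3/5 in 3/10 s^2 + s sin s + cos s >= 1, whose left side minus 1 is the integral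
   of a (3/5 + cos a) over [0, s]; strict positivity of the transform comes from c3 > 0. Since the
   double root is a limit, [kernel_combination] and [kernel_separation] are inequalities with
   constants uniform for bounded eta kept away from c3 and - c3; at exact roots they become
   identities. The given kernel enters by pairing T phi with K(w, .), so that an error in phi * nu =
   1 becomes an error in the value at w. *)
Require Import Defs.
From mathcomp Require Import all_boot all_order all_algebra.
From mathcomp Require Import complex.
From mathcomp Require Import all_classical all_reals all_analysis.
From mathcomp Require Import measurable_realfun ring lra.
Import Order.TTheory GRing.Theory Num.Theory.
Import numFieldNormedType.Exports.
Local Open Scope classical_set_scope.
Local Open Scope ring_scope.
Local Open Scope complex_scope.
Set Implicit Arguments.
Unset Strict Implicit.
Unset Printing Implicit Defensive.

(** * The complex exponential *)

Section ComplexModulus.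
Context {R : realType}.
Implicit Types (z w : R[i]) (x y : R).

Lemma Re_mul z w :
  complex.Re (z * w) = complex.Re z * complex.Re w - complex.Im z * complex.Im w.
Proof. by case: z w => [a b] [c d]. Qed.

Lemma Im_mul z w :
  complex.Im (z * w) = complex.Re z * complex.Im w + complex.Im z * complex.Re w.
Proof. by case: z w => [a b] [c d]. Qed.

Lemma Re_add z w : complex.Re (z + w) = complex.Re z + complex.Re w.
Proof. by case: z w => [a b] [c d]. Qed.

Lemma Im_add z w : complex.Im (z + w) = complex.Im z + complex.Im w.
Proof. by case: z w => [a b] [c d]. Qed.

Lemma Re_opp z : complex.Re (- z) = - complex.Re z.
Proof. by case: z. Qed.

Lemma Im_opp z : complex.Im (- z) = - complex.Im z.
Proof. by case: z. Qed.

Lemma complex_ext z w :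
  complex.Re z = complex.Re w -> complex.Im z = complex.Im w -> z = w.
Proof. by case: z w => [a b] [c d] /= -> ->. Qed.

Lemma normC_cabs z : `|z| = (cabs z)%:C.
Proof. by rewrite /cabs normc_def. Qed.

Lemma cabsE z : cabs z = Num.sqrt (complex.Re z ^+ 2 + complex.Im z ^+ 2).
Proof. by rewrite /cabs normc_def. Qed.

Lemma cabs_ge0 z : 0 <= cabs z.
Proof. by rewrite -ler0c -normC_cabs. Qed.

Lemma cabs_eq0 z : (cabs z == 0) = (z == 0).
Proof. by rewrite -[RHS]normr_eq0 normC_cabs -(inj_eq (@complexI R)). Qed.

Lemma cabs0 : cabs (0 : R[i]) = 0.
Proof. by apply/eqP; rewrite cabs_eq0. Qed.

Lemma cabs_gt0 z : (0 < cabs z) = (z != 0).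
Proof. by rewrite lt_def cabs_ge0 andbT cabs_eq0. Qed.

Lemma cabsM z w : cabs (z * w) = cabs z * cabs w.
Proof.
by apply: (@complexI R); rewrite -normC_cabs normrM !normC_cabs rmorphM.
Qed.

Lemma cabsD z w : cabs (z + w) <= cabs z + cabs w.
Proof. by rewrite -lecR rmorphD /= -!normC_cabs ler_normD. Qed.

Lemma cabsN z : cabs (- z) = cabs z.
Proof. by rewrite /cabs normrN. Qed.

Lemma cabsBC z w : cabs (z - w) = cabs (w - z).
Proof. by rewrite /cabs distrC. Qed.

Lemma cabsB z w : cabs (z - w) <= cabs z + cabs w.
Proof. by rewrite -(cabsN w) cabsD. Qed.

Lemma cabs_real x : cabs x%:C = `|x|.
Proof. by rewrite cabsE /= expr0n addr0 sqrtr_sqr. Qed.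

Lemma cabs1 : cabs (1 : R[i]) = 1.
Proof. by rewrite (cabs_real 1) normr1. Qed.

Lemma cabs_i : cabs ('i : R[i]) = 1.
Proof. by rewrite cabsE /= expr0n expr1n add0r sqrtr1. Qed.

Lemma cabsX z n : cabs (z ^+ n) = cabs z ^+ n.
Proof. by elim: n => [|n IH]; rewrite ?expr0 ?cabs1// !exprS cabsM IH. Qed.

Lemma cabsV z : cabs z^-1 = (cabs z)^-1.
Proof.
have [->|z0] := eqVneq z 0; first by rewrite invr0 cabs0 invr0.
apply: (@mulfI _ (cabs z)); first by rewrite cabs_eq0.
by rewrite -cabsM !divff ?cabs1// cabs_eq0.
Qed.

Lemma cabs_conj z : cabs z^* = cabs z.
Proof. by case: z => a b; rewrite !cabsE /= sqrrN. Qed.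

Lemma Re_le_cabs z : `|complex.Re z| <= cabs z.
Proof. by rewrite -lecR -normC_cabs normc_ge_Re. Qed.

Lemma Im_le_cabs z : `|complex.Im z| <= cabs z.
Proof.
rewrite -[leLHS](_ : `|complex.Re (z * - 'i)| = _); last first.
  by rewrite Re_mul /= oppr0 mulr0 sub0r mulrN1 opprK.
by rewrite (le_trans (Re_le_cabs _))// cabsM cabsN cabs_i mulr1.
Qed.

Lemma cabs_le_ReIm z : cabs z <= `|complex.Re z| + `|complex.Im z|.
Proof.
case: z => a b /=.
rewrite (_ : a +i* b = a%:C + 'i * b%:C); last first.
  by apply: complex_ext; rewrite /= ?(mul0r,mulr0,mul1r,addr0,add0r,subr0).
by rewrite (le_trans (cabsD _ _))// cabsM cabs_i mul1r !cabs_real.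
Qed.

Lemma cabs_sqr z : cabs z ^+ 2 = complex.Re z ^+ 2 + complex.Im z ^+ 2.
Proof. by rewrite cabsE sqr_sqrtr// addr_ge0 ?sqr_ge0. Qed.

Lemma mulcJ z : z * z^* = (cabs z ^+ 2)%:C.
Proof.
by rewrite cabs_sqr; case: z => a b; apply: complex_ext => /=; ring.
Qed.

End ComplexModulus.

Section ComplexExponential.
Context {R : realType}.
Implicit Types (z w : R[i]) (x y : R).

Lemma Re_cexp z : complex.Re (cexp z) = expR (complex.Re z) * cos (complex.Im z).
Proof. by rewrite /cexp Re_mul /= mul0r subr0. Qed.

Lemma Im_cexp z : complex.Im (cexp z) = expR (complex.Re z) * sin (complex.Im z).
Proof. by rewrite /cexp Im_mul /= mul0r addr0. Qed.

Lemma cexpD z w : cexp (z + w) = cexp z * cexp w.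
Proof.
apply: complex_ext; rewrite !(Re_mul, Im_mul, Re_cexp, Im_cexp) Re_add Im_add expRD.
  by rewrite cosD; ring.
by rewrite sinD; ring.
Qed.

Lemma cexp0 : cexp (0 : R[i]) = 1.
Proof.
by apply: complex_ext; rewrite !(Re_cexp, Im_cexp) /= ?expR0 ?cos0 ?sin0 ?mul1r.
Qed.

Lemma cabs_cexp z : cabs (cexp z) = expR (complex.Re z).
Proof.
rewrite cabsE Re_cexp Im_cexp !exprMn -mulrDr cos2Dsin2 mulr1 sqrtr_sqr.
by rewrite ger0_norm// expR_ge0.
Qed.

Lemma cexpNM z : cexp z * cexp (- z) = 1.
Proof. by rewrite -cexpD subrr cexp0. Qed.

Lemma cexp_neq0 z : cexp z != 0.
Proof. by rewrite -cabs_gt0 cabs_cexp expR_gt0. Qed.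

Lemma cexpN z : cexp (- z) = (cexp z)^-1.
Proof.
by apply: (@mulfI _ (cexp z)); rewrite ?cexp_neq0// cexpNM divff// cexp_neq0.
Qed.

Lemma cexp_conj z : cexp z^* = (cexp z)^*.
Proof.
by case: z => a b; apply: complex_ext; rewrite /= ?cosN ?sinN; ring.
Qed.

Lemma cexp_real x : cexp x%:C = (expR x)%:C.
Proof.
by apply: complex_ext; rewrite ?Re_cexp ?Im_cexp /= ?cos0 ?sin0 ?mulr0 ?mulr1.
Qed.

Lemma cabs_cexp_le z : cabs (cexp z) <= expR (cabs z).
Proof.
by rewrite cabs_cexp ler_expR (le_trans (ler_norm _))// Re_le_cabs.
Qed.

Lemma Re_iM z : complex.Re ('i * z) = - complex.Im z.
Proof. by rewrite Re_mul /= mul0r mul1r sub0r. Qed.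

Lemma Im_iM z : complex.Im ('i * z) = complex.Re z.
Proof. by rewrite Im_mul /= mul0r mul1r add0r. Qed.

Lemma cexp_i x : cexp ('i * x%:C) = cos x +i* sin x.
Proof.
by apply: complex_ext; rewrite ?Re_cexp ?Im_cexp Re_iM Im_iM /=
  oppr0 expR0 mul1r.
Qed.

Lemma cabs_cexp_i x : cabs (cexp ('i * x%:C)) = 1.
Proof. by rewrite cabs_cexp Re_iM /= oppr0 expR0. Qed.

End ComplexExponential.

(** * Integrals of complex functions *)

Section ComplexIntegral.
Context {R : realType} d (T : measurableType d) (mu : {measure set T -> \bar R}).
Implicit Types (D : set T) (f g : T -> R[i]) (u v : T -> R).

Definition cmeas D f :=
  measurable_fun D (fun x => complex.Re (f x)) /\
  measurable_fun D (fun x => complex.Im (f x)).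

Lemma cmeas_cst D (c : R[i]) : cmeas D (fun=> c).
Proof. by split; exact: measurable_cst. Qed.

Lemma cmeas_real D u : measurable_fun D u -> cmeas D (fun x => (u x)%:C).
Proof. by move=> mu_; split => //=; exact: measurable_cst. Qed.

Lemma cmeasD D f g : cmeas D f -> cmeas D g -> cmeas D (fun x => f x + g x).
Proof.
move=> [fr fi] [gr gi]; split.
  by under eq_fun do rewrite Re_add; exact: measurable_funD.
by under eq_fun do rewrite Im_add; exact: measurable_funD.
Qed.

Lemma cmeasM D f g : cmeas D f -> cmeas D g -> cmeas D (fun x => f x * g x).
Proof.
move=> [fr fi] [gr gi]; split.
  under eq_fun do rewrite Re_mul.
  by apply: measurable_funB; exact: measurable_funM.
under eq_fun do rewrite Im_mul.
by apply: measurable_funD; exact: measurable_funM.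
Qed.

Lemma cmeasN D f : cmeas D f -> cmeas D (fun x => - f x).
Proof.
move=> mf; under eq_fun do rewrite -mulN1r.
by apply: cmeasM => //; exact: cmeas_cst.
Qed.

Lemma cmeasB D f g : cmeas D f -> cmeas D g -> cmeas D (fun x => f x - g x).
Proof. by move=> mf mg; apply: cmeasD => //; exact: cmeasN. Qed.

Lemma cmeas_conj D f : cmeas D f -> cmeas D (fun x => (f x)^*).
Proof.
move=> [fr fi]; split.
  by apply: eq_measurable_fun fr => x _ /=; case: (f x).
apply: (@eq_measurable_fun _ _ _ _ _ (fun x => - complex.Im (f x))).
  by move=> x _ /=; case: (f x).
exact: measurableT_comp.
Qed.

Lemma cmeas_cexp D f : cmeas D f -> cmeas D (fun x => cexp (f x)).
Proof.
move=> [fr fi]; split.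
  under eq_fun do rewrite Re_cexp.
  apply: measurable_funM; first exact: measurableT_comp.
  apply: (@measurableT_comp _ _ _ _ _ _ cos) => //.
  by apply: continuous_measurable_fun; exact: continuous_cos.
under eq_fun do rewrite Im_cexp.
apply: measurable_funM; first exact: measurableT_comp.
apply: (@measurableT_comp _ _ _ _ _ _ sin) => //.
by apply: continuous_measurable_fun; exact: continuous_sin.
Qed.

Lemma cmeas_cabs D f : cmeas D f -> measurable_fun D (fun x => cabs (f x)).
Proof.
move=> [fr fi].
under eq_fun do rewrite cabsE.
have ms : measurable_fun setT (Num.sqrt : R -> R).
  by apply: continuous_measurable_fun; exact: sqrt_continuous.
apply: measurableT_comp ms _.
by apply: measurable_funD; exact: measurable_funX.
Qed.

Lemma cintegrable_meas D f : cintegrable mu D f -> cmeas D f.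
Proof.
by move=> [/measurable_int/measurable_EFinP ? /measurable_int/measurable_EFinP ?]; split.
Qed.

Lemma integrable_dom D u v : measurable D -> measurable_fun D u ->
  mu.-integrable D (EFin \o v) -> (forall x, D x -> `|u x| <= v x) ->
  mu.-integrable D (fun x => (u x)%:E).
Proof.
move=> mD mu_ iv uv; apply: (le_integrable mD _ _ iv).
  exact/measurable_EFinP.
by move=> x Dx /=; rewrite lee_fin (le_trans (uv _ Dx))// ler_norm.
Qed.

Lemma integrable_scale D (c : R) u : measurable D ->
  mu.-integrable D (EFin \o u) -> mu.-integrable D (EFin \o (fun x => c * u x)).
Proof. by move=> mD iu; exact: (integrableZl mD c iu). Qed.

Lemma integrable_add D u v : measurable D ->
  mu.-integrable D (EFin \o u) -> mu.-integrable D (EFin \o v) ->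
  mu.-integrable D (EFin \o (fun x => u x + v x)).
Proof. by move=> mD iu iv; exact: (integrableD mD iu iv). Qed.

Lemma cintegrable_dom D f v : measurable D -> cmeas D f ->
  mu.-integrable D (EFin \o v) -> (forall x, D x -> cabs (f x) <= v x) ->
  cintegrable mu D f.
Proof.
move=> mD [fr fi] iv fv; split; apply: (integrable_dom mD _ iv) => // x Dx.
  exact: le_trans (Re_le_cabs _) (fv _ Dx).
exact: le_trans (Im_le_cabs _) (fv _ Dx).
Qed.

Lemma cintegrable_cabs D f : measurable D -> cintegrable mu D f ->
  mu.-integrable D (EFin \o (fun x => cabs (f x))).
Proof.
move=> mD cf; have [fr fi] := cf.
have ifr := integrable_norm fr; have ifi := integrable_norm fi.
apply: (integrable_dom mD _ (integrableD mD ifr ifi)).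
  by apply: cmeas_cabs; exact: cintegrable_meas.
move=> x Dx /=; rewrite ger0_norm ?cabs_ge0//.
exact: cabs_le_ReIm.
Qed.

Lemma eq_cintegral D f g : {in D, f =1 g} -> cintegral mu D f = cintegral mu D g.
Proof.
by move=> fg; congr Complex; apply: eq_Rintegral => x Dx; rewrite fg.
Qed.

Lemma eq_cintegrable D f g : measurable D -> {in D, f =1 g} ->
  cintegrable mu D f -> cintegrable mu D g.
Proof.
move=> mD fg [fr fi]; split.
  by apply: eq_integrable fr => // x Dx; rewrite fg.
by apply: eq_integrable fi => // x Dx; rewrite fg.
Qed.

Lemma cintegrableD D f g : measurable D ->
  cintegrable mu D f -> cintegrable mu D g -> cintegrable mu D (fun x => f x + g x).
Proof.
move=> mD [fr fi] [gr gi]; split.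
  by under eq_fun do rewrite Re_add EFinD; exact: integrableD.
by under eq_fun do rewrite Im_add EFinD; exact: integrableD.
Qed.

Lemma cintegralD D f g : measurable D ->
  cintegrable mu D f -> cintegrable mu D g ->
  cintegral mu D (fun x => f x + g x) = cintegral mu D f + cintegral mu D g.
Proof.
move=> mD [fr fi] [gr gi]; rewrite /cintegral; congr Complex.
  by under eq_fun do rewrite Re_add; rewrite RintegralD.
by under eq_fun do rewrite Im_add; rewrite RintegralD.
Qed.

Lemma cintegrableZl D f (c : R[i]) : measurable D ->
  cintegrable mu D f -> cintegrable mu D (fun x => c * f x).
Proof.
move=> mD [fr fi]; split.
  under eq_fun do rewrite Re_mul EFinB !EFinM.
  by apply: integrableB => //; exact: integrableZl.
under eq_fun do rewrite Im_mul EFinD !EFinM.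
by apply: integrableD => //; exact: integrableZl.
Qed.

Lemma cintegralZl D f (c : R[i]) : measurable D ->
  cintegrable mu D f -> cintegral mu D (fun x => c * f x) = c * cintegral mu D f.
Proof.
move=> mD [fr fi]; rewrite /cintegral; apply: complex_ext => /=.
  under eq_fun do rewrite Re_mul.
  have e1 := integrableZl mD (complex.Re c) fr.
  have e2 := integrableZl mD (complex.Im c) fi.
  by rewrite RintegralB// !RintegralZl// Re_mul.
under eq_fun do rewrite Im_mul.
have e1 := integrableZl mD (complex.Re c) fi.
have e2 := integrableZl mD (complex.Im c) fr.
by rewrite RintegralD// !RintegralZl// Im_mul.
Qed.

Lemma cintegrableN D f : measurable D ->
  cintegrable mu D f -> cintegrable mu D (fun x => - f x).
Proof.
by move=> mD cf; under eq_fun do rewrite -mulN1r; exact: cintegrableZl.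
Qed.

Lemma cintegralN D f : measurable D -> cintegrable mu D f ->
  cintegral mu D (fun x => - f x) = - cintegral mu D f.
Proof.
move=> mD cf; under eq_fun do rewrite -mulN1r.
by rewrite cintegralZl// mulN1r.
Qed.

Lemma cintegrableB D f g : measurable D ->
  cintegrable mu D f -> cintegrable mu D g -> cintegrable mu D (fun x => f x - g x).
Proof. by move=> mD cf cg; apply: cintegrableD => //; exact: cintegrableN. Qed.

Lemma cintegralB D f g : measurable D ->
  cintegrable mu D f -> cintegrable mu D g ->
  cintegral mu D (fun x => f x - g x) = cintegral mu D f - cintegral mu D g.
Proof.
move=> mD cf cg; rewrite cintegralD// ?cintegralN//.
exact: cintegrableN.
Qed.

Lemma cintegral_real D u : cintegral mu D (fun x => (u x)%:C) = (Rintegral mu D u)%:C.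
Proof.
rewrite /cintegral /=; congr Complex.
by rewrite /Rintegral integral0.
Qed.

Lemma cintegrable_real D u :
  mu.-integrable D (EFin \o u) -> cintegrable mu D (fun x => (u x)%:C).
Proof. by move=> iu; split => //=; exact: integrable0. Qed.

Lemma cintegral_conj D f : measurable D -> cintegrable mu D f ->
  cintegral mu D (fun x => (f x)^*) = (cintegral mu D f)^*.
Proof.
move=> mD [fr fi]; rewrite /cintegral /=; congr Complex.
  by apply: eq_Rintegral => x _; case: (f x).
rewrite -mulN1r -RintegralZl//; apply: eq_Rintegral => x _.
by rewrite mulN1r; case: (f x).
Qed.

Lemma cabs_cintegral D f v : measurable D -> cmeas D f ->
  mu.-integrable D (EFin \o v) -> (forall x, D x -> cabs (f x) <= v x) ->
  cabs (cintegral mu D f) <= Rintegral mu D v.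
Proof.
move=> mD mf iv fv; have cf := cintegrable_dom mD mf iv fv.
have v0 : 0 <= Rintegral mu D v.
  by apply: Rintegral_ge0 => x Dx; exact: le_trans (cabs_ge0 _) (fv _ Dx).
have [->|I0] := eqVneq (cintegral mu D f) 0; first by rewrite cabs0.
set I := cintegral mu D f in I0 *.
have cI : 0 < cabs I by rewrite cabs_gt0.
(* Multiplying [f] by the conjugate of the constant [I] makes its integral the real number |I|^2, so
   a bound on real parts suffices. *)
rewrite -(ler_pM2l cI) -expr2.
have -> : cabs I ^+ 2 = complex.Re (I^* * I) by rewrite mulrC mulcJ.
rewrite -cintegralZl// -RintegralZl//=.
apply: le_Rintegral => //.
- by have [] := cintegrableZl I^* mD cf.
- by have /= := integrableZl mD (cabs I) iv; under eq_fun do rewrite -EFinM.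
- move=> x Dx; rewrite (le_trans (ler_norm _))// (le_trans (Re_le_cabs _))//.
  by rewrite cabsM cabs_conj ler_wpM2l ?cabs_ge0// fv.
Qed.

Lemma cintegral_mkcond D f :
  cintegral mu D f = cintegral mu setT (fun x => (\1_D x)%:C * f x).
Proof.
rewrite /cintegral; congr Complex.
  rewrite Rintegral_mkcond; apply: eq_Rintegral => x _.
  by rewrite patchE indicE Re_mul /= mul0r subr0; case: ifPn; rewrite ?mul1r ?mul0r.
rewrite Rintegral_mkcond; apply: eq_Rintegral => x _.
by rewrite patchE indicE Im_mul /= mul0r addr0; case: ifPn; rewrite ?mul1r ?mul0r.
Qed.

(** Real dominated convergence applied to |F n - f|, which is at most 2 v and tends to 0 pointwise.
    Convergence is phrased through [cabs], so only real limits occur. *)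
Lemma cintegral_dct D (F : nat -> T -> R[i]) f v : measurable D ->
  (forall n, cmeas D (F n)) -> cmeas D f ->
  mu.-integrable D (EFin \o v) -> (forall n x, D x -> cabs (F n x) <= v x) ->
  (forall x, D x -> (fun n => cabs (F n x - f x)) @ \oo --> (0:R)) ->
  cintegrable mu D f /\ (fun n => cabs (cintegral mu D (F n) - cintegral mu D f)) @ \oo --> (0:R).
Proof.
move=> mD mF mf iv Fv Ff.
have fv x : D x -> cabs (f x) <= v x.
  move=> Dx; apply/ler_addgt0Pr => e e0.
  have /cvgrPdist_lt/(_ _ e0)[N _ /(_ N (leqnn N))] := Ff _ Dx.
  rewrite sub0r normrN ger0_norm ?cabs_ge0// => H.
  rewrite -[f x](subKr (F N x)) (le_trans (cabsB _ _))// lerD ?Fv//.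
  exact: ltW.
have cf := cintegrable_dom mD mf iv fv; split => //.
have cF n := cintegrable_dom mD (mF n) iv (Fv n).
have mG n : measurable_fun D (EFin \o (fun x => cabs (F n x - f x))).
  by apply/measurable_EFinP; apply: cmeas_cabs; exact: cmeasB.
have i2v : mu.-integrable D (EFin \o (fun x => 2 * v x)).
  have /= := integrableZl mD 2 iv.
  by under eq_fun do rewrite -EFinM.
have Gv n x : D x -> cabs (F n x - f x) <= 2 * v x.
  by move=> Dx; rewrite (le_trans (cabsB _ _))// mulr_natl mulr2n lerD ?fv ?Fv.
have H : (fun n => Rintegral mu D (fun x => cabs (F n x - f x))) @ \oo --> (0:R).
  apply: (@fine_cvg _ _ _ _ _ 0) => /=.
  have -> : 0%:E = (\int[mu]_(x in D) (0 : \bar R))%E by rewrite integral0.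
  have [] := @dominated_convergence _ _ _ mu D mD
    (fun n => EFin \o (fun x => cabs (F n x - f x))) (fun=> 0%E)
    (EFin \o (fun x => 2 * v x)) mG (measurable_cst _).
  - by apply: aeW => x Dx; apply: cvg_EFin; [exact: nearW|exact: Ff].
  - exact: i2v.
  - by apply: aeW => x n Dx /=; rewrite lee_fin ger0_norm ?cabs_ge0// Gv.
  - by [].
apply: (@squeeze_cvgr _ _ _ _ _ _ _ _ _ (cvg_cst 0) H).
apply: nearW => n; rewrite cabs_ge0 /= -cintegralB//.
apply: cabs_cintegral => //; first exact: cmeasB.
apply: (integrable_dom mD _ i2v); first exact/measurable_EFinP.
by move=> x Dx; rewrite ger0_norm ?cabs_ge0// Gv.
Qed.

End ComplexIntegral.

(** * Fubini's theorem under a product bound *)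

Section ComplexFubini.
Context {R : realType}.
Notation mu := (@lebesgue_measure R).
Notation T := (measurableTypeR R).
Implicit Types (u : R -> R -> R) (F : R -> R -> R[i]) (a b : R -> R).

Lemma EFin_Rintegral (D : set T) (v : T -> R) : measurable D ->
  mu.-integrable D (EFin \o v) ->
  (Rintegral mu D v)%:E = (\int[mu]_(x in D) (v x)%:E)%E.
Proof. by move=> mD iv; rewrite /Rintegral fineK// integrable_fin_num. Qed.

(** The product bound makes every section integrable, not only almost every one, so the real-valued
    inner integrals agree with the extended ones at each point. Measurability of the inner integral
    is a separate conclusion because later integrands are themselves such integrals. *)
Lemma Rfubini u a b :
  measurable_fun setT (fun z : T * T => u z.1 z.2) ->
  mu.-integrable setT (EFin \o a) -> mu.-integrable setT (EFin \o b) ->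
  (forall x y, `|u x y| <= a x * b y) ->
  measurable_fun setT (fun x : T => Rintegral mu setT (u x)) /\
  Rintegral mu setT (fun x => Rintegral mu setT (u x)) =
  Rintegral mu setT (fun y => Rintegral mu setT (u ^~ y)).
Proof.
move=> mu_ ia ib uab.
have mux x : measurable_fun setT (u x : T -> R).
  by apply: (measurableT_comp mu_ (f := fun z : T * T => u z.1 z.2) (g := fun y => (x, y)));
    exact: measurable_pair1.
have muy y : measurable_fun setT (u ^~ y : T -> R).
  by apply: (measurableT_comp mu_ (f := fun z : T * T => u z.1 z.2) (g := fun x => (x, y)));
    exact: measurable_pair2.
have iux x : mu.-integrable setT (EFin \o u x).
  apply: (@integrable_dom _ _ T mu setT (u x) (fun y => a x * b y)) => //.
  by have := integrableZl measurableT (a x) ib; under eq_fun do rewrite -EFinM.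
have iuy y : mu.-integrable setT (EFin \o u ^~ y).
  apply: (@integrable_dom _ _ T mu setT (u ^~ y) (fun x => a x * b y)) => //.
  by have := integrableZr measurableT (b y) ia; under eq_fun do rewrite -EFinM.
have mf : measurable_fun setT (fun z : T * T => (u z.1 z.2)%:E).
  exact/measurable_EFinP.
have If : (mu \x mu)%E.-integrable setT (fun z : T * T => (u z.1 z.2)%:E).
  apply/integrable12ltyP => //=.
  apply: (@le_lt_trans _ _ (\int[mu]_x (a x * Rintegral mu setT b)%:E)%E).
    apply: ge0_le_integral => //.
    - by move=> x _; exact: integral_ge0.
    - have mfa : measurable_fun setT (fun z : T * T => `|(u z.1 z.2)%:E|%E).
        exact: measurableT_comp.
      by apply: (measurable_fun_fubini_tonelli_F (fun z : T * T => `|(u z.1 z.2)%:E|%E)) mfa _ => z; exact: abse_ge0.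
    - apply/measurable_EFinP; apply: measurable_funM => //.
      by apply/measurable_EFinP; exact: measurable_int ia.
    - move=> x _; rewrite EFinM EFin_Rintegral//.
      rewrite -integralZl//; apply: ge0_le_integral => //.
      + by apply/measurable_EFinP; exact: measurableT_comp.
      + exact: measurable_int (integrableZl measurableT (a x) ib).
      + by move=> y _ /=; rewrite lee_fin uab.
  under eq_integral do rewrite EFinM.
  rewrite integralZr// -EFin_Rintegral// -EFinM; exact: ltry.
have FE x : (Rintegral mu setT (u x))%:E = (\int[mu]_y (u x y)%:E)%E.
  by rewrite EFin_Rintegral.
have GE y : (Rintegral mu setT (u ^~ y))%:E = (\int[mu]_x (u x y)%:E)%E.
  by rewrite EFin_Rintegral.
split.
  apply/measurable_EFinP; under [X in measurable_fun _ X]eq_fun do rewrite /= FE.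
  exact: (measurable_fubini_F If).
rewrite {1}/Rintegral [RHS]/Rintegral; congr fine.
under eq_integral do rewrite FE.
under [RHS]eq_integral do rewrite GE.
exact: (Fubini If).
Qed.

Lemma cfubini F a b :
  cmeas setT (fun z : T * T => F z.1 z.2) ->
  mu.-integrable setT (EFin \o a) -> mu.-integrable setT (EFin \o b) ->
  (forall x y, cabs (F x y) <= a x * b y) ->
  cmeas setT (fun x : T => cintegral mu setT (F x)) /\
  cintegral mu setT (fun x => cintegral mu setT (F x)) =
  cintegral mu setT (fun y => cintegral mu setT (F ^~ y)).
Proof.
move=> [mr mi] ia ib Fab.
have [|mr' er] := Rfubini (u := fun x y => complex.Re (F x y)) mr ia ib _.
  by move=> x y; rewrite (le_trans (Re_le_cabs _)).
have [|mi' ei] := Rfubini (u := fun x y => complex.Im (F x y)) mi ia ib _.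
  by move=> x y; rewrite (le_trans (Im_le_cabs _)).
split; first by split.
by apply: complex_ext; [exact: er|exact: ei].
Qed.

End ComplexFubini.

(** * Continuity and derivatives of complex functions of a real variable *)

Section RealVariable.
Context {R : realType}.
Notation mu := (@lebesgue_measure R).
Implicit Types (f g F : R -> R[i]) (u v : R -> R) (a b x y : R).

Definition ccont f :=
  continuous (fun x => complex.Re (f x)) /\ continuous (fun x => complex.Im (f x)).

(** Differentiability along the real line is stated by components, so that real derivatives and the
    real fundamental theorem of calculus apply to each of them. *)
Definition cder F x (d : R[i]) :=
  is_derive x 1 (fun y => complex.Re (F y)) (complex.Re d) /\
  is_derive x 1 (fun y => complex.Im (F y)) (complex.Im d).

Lemma ccont_cst (c : R[i]) : ccont (fun=> c).
Proof. by split=> x; exact: cvg_cst. Qed.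

Lemma ccont_real u : continuous u -> ccont (fun x => (u x)%:C).
Proof. by move=> cu; split => //= x; exact: cvg_cst. Qed.

Lemma ccontD f g : ccont f -> ccont g -> ccont (fun x => f x + g x).
Proof.
move=> [fr fi] [gr gi]; split.
  by under eq_fun do rewrite Re_add; move=> x; apply: cvgD; [exact: fr|exact: gr].
by under eq_fun do rewrite Im_add; move=> x; apply: cvgD; [exact: fi|exact: gi].
Qed.

Lemma ccontM f g : ccont f -> ccont g -> ccont (fun x => f x * g x).
Proof.
move=> [fr fi] [gr gi]; split.
  under eq_fun do rewrite Re_mul; move=> x.
  by apply: cvgB; apply: cvgM; [exact: fr|exact: gr|exact: fi|exact: gi].
under eq_fun do rewrite Im_mul; move=> x.
by apply: cvgD; apply: cvgM; [exact: fr|exact: gi|exact: fi|exact: gr].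
Qed.

Lemma ccontN f : ccont f -> ccont (fun x => - f x).
Proof.
by move=> cf; under eq_fun do rewrite -mulN1r; apply: ccontM => //; exact: ccont_cst.
Qed.

Lemma ccontB f g : ccont f -> ccont g -> ccont (fun x => f x - g x).
Proof. by move=> cf cg; apply: ccontD => //; exact: ccontN. Qed.

Lemma ccont_comp f u : ccont f -> continuous u -> ccont (fun x => f (u x)).
Proof.
move=> [fr fi] cu; split => x.
  exact: (continuous_comp (cu x) (fr (u x))).
exact: (continuous_comp (cu x) (fi (u x))).
Qed.

Lemma ccont_cexp f : ccont f -> ccont (fun x => cexp (f x)).
Proof.
move=> [fr fi]; split.
  under eq_fun do rewrite Re_cexp; move=> x; apply: cvgM.
    exact: (continuous_comp (fr x) (@continuous_expR _ _)).
  exact: (continuous_comp (fi x) (@continuous_cos _ _)).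
under eq_fun do rewrite Im_cexp; move=> x; apply: cvgM.
  exact: (continuous_comp (fr x) (@continuous_expR _ _)).
exact: (continuous_comp (fi x) (@continuous_sin _ _)).
Qed.

Lemma ccont_conj f : ccont f -> ccont (fun x => (f x)^*).
Proof.
move=> [fr fi]; split.
  by rewrite (_ : (fun _ => _) = (fun x => complex.Re (f x)))//; apply/funext => x; case: (f x).
rewrite (_ : (fun _ => _) = (fun x => - complex.Im (f x))); last by apply/funext => x; case: (f x).
by move=> x; apply: cvgN; exact: fi.
Qed.

Lemma ccont_cmeas f (D : set (measurableTypeR R)) : measurable D -> ccont f -> cmeas D f.
Proof.
move=> mD [fr fi]; split; apply: measurable_funTS; exact: continuous_measurable_fun.
Qed.

Lemma ccont_cabs f : ccont f -> continuous (fun x => cabs (f x)).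
Proof.
move=> [fr fi] x; under eq_fun do rewrite cabsE.
apply: (@continuous_comp _ _ _ (fun x => complex.Re (f x) ^+ 2 + complex.Im (f x) ^+ 2) Num.sqrt).
  by apply: cvgD; under eq_fun do rewrite expr2; apply: cvgM; by [exact: fr|exact: fi].
exact: sqrt_continuous.
Qed.

Lemma ccont_bounded f a b : ccont f ->
  exists M, 0 <= M /\ forall x, a <= x <= b -> cabs (f x) <= M.
Proof.
move=> /ccont_cabs cf; have [ab|ab] := leP a b; last first.
  exists 0; split => // x /andP[ax xb].
  by have := lt_le_trans ab (le_trans ax xb); rewrite ltxx.
have [c _ H] := EVT_max ab (continuous_subspaceT cf).
exists (cabs (f c)); split; first exact: cabs_ge0.
by move=> x xab; apply: H; rewrite in_itv.
Qed.

Lemma integrable_itv_cst a b (M : R) : mu.-integrable `[a, b] (EFin \o (fun=> M)).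
Proof.
apply: continuous_compact_integrable; first exact: segment_compact.
by apply: continuous_subspaceT => x; exact: cvg_cst.
Qed.

Lemma ccont_integrable f a b : ccont f -> cintegrable mu `[a, b] f.
Proof.
move=> cf; have [M [_ H]] := ccont_bounded a b cf.
apply: (cintegrable_dom _ _ (integrable_itv_cst a b M)) => //.
exact: ccont_cmeas.
Qed.

Lemma cder_ccont F (F' : R -> R[i]) : (forall x, cder F x (F' x)) -> ccont F.
Proof.
move=> dF; split=> x; have [fr fi] := dF x.
  by apply: differentiable_continuous; apply/derivable1_diffP; exact: ex_derive.
by apply: differentiable_continuous; apply/derivable1_diffP; exact: ex_derive.
Qed.

Lemma is_derive_add u v x (du dv : R) :
  is_derive x 1 u du -> is_derive x 1 v dv ->
  is_derive x 1 (fun y => u y + v y) (du + dv).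
Proof. exact: is_deriveD. Qed.

Lemma is_derive_sub u v x (du dv : R) :
  is_derive x 1 u du -> is_derive x 1 v dv ->
  is_derive x 1 (fun y => u y - v y) (du - dv).
Proof. exact: is_deriveB. Qed.

Lemma is_derive_mul u v x (du dv : R) :
  is_derive x 1 u du -> is_derive x 1 v dv ->
  is_derive x 1 (fun y => u y * v y) (du * v x + u x * dv).
Proof.
move=> hu hv; have := @is_deriveM _ _ u v x 1 _ _ hu hv.
by rewrite /GRing.scale /= addrC (mulrC (v x)).
Qed.

Lemma cder_cst (c : R[i]) x : cder (fun=> c) x 0.
Proof. by split; exact: is_derive_cst. Qed.

Lemma cder_real u x d : is_derive x 1 u d -> cder (fun x => (u x)%:C) x d%:C.
Proof. by move=> du; split => //=; exact: is_derive_cst. Qed.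

Lemma cder_id x : cder (fun x => x%:C) x 1.
Proof. by apply: (@cder_real id x 1); exact: is_derive_id. Qed.

Lemma cderD F G x d e : cder F x d -> cder G x e -> cder (fun x => F x + G x) x (d + e).
Proof.
move=> [fr fi] [gr gi]; split.
  by under eq_fun do rewrite Re_add; rewrite Re_add; apply: is_derive_add.
by under eq_fun do rewrite Im_add; rewrite Im_add; apply: is_derive_add.
Qed.

Lemma cderM F G x d e :
  cder F x d -> cder G x e -> cder (fun x => F x * G x) x (d * G x + F x * e).
Proof.
move=> [fr fi] [gr gi]; split.
  under eq_fun do rewrite Re_mul.
  apply: is_derive_eq (is_derive_sub (is_derive_mul fr gr) (is_derive_mul fi gi)) _.
  by rewrite Re_add !Re_mul /GRing.scale /=; ring.
under eq_fun do rewrite Im_mul.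
apply: is_derive_eq (is_derive_add (is_derive_mul fr gi) (is_derive_mul fi gr)) _.
by rewrite Im_add !Im_mul /GRing.scale /=; ring.
Qed.

Lemma cder_eq F x d e : cder F x d -> d = e -> cder F x e.
Proof. by move=> + <-. Qed.

Lemma cderZ F x d (c : R[i]) : cder F x d -> cder (fun x => c * F x) x (c * d).
Proof.
by move=> dF; apply: cder_eq (cderM (cder_cst c x) dF) _; rewrite mul0r add0r.
Qed.

Lemma cderN F x d : cder F x d -> cder (fun x => - F x) x (- d).
Proof.
by move=> dF; under eq_fun do rewrite -mulN1r; apply: cder_eq (cderZ (-1) dF) _; rewrite mulN1r.
Qed.

Lemma cderB F G x d e : cder F x d -> cder G x e -> cder (fun x => F x - G x) x (d - e).
Proof. by move=> dF dG; apply: cderD => //; exact: cderN. Qed.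

Lemma cder_cexp F x d : cder F x d -> cder (fun x => cexp (F x)) x (d * cexp (F x)).
Proof.
move=> [fr fi]; split.
  under eq_fun do rewrite Re_cexp.
  apply: is_derive_eq.
  by rewrite Re_mul Re_cexp Im_cexp /GRing.scale /=; ring.
under eq_fun do rewrite Im_cexp.
apply: is_derive_eq.
by rewrite Im_mul Re_cexp Im_cexp /GRing.scale /=; ring.
Qed.

Lemma cder_lin (c : R[i]) x : cder (fun x => c * x%:C) x c.
Proof. by apply: cder_eq (cderZ c (cder_id x)) _; rewrite mulr1. Qed.

Lemma ccont_lin (c : R[i]) : ccont (fun x => c * x%:C).
Proof. exact: (cder_ccont (F' := fun=> c) (cder_lin c)). Qed.

Lemma Rintegral_FTC u (u' : R -> R) a b : a <= b -> continuous u' ->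
  (forall x, is_derive x 1 u (u' x)) -> Rintegral mu `[a, b] u' = u b - u a.
Proof.
rewrite le_eqVlt => /predU1P[->|ab] cu' du.
  by rewrite set_itv1 Rintegral_set1 subrr.
have cu : continuous u.
  move=> x; apply: differentiable_continuous; apply/derivable1_diffP.
  by have [] := du x.
rewrite /Rintegral (continuous_FTC2 (F := u) ab)//.
- exact: continuous_subspaceT.
- split; first by move=> x _; have [] := du x.
  + by apply: cvg_at_right_filter; exact: cu.
  + by apply: cvg_at_left_filter; exact: cu.
- by move=> x _; rewrite derive1E; have [_] := du x.
Qed.

Lemma cintegral_FTC F F' a b : a <= b -> ccont F' -> (forall x, cder F x (F' x)) ->
  cintegral mu `[a, b] F' = F b - F a.
Proof.
move=> ab [cr ci] dF; rewrite /cintegral.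
rewrite (Rintegral_FTC ab cr (fun x => (dF x).1)).
rewrite (Rintegral_FTC ab ci (fun x => (dF x).2)).
by apply: complex_ext; rewrite /= ?Re_add ?Im_add ?Re_opp ?Im_opp.
Qed.

(* Projecting the increment on its own direction reduces this to the real case. *)
Lemma cabs_increment F F' (v v' : R -> R) a b : a <= b ->
  (forall x, cder F x (F' x)) -> (forall x, is_derive x 1 v (v' x)) ->
  (forall x, a <= x <= b -> cabs (F' x) <= v' x) ->
  cabs (F b - F a) <= v b - v a.
Proof.
move=> ab dF dv H.
set I := F b - F a.
have [I0|I0] := eqVneq I 0.
  rewrite I0 cabs0 subr_ge0.
  apply: (@ger0_derive1_le_cc _ v a b); rewrite ?in_itv /= ?lexx ?ab //.
  - move=> x; rewrite in_itv /= => /andP[ax xb]; rewrite derive1E.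
    have [_ ->] := dv x; apply: le_trans (cabs_ge0 _) (H x _).
    by rewrite !ltW.
  - apply: continuous_subspaceT => x; apply: differentiable_continuous.
    by apply/derivable1_diffP; have [] := dv x.
pose w x := cabs I * v x - complex.Re (I^* * F x).
have dw x : is_derive x 1 w (cabs I * v' x - complex.Re (I^* * F' x)).
  apply: is_derive_sub; last by have [] := cderZ I^* (dF x).
have : w a <= w b.
  apply: (@ger0_derive1_le_cc _ w a b); rewrite ?in_itv /= ?lexx ?ab //.
  - move=> x; rewrite in_itv /= => /andP[ax xb]; rewrite derive1E.
    have [_ ->] := dw x; rewrite subr_ge0.
    rewrite (le_trans (ler_norm _))// (le_trans (Re_le_cabs _))// cabsM cabs_conj.
    by rewrite ler_wpM2l ?cabs_ge0// H// !ltW.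
  - apply: continuous_subspaceT => x; apply: differentiable_continuous.
    by apply/derivable1_diffP; have [] := dw x.
have cI : 0 < cabs I by rewrite cabs_gt0.
rewrite /w => wab; rewrite -(ler_pM2l cI) -expr2.
have -> : cabs I ^+ 2 = complex.Re (I^* * I) by rewrite mulrC mulcJ.
rewrite /I mulrBr Re_add Re_opp mulrBr -/I; lra.
Qed.

End RealVariable.

(** * Goursat's theorem *)

Section ExponentialTaylor.
Context {R : realType}.
Implicit Types (z w c : R[i]) (t x : R).

Definition cexp_poly n w : R[i] := \sum_(k < n) w ^+ k / k`!%:R.

Lemma cder_pow c n t :
  cder (fun t => (c * t%:C) ^+ n.+1) t (n.+1%:R * c * (c * t%:C) ^+ n).
Proof.
elim: n => [|n IH].
  under eq_fun do rewrite expr1.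
  by rewrite expr0 mulr1 mul1r; exact: cder_lin.
under eq_fun do rewrite exprS.
apply: cder_eq (cderM (cder_lin c t) IH) _.
by rewrite -[n.+2%:R]natr1 exprS; ring.
Qed.

Lemma cder_cexp_poly c n t :
  cder (fun t => cexp_poly n.+1 (c * t%:C)) t (c * cexp_poly n (c * t%:C)).
Proof.
elim: n => [|n IH].
  rewrite /cexp_poly big_ord0 mulr0.
  under eq_fun do rewrite big_ord_recl big_ord0 expr0 addr0.
  exact: cder_cst.
rewrite /cexp_poly; under eq_fun do rewrite big_ord_recr /=.
rewrite [X in c * X]big_ord_recr /= mulrDr; apply: cderD => //.
under eq_fun do rewrite mulrC.
apply: cder_eq (cderZ _ (cder_pow c n t)) _.
have n0 : n`!%:R != 0 :> R[i] by rewrite pnatr_eq0 -lt0n fact_gt0.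
have n1 : n.+1%:R != 0 :> R[i] by rewrite pnatr_eq0.
by rewrite factS natrM; field; rewrite n0 addrC natr1 n1.
Qed.

Lemma cexp_poly0 n : cexp_poly n.+1 (0 : R[i]) = 1.
Proof.
rewrite /cexp_poly big_ord_recl big1 => [|i _]; last by rewrite expr0n mul0r.
by rewrite expr0 fact0 divr1 addr0.
Qed.

(** Along the ray t |-> z t, the derivative of the remainder of order n + 1 is z times the remainder
    of order n, so induction on n and [cabs_increment] give the bound. Differentiating the factor
    exp(|z| t) only adds a nonnegative term to the majorant. *)
Lemma cexp_taylor n z :
  cabs (cexp z - cexp_poly n z) <= cabs z ^+ n / n`!%:R * expR (cabs z).
Proof.
suff H t : 0 <= t -> cabs (cexp (z * t%:C) - cexp_poly n (z * t%:C)) <=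
    (cabs z * t) ^+ n / n`!%:R * expR (cabs z * t).
  by have := H 1 ler01; rewrite !mulr1.
elim: n t => [|n IH] t t0.
  rewrite /cexp_poly big_ord0 subr0 expr0 fact0 divr1 mul1r.
  rewrite (le_trans (cabs_cexp_le _))// cabsM cabs_real ger0_norm//.
pose F t := cexp (z * t%:C) - cexp_poly n.+1 (z * t%:C).
pose F' t := z * (cexp (z * t%:C) - cexp_poly n (z * t%:C)).
pose v t : R := (cabs z * t) ^+ n.+1 / n.+1`!%:R * expR (cabs z * t).
pose v' t : R := cabs z * ((cabs z * t) ^+ n / n`!%:R * expR (cabs z * t)) +
  cabs z * ((cabs z * t) ^+ n.+1 / n.+1`!%:R * expR (cabs z * t)).
have dF x : cder F x (F' x).
  rewrite /F' mulrBr; apply: cderB; last exact: cder_cexp_poly.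
  exact: cder_cexp (cder_lin z x).
have dv x : is_derive x 1 v (v' x).
  have n0 : n`!%:R != 0 :> R by rewrite pnatr_eq0 -lt0n fact_gt0.
  have n1 : n.+1%:R != 0 :> R by rewrite pnatr_eq0.
  have dl (y : R) : is_derive y 1 (fun t : R => cabs z * t) (cabs z).
    by apply: is_derive_eq; rewrite /GRing.scale /= mulr1.
  have dp m : is_derive x 1 (fun t : R => (cabs z * t) ^+ m.+1) (m.+1%:R * cabs z * (cabs z * x) ^+ m).
    elim: m => [|m IHm].
      by under eq_fun do rewrite expr1; rewrite mul1r expr0 mulr1.
    under eq_fun do rewrite exprS.
    apply: is_derive_eq (is_derive_mul (dl x) IHm) _.
    by rewrite -[m.+2%:R]natr1 exprS; ring.
  have de := @is_derive1_comp _ expR _ _ _ _ (is_derive_expR _) (dl x).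
  have dc : is_derive x 1 (fun _ : R => (n.+1)`!%:R^-1 : R) 0 by exact: is_derive_cst.
  apply: is_derive_eq (is_derive_mul (is_derive_mul (dp n) dc) de) _.
  rewrite /v' /= factS natrM; field.
  by rewrite n0 addrC natr1 n1.
have v0 : v 0 = 0 by rewrite /v mulr0 expr0n /= mul0r mul0r.
have F0 : F 0 = 0 by rewrite /F mulr0 cexp0 cexp_poly0 subrr.
have := cabs_increment t0 dF dv; rewrite v0 F0 !subr0; apply.
move=> x /andP[x0 xt]; rewrite /F' cabsM /v'.
rewrite -[leLHS]addr0 lerD//; first by rewrite ler_wpM2l ?cabs_ge0// IH.
by rewrite !mulr_ge0 ?cabs_ge0// ?invr_ge0 ?exprn_ge0 ?mulr_ge0 ?cabs_ge0 ?expR_ge0.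
Qed.

End ExponentialTaylor.

(** * Complex differentiability as a first-order expansion *)

Section ComplexDifferentiability.
Context {R : realType}.
Implicit Types (f g : R[i] -> R[i]) (z w d e : R[i]).

(** Complex differentiability at [z] with derivative [d], with real epsilon and radius: increments
    are then estimated by inequalities between real numbers. *)
Definition cdiff f z d := forall eps : R, 0 < eps -> exists2 r : R, 0 < r &
  forall w, cabs (w - z) < r -> cabs (f w - f z - d * (w - z)) <= eps * cabs (w - z).

Lemma cdiff_bound f z d : cdiff f z d -> exists2 r : R, 0 < r &
  forall w, cabs (w - z) < r -> cabs (f w - f z) <= (cabs d + 1) * cabs (w - z).
Proof.
move=> /(_ 1 ltr01)[r r0 H]; exists r => // w /H.
move=> h; rewrite -[f w - f z](subrK (d * (w - z))) (le_trans (cabsD _ _))//.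
by rewrite cabsM; lra.
Qed.

Lemma derivable_cdiff f z :
  derivable (f : R[i]^o -> R[i]^o) z 1 <-> exists d, cdiff f z d.
Proof.
split.
  move=> /cvg_ex[/= d /cvgrPdist_le H]; exists d => e e0.
  have /H : 0 < e%:C :> R[i] by rewrite ltcR.
  rewrite /dnbhs /within /= => /nbhs_ballP[r /= r0 Hr].
  have rE : r = (complex.Re r)%:C.
    by have := gtr0_real r0 => /RRe_real.
  exists (complex.Re r); first by rewrite rE ltcR in r0.
  move=> w wz; have [->|wz0] := eqVneq w z.
    by rewrite !subrr mulr0 subrr cabs0 mulr0.
  have wz1 : w - z != 0 by rewrite subr_eq0.
  have := Hr (w - z); rewrite /ball /= sub0r normrN normC_cabs rE ltcR.
  move=> /(_ wz wz1).
  rewrite /GRing.scale /= mulr1 subrK normC_cabs lecR => h.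
  have -> : f w - f z - d * (w - z) = - ((w - z) * (d - (w - z)^-1 * (f w - f z))).
    by field.
  by rewrite cabsN cabsM mulrC ler_wpM2r// cabs_ge0.
move=> [d H]; apply/cvg_ex; exists d; apply/cvgrPdist_le => e e0.
have eE : e = (complex.Re e)%:C by have := gtr0_real e0 => /RRe_real.
have [|r r0 Hr] := H (complex.Re e); first by rewrite eE ltcR in e0.
rewrite /dnbhs /within /=; apply/nbhs_ballP; exists r%:C; rewrite /= ?ltcR//.
move=> h; rewrite /ball /= sub0r normrN normC_cabs ltcR => hr h0.
have := Hr (h + z); rewrite addrK => /(_ hr).
rewrite /GRing.scale /= mulr1 normC_cabs eE lecR => k.
have ch : 0 < cabs h by rewrite cabs_gt0.
rewrite -(ler_pM2r ch) (le_trans _ k)// -cabsM -cabsN.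
by rewrite (_ : - _ = f (h + z) - f z - d * h)//; field.
Qed.

Lemma entireP f : entire f <-> forall z, exists d, cdiff f z d.
Proof. by split=> H z; apply/derivable_cdiff; exact: H. Qed.

Lemma cdiff_cst z c : cdiff (fun=> c) z 0.
Proof.
by move=> e e0; exists 1 => // w _; rewrite subrr mul0r subrr cabs0 mulr_ge0 ?cabs_ge0 ?ltW.
Qed.

Lemma cdiff_lin z (a b : R[i]) : cdiff (fun w => a * w + b) z a.
Proof.
move=> e e0; exists 1 => // w _; rewrite (_ : _ - _ = 0); last by ring.
by rewrite cabs0 mulr_ge0 ?cabs_ge0 ?ltW.
Qed.

Lemma cdiffD f g z d e : cdiff f z d -> cdiff g z e ->
  cdiff (fun w => f w + g w) z (d + e).
Proof.
move=> hf hg eps e0; have e2 : 0 < eps / 2 by rewrite divr_gt0.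
have [r r0 H] := hf _ e2; have [s s0 K] := hg _ e2.
exists (Num.min r s); first by rewrite lt_min r0.
move=> w; rewrite lt_min => /andP[/H h /K k].
rewrite (_ : _ - _ = (f w - f z - d * (w - z)) + (g w - g z - e * (w - z))); last by ring.
by rewrite (le_trans (cabsD _ _))//; lra.
Qed.

Lemma cdiff_quad f z d (M r : R) : 0 < r ->
  (forall w, cabs (w - z) < r -> cabs (f w - f z - d * (w - z)) <= M * cabs (w - z) ^+ 2) ->
  cdiff f z d.
Proof.
move=> r0 H e e0.
exists (Num.min r (e / (`|M| + 1))); first by rewrite lt_min r0 divr_gt0// ltr_wpDl.
move=> w; rewrite lt_min => /andP[/H h].
rewrite ltr_pdivlMr ?ltr_wpDl// => k.
rewrite (le_trans h)// expr2 mulrA ler_wpM2r ?cabs_ge0//.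
have := cabs_ge0 (w - z) => c0.
rewrite (le_trans _ (ltW k))// [leRHS]mulrC ler_wpM2r// .
by rewrite (le_trans (ler_norm _))// lerDl.
Qed.

Lemma cdiffM f g z d e : cdiff f z d -> cdiff g z e ->
  cdiff (fun w => f w * g w) z (d * g z + f z * e).
Proof.
move=> hf hg eps e0.
have [r0 r0p Hf0] := cdiff_bound hf.
pose M := cabs (f z) + cabs (g z) + (cabs d + 1) * (cabs e + 1) + 1.
have M0 : 0 < M.
  by rewrite ltr_wpDl// !addr_ge0 ?mulr_ge0 ?addr_ge0 ?cabs_ge0.
have e3 : 0 < eps / (3 * M) by rewrite divr_gt0// mulr_gt0.
have [s0 s0p Hg0] := cdiff_bound hg.
have [r rp H] := hf _ e3; have [s sp K] := hg _ e3.
exists (Num.min (Num.min r s) (Num.min (Num.min r0 s0) (eps / (3 * M)))).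
  by rewrite !lt_min rp sp r0p s0p e3.
move=> w; rewrite !lt_min => /andP[/andP[/H h /K k]] /andP[/andP[/Hf0 h0 /Hg0 k0] q].
rewrite (_ : _ - _ = (f w - f z - d * (w - z)) * g z + f z * (g w - g z - e * (w - z))
  + (f w - f z) * (g w - g z)); last by ring.
rewrite (le_trans (cabsD _ _))// (le_trans (lerD (cabsD _ _) (lexx _)))// !cabsM.
set x := cabs (w - z) in h k h0 k0 q *.
have x0 : 0 <= x by exact: cabs_ge0.
have t1 : cabs (f w - f z - d * (w - z)) * cabs (g z) <= eps / (3 * M) * x * M.
  rewrite ler_pM ?cabs_ge0// /M.
  have := cabs_ge0 (f z).
  have : 0 <= (cabs d + 1) * (cabs e + 1) by rewrite mulr_ge0 ?addr_ge0 ?cabs_ge0.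
  lra.
have t2 : cabs (f z) * cabs (g w - g z - e * (w - z)) <= M * (eps / (3 * M) * x).
  rewrite ler_pM ?cabs_ge0// /M; have := cabs_ge0 (g z);
     have : 0 <= (cabs d + 1) * (cabs e + 1) by rewrite mulr_ge0 ?addr_ge0 ?cabs_ge0.
  lra.
have t3 : cabs (f w - f z) * cabs (g w - g z) <= M * x * (eps / (3 * M)).
  rewrite (le_trans (ler_pM _ _ h0 k0)) ?cabs_ge0//.
  rewrite [leLHS](_ : _ = (cabs d + 1) * (cabs e + 1) * x * x); last by ring.
  rewrite ler_pM ?mulr_ge0 ?addr_ge0 ?cabs_ge0 ?(ltW q)// ler_wpM2r// /M.
  have := cabs_ge0 (f z); have := cabs_ge0 (g z); lra.
have -> : eps * x = eps / (3 * M) * x * M + M * (eps / (3 * M) * x) + M * x * (eps / (3 * M)).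
  by field; rewrite gt_eqF.
by rewrite !lerD.
Qed.

Lemma cdiff_comp_lin f (a b z d : R[i]) : cdiff f (a * z + b) d ->
  cdiff (fun w => f (a * w + b)) z (a * d).
Proof.
move=> H e e0.
have [|r r0 K] := H (e / (cabs a + 1)).
  by rewrite divr_gt0// ltr_wpDl ?cabs_ge0.
have a0 : 0 < cabs a + 1 by rewrite ltr_wpDl ?cabs_ge0.
exists (r / (cabs a + 1)); first by rewrite divr_gt0.
move=> w wz; have E : a * w + b - (a * z + b) = a * (w - z) by ring.
have := K (a * w + b); rewrite E cabsM.
have c0 := cabs_ge0 (w - z); have ca := cabs_ge0 a.
rewrite ltr_pdivlMr// in wz.
have h : cabs a * cabs (w - z) < r.
  by rewrite (le_lt_trans _ wz)// mulrC ler_wpM2l// lerDl.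
move=> /(_ h); rewrite (_ : d * (a * (w - z)) = a * d * (w - z)); last by ring.
move=> k; rewrite (le_trans k)// -mulrA ler_wpM2l ?(ltW e0)//.
by rewrite ler_pdivrMl// ler_wpM2r// lerDl.
Qed.

Lemma cdiff_cexp z : cdiff cexp z (cexp z).
Proof.
apply: (@cdiff_quad _ _ _ (expR (complex.Re z) * expR 1) 1) => // w wz.
have -> : cexp w - cexp z - cexp z * (w - z) = cexp z * (cexp (w - z) - cexp_poly 2 (w - z)).
  rewrite /cexp_poly !big_ord_recl big_ord0 /= /bump /= !divr1 expr0 expr1 addr0.
  have -> : cexp w = cexp z * cexp (w - z) by rewrite -cexpD addrC subrK.
  by ring.
rewrite cabsM cabs_cexp -mulrA ler_wpM2l ?expR_ge0//.
rewrite (le_trans (cexp_taylor _ _))// mulrC ler_pM ?expR_ge0//.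
- by rewrite divr_ge0// exprn_ge0 ?cabs_ge0.
- by rewrite ler_expR ltW.
- rewrite ler_pdivrMr// ler_peMr ?exprn_ge0 ?cabs_ge0// ler1n//.
Qed.

Lemma entire_ccont f (p q : R[i]) : entire f -> ccont (fun t : R => f (p + q * t%:C)).
Proof.
move=> /entireP ef.
suff H : forall t (e : R), 0 < e -> exists2 r : R, 0 < r & forall s, `|t - s| < r ->
    cabs (f (p + q * t%:C) - f (p + q * s%:C)) < e.
  split => t; apply/cvgrPdist_lt => e e0; have [r r0 K] := H t e e0;
  near=> s; (apply: le_lt_trans (K s _); last by near: s; exact: cvgr_dist_lt).
    by rewrite -Re_opp -Re_add Re_le_cabs.
  by rewrite -Im_opp -Im_add Im_le_cabs.
move=> t e e0; have [d /cdiff_bound[r r0 K]] := ef (p + q * t%:C).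
have d0 : 0 < cabs d + 1 by rewrite ltr_wpDl ?cabs_ge0.
have q0 : 0 < cabs q + 1 by rewrite ltr_wpDl ?cabs_ge0.
exists (Num.min (r / (cabs q + 1)) (e / (cabs d + 1) / (cabs q + 1))).
  by rewrite lt_min !divr_gt0.
move=> s; rewrite lt_min !ltr_pdivlMr// => /andP[h1 h2].
have E : cabs (p + q * s%:C - (p + q * t%:C)) = cabs q * `|t - s|.
  rewrite (_ : _ - _ = q * (s - t)%:C); first by rewrite cabsM cabs_real distrC.
  by rewrite rmorphB /=; ring.
rewrite cabsBC; apply: le_lt_trans (K _ _) _; rewrite E.
  apply: le_lt_trans h1; rewrite mulrC ler_wpM2l// lerDl//.
apply: le_lt_trans h2; rewrite mulrC ler_wpM2r ?(ltW d0)//.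
by rewrite mulrC ler_wpM2l// lerDl.
Unshelve. all: by end_near. Qed.

End ComplexDifferentiability.

(** * Vanishing of contour integrals over parallelograms *)

Section Goursat.
Context {R : realType}.
Notation mu := (@lebesgue_measure R).

Lemma cintegral_split (f : R -> R[i]) (a c b : R) : ccont f -> a <= c -> c <= b ->
  cintegral mu `[a, b] f = cintegral mu `[a, c] f + cintegral mu `[c, b] f.
Proof.
move=> cf ac cb; have [fr fi] := ccont_integrable a b cf.
suff H (u : R -> R) : mu.-integrable `[a, b] (EFin \o u) ->
    Rintegral mu `[a, b] u = Rintegral mu `[a, c] u + Rintegral mu `[c, b] u.
  by rewrite /cintegral H// H//; apply: complex_ext; rewrite /= ?Re_add ?Im_add.
move=> iu; have := @Rintegral_itvB _ u (BLeft a) (BRight b) c iu.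
move=> /(_ ac cb); rewrite Rintegral_itv_obnd_cbnd; last first.
  by apply: integrableS iu => //; apply: subset_itvr; rewrite bnd_simp.
by move=> <-; rewrite addrC subrK.
Qed.

(** Nested squares with lower-left corner (a, b) and side l. Each new square lies inside the
    previous one, so the suprema of the corners give a point common to all, and the sides tend to
    0. *)
Lemma bisection (P : R -> R -> R -> Prop) (a b l : R) :
  (forall a b l, 0 < l -> P a b l -> exists a' b',
     [/\ a <= a' <= a + l / 2, b <= b' <= b + l / 2 & P a' b' (l / 2)]) ->
  0 < l -> P a b l ->
  exists x y, forall d, 0 < d -> exists a' b' l',
    [/\ 0 < l' < d, a' <= x <= a' + l', b' <= y <= b' + l' & P a' b' l'].
Proof.
move=> step l0 Pabl.
pose S := {s : R * R * R | 0 < s.2 /\ P s.1.1 s.1.2 s.2}.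
have next (s : S) : {t : S | [/\ (sval s).1.1 <= (sval t).1.1 <= (sval s).1.1 + (sval s).2 / 2,
    (sval s).1.2 <= (sval t).1.2 <= (sval s).1.2 + (sval s).2 / 2 &
    (sval t).2 = (sval s).2 / 2]}.
  apply: cid; case: s => [[[a1 b1] l1] /= [l1p Ps]].
  have [a' [b' [h1 h2 h3]]] := step _ _ _ l1p Ps.
  have l2 : 0 < l1 / 2 by rewrite divr_gt0.
  by exists (exist _ (a', b', l1 / 2) (conj l2 h3)).
pose s0 : S := exist _ (a, b, l) (conj l0 Pabl).
pose s := fix s n := if n is n'.+1 then sval (next (s n')) else s0.
pose A n := (sval (s n)).1.1; pose B n := (sval (s n)).1.2; pose L n := (sval (s n)).2.
have HA n : A n <= A n.+1 <= A n + L n / 2 by rewrite /A /L /=; case: (next _) => t /= [].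
have HB n : B n <= B n.+1 <= B n + L n / 2 by rewrite /B /L /=; case: (next _) => t /= [].
have HL n : L n.+1 = L n / 2 by rewrite /L /=; case: (next _) => t /= [].
have L0 n : 0 < L n by rewrite /L; case: (s n) => ? [].
have lim (X : nat -> R) : (forall n, X n <= X n.+1 <= X n + L n / 2) ->
    exists x, forall n, X n <= x <= X n + L n.
  move=> HX.
  have up n m : (n <= m)%N -> X n <= X m /\ X m + L m <= X n + L n.
    elim: m => [|m IH]; first by rewrite leqn0 => /eqP ->.
    rewrite leq_eqVlt => /predU1P[->//|]; rewrite ltnS => /IH[h1 h2].
    have /andP[k1 k2] := HX m; rewrite HL; split; first exact: le_trans k1.
    have := L0 m; lra.
  exists (sup (range X)) => n.
  have ub : ubound (range X) (X n + L n).
    move=> _ [m _ <-]; have [nm|mn] := leqP n m.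
      have [h1 h2] := up _ _ nm; have := L0 m; lra.
    have [h1 h2] := up _ _ (ltnW mn); have := L0 n; lra.
  apply/andP; split.
    by apply: ub_le_sup; [exists (X n + L n)|exists n].
  by apply: ge_sup => //; exists (X n), n.
have [x hx] := lim _ HA; have [y hy] := lim _ HB.
exists x, y => d d0.
have LE n : L n = l / 2 ^+ n.
  elim: n => [|n IH]; first by rewrite expr0 divr1.
  by rewrite HL IH exprS invfM mulrA mulrAC.
have [n hn] : exists n, L n < d.
  have /cvgrPdist_lt/(_ _ d0)[n _ /(_ n (leqnn n))] : (fun n => l * (2^-1) ^+ n) @ \oo --> (l * 0).
    apply: cvgMl_tmp; apply: cvg_expr; rewrite ger0_norm ?invr_ge0//.
    by rewrite invf_lt1// ltr1n.
  rewrite mulr0 sub0r normrN => h; exists n; rewrite LE (le_lt_trans (ler_norm _))//.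
  by rewrite -exprVn.
exists (A n), (B n), (L n); split => //; first by rewrite L0 hn.
by rewrite /A /B /L; case: (s n) => ? [].
Qed.

Lemma cintegral_cst (k : R[i]) (a b : R) : a <= b ->
  cintegral mu `[a, b] (fun=> k) = k * (b - a)%:C.
Proof.
move=> ab; rewrite (cintegral_FTC ab (ccont_cst k) (cder_lin k)).
by rewrite rmorphB /= mulrBr.
Qed.

Lemma Rintegral_itv_cst (M a b : R) : a <= b ->
  Rintegral mu `[a, b] (fun=> M) = M * (b - a).
Proof.
move=> ab; rewrite mulrBr; apply: (Rintegral_FTC (u := fun x => M * x) ab).
- by move=> x; exact: cvg_cst.
- by move=> x; apply: is_derive_eq; rewrite /GRing.scale /= mulr1.
Qed.

Lemma pigeonhole4 (M : R) (z1 z2 z3 z4 : R[i]) :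
  M + M + M + M <= cabs (z1 + z2 + z3 + z4) ->
  [\/ M <= cabs z1, M <= cabs z2, M <= cabs z3 | M <= cabs z4].
Proof.
have [c1|c1] := leP M (cabs z1); first by constructor.
have [c2|c2] := leP M (cabs z2); first by constructor.
have [c3|c3] := leP M (cabs z3); first by constructor.
have [c4|c4] := leP M (cabs z4); first by constructor.
have := cabsD (z1 + z2 + z3) z4; have := cabsD (z1 + z2) z3; have := cabsD z1 z2.
by move=> *; exfalso; lra.
Qed.

(** The integral along t |-> c + p t with respect to the real parameter; the factor [p] of the line
    element is supplied by [boundary_integral]. *)
Definition segment_integral (F : R[i] -> R[i]) (p c : R[i]) (a l : R) : R[i] :=
  cintegral mu `[a, a + l] (fun x => F (c + p * x%:C)).

Lemma segment_integralD F p c a l : entire F -> 0 <= l ->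
  segment_integral F p c a (l + l) =
  segment_integral F p c a l + segment_integral F p c (a + l) l.
Proof.
move=> eF l0; rewrite /segment_integral (@cintegral_split _ a (a + l)).
- by rewrite addrA.
- exact: entire_ccont.
- by rewrite lerDl.
- by rewrite addrA lerDl.
Qed.

Lemma segment_integral_dist F p c d k (M a l : R) : entire F -> 0 <= l ->
  (forall t, a <= t <= a + l -> cabs (F (c + p * t%:C) - F (d + p * t%:C) - k) <= M) ->
  cabs (segment_integral F p c a l - segment_integral F p d a l - k * l%:C) <= M * l.
Proof.
move=> eF l0 H; have al : a <= a + l by rewrite lerDl.
have cF c' := entire_ccont c' p eF.
have lE : l = a + l - a by rewrite addrAC subrr add0r.
rewrite /segment_integral -cintegralB//; [|exact: ccont_integrable..].
rewrite [in k * _]lE -(cintegral_cst k al) -cintegralB//; last first.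
- exact/ccont_integrable/ccont_cst.
- exact/ccont_integrable/ccontB.
rewrite [in leRHS]lE -Rintegral_itv_cst//; apply: cabs_cintegral => //.
- by apply: ccont_cmeas => //; apply: ccontB; [exact: ccontB|exact: ccont_cst].
- exact: integrable_itv_cst.
Qed.

Opaque segment_integral.

(** The contour integral around the parallelogram with corner p a + q b and edges p l, q l. Free
    directions let one theorem serve for the quadrants on both sides of the real half line. *)
Definition boundary_integral (F : R[i] -> R[i]) (p q : R[i]) (a b l : R) : R[i] :=
  p * (segment_integral F p (q * b%:C) a l - segment_integral F p (q * (b + l)%:C) a l) +
  q * (segment_integral F q (p * (a + l)%:C) b l - segment_integral F q (p * a%:C) b l).

Section Entire.
Variables (F : R[i] -> R[i]) (p q : R[i]).
Hypothesis eF : entire F.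
Notation E := (boundary_integral F p q).

Lemma boundary_integral_add (a b l : R) : 0 <= l ->
  E a b (l + l) = E a b l + E (a + l) b l + E a (b + l) l + E (a + l) (b + l) l.
Proof.
move=> l0; rewrite /boundary_integral !segment_integralD//.
have aE : a + (l + l) = a + l + l by rewrite addrA.
have bE : b + (l + l) = b + l + l by rewrite addrA.
rewrite aE bE.
(* The integrals are abstracted, so that the cancellation of the inner edges is a mere ring
   identity. *)
repeat match goal with |- context [segment_integral ?a ?b ?c ?d ?e] =>
  generalize (segment_integral a b c d e) end.
by move=> *; ring.
Qed.

(** On opposite sides the affine part of [F] differs by the constants - d q l and d p l; weighted
    with p and q, their contributions cancel. What remains is the error of differentiability, of
    order l times a small factor, over a contour of length O(l). *)
Lemma boundary_integral_local (x y : R) (e : R) : 0 < e -> exists2 r, 0 < r &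
  forall a b l, 0 < l < r -> a <= x <= a + l -> b <= y <= b + l ->
  cabs (E a b l) <= e * l ^+ 2.
Proof.
move=> e0; pose z := p * x%:C + q * y%:C.
have [d Hd] := (entireP F).1 eF z.
pose K := cabs p + cabs q + 1.
have K0 : 0 < K by rewrite ltr_wpDl// addr_ge0 ?cabs_ge0.
(* One factor [K] comes from the distance to [z], at most K l, the other from the weights |p| + |q|;
   the 2 counts the two sides in each difference. *)
pose e' := e / (2 * K * K).
have e'0 : 0 < e' by rewrite divr_gt0// !mulr_gt0.
have [r r0 H] := Hd _ e'0.
exists (r / K); first by rewrite divr_gt0.
move=> a b l /andP[l0]; rewrite ltr_pdivlMr// => lr hx hy.
pose G w := F w - F z - d * (w - z).
have GE u v : a <= u <= a + l -> b <= v <= b + l ->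
    cabs (G (p * u%:C + q * v%:C)) <= e' * (l * K).
  move=> hu hv.
  have w : cabs (p * u%:C + q * v%:C - z) <= l * K.
    rewrite (_ : _ - _ = p * (u - x)%:C + q * (v - y)%:C); last first.
      by rewrite /z !rmorphB /=; ring.
    rewrite (le_trans (cabsD _ _))// !cabsM !cabs_real /K.
    have h1 : `|u - x| <= l by rewrite ler_norml; lra.
    have h2 : `|v - y| <= l by rewrite ler_norml; lra.
    have := ler_wpM2l (cabs_ge0 p) h1; have := ler_wpM2l (cabs_ge0 q) h2.
    by rewrite mulrDr mulrDr mulr1 (mulrC l) (mulrC l); lra.
  by rewrite (le_trans (H _ (le_lt_trans w lr)))// ler_wpM2l// ltW.
have FG w : F w = G w + (F z - d * z) + d * w by rewrite /G; ring.
have hX : cabs (segment_integral F p (q * b%:C) a l - segment_integral F p (q * (b + l)%:C) a l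
    - - (d * q * l%:C) * l%:C) <= 2 * (e' * (l * K)) * l.
  apply: segment_integral_dist => //; first exact: ltW.
  move=> t ht; rewrite (addrC (q * b%:C)) (addrC (q * (b + l)%:C)) (FG (_ + q * b%:C)) (FG (_ + q * (b + l)%:C)).
  rewrite (_ : _ - _ = G (p * t%:C + q * b%:C) - G (p * t%:C + q * (b + l)%:C)); last first.
    by rewrite rmorphD /=; ring.
  rewrite (le_trans (cabsB _ _))// mulr_natl mulr2n lerD// GE//.
    by rewrite lexx lerDl ltW.
  by rewrite lexx lerDl ltW.
have hY : cabs (segment_integral F q (p * (a + l)%:C) b l - segment_integral F q (p * a%:C) b l
    - d * p * l%:C * l%:C) <= 2 * (e' * (l * K)) * l.
  apply: segment_integral_dist => //; first exact: ltW.
  move=> t ht; rewrite (FG (p * (a + l)%:C + _)) (FG (p * a%:C + _)).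
  rewrite (_ : _ - _ = G (p * (a + l)%:C + q * t%:C) - G (p * a%:C + q * t%:C)); last first.
    by rewrite rmorphD /=; ring.
  rewrite (le_trans (cabsB _ _))// mulr_natl mulr2n lerD// GE//.
    by rewrite lexx lerDl ltW.
  by rewrite lexx lerDl ltW.
rewrite /boundary_integral.
set I1 := _ - _ in hX *; set I2 := _ - _ in hY *.
rewrite [X in cabs X](_ : _ = p * I1 + q * I2); last by rewrite /I1 /I2; ring.
rewrite (le_trans (cabsD _ _))// !cabsM.
have := ler_wpM2l (cabs_ge0 p) hX; have := ler_wpM2l (cabs_ge0 q) hY => h1 h2.
rewrite (le_trans (lerD h2 h1))// -mulrDl.
have -> : e * l ^+ 2 = K * (2 * (e' * (l * K)) * l).
  by rewrite /e'; field; rewrite gt_eqF.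
rewrite ler_wpM2r// ?lerDl//.
exact: mulr_ge0 (mulr_ge0 (ler0n _ 2) (mulr_ge0 (ltW e'0) (mulr_ge0 (ltW l0) (ltW K0)))) (ltW l0).
Qed.

Theorem goursat (a b l : R) : 0 < l -> E a b l = 0.
Proof.
move=> l0; apply/eqP/contraT => E0.
pose m := cabs (E a b l) / l ^+ 2.
have m0 : 0 < m by rewrite divr_gt0 ?exprn_gt0// cabs_gt0.
(* The four quarters of a square share its boundary integral, so one of them inherits [P] with the
   same [m]. The local estimate with m / 2 contradicts this at the common point. *)
pose P a b l := m * l ^+ 2 <= cabs (E a b l).
have := @bisection P a b l _ l0; case.
- move=> a1 b1 l1 l1p; rewrite /P => H.
  have hl : l1 / 2 + l1 / 2 = l1 by rewrite -splitr.
  have := @boundary_integral_add a1 b1 (l1 / 2); rewrite hl => H2.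
  have {}H2 := H2 (ltW (divr_gt0 l1p (ltr0n _ 2))).
  set h := l1 / 2 in H2 hl *.
  have h0 : 0 < h by rewrite divr_gt0.
  have in1 (c : R) : c <= c <= c + h by rewrite lexx lerDl ltW.
  have in2 (c : R) : c <= c + h <= c + h by rewrite lexx lerDl ltW.
  rewrite H2 in H; move: H.
  have -> : m * l1 ^+ 2 = m * h ^+ 2 + m * h ^+ 2 + m * h ^+ 2 + m * h ^+ 2.
    by rewrite -hl; ring.
  move=> /pigeonhole4[c1|c2|c3|c4].
  - by exists a1, b1.
  - by exists (a1 + h), b1.
  - by exists a1, (b1 + h).
  - by exists (a1 + h), (b1 + h).
- by rewrite /P /m mulfVK// gt_eqF// exprn_gt0.
- move=> x [y H]; have m2 : 0 < m / 2 by rewrite divr_gt0.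
  have [r r0 K] := boundary_integral_local x y m2.
  have [a' [b' [l' [hl ha hb]]]] := H _ r0; rewrite /P => h.
  have := K _ _ _ hl ha hb; have /andP[l'0 _] := hl.
  have : 0 < m * l' ^+ 2 by rewrite mulr_gt0// exprn_gt0.
  lra.
Qed.

End Entire.
Transparent segment_integral.

End Goursat.

(** * Fourier integrals on a half line *)

Section LocalExpansion.
Context {R : realType}.
Implicit Types (h : R -> R[i]) (s d r : R).

(** A power series expansion at [s] in quantitative form: one radius and one constant make the
    remainder after n terms geometrically small for all n. *)
Definition local_expansion h s := exists r C (c : nat -> R[i]), 0 < r /\
  forall n d, `|d| <= r ->
    cabs (h (s + d) - \sum_(k < n) c k * d%:C ^+ k) <= C * (`|d| / r) ^+ n.

Lemma local_expansionB h1 h2 s : local_expansion h1 s -> local_expansion h2 s ->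
  local_expansion (fun s => h1 s - h2 s) s.
Proof.
move=> [r1 [C1 [c1 [r10 H1]]]] [r2 [C2 [c2 [r20 H2]]]].
have C10 : 0 <= C1.
  by have := H1 0 0; rewrite normr0 expr0 mulr1 => /(_ (ltW r10)); apply: le_trans (cabs_ge0 _).
have C20 : 0 <= C2.
  by have := H2 0 0; rewrite normr0 expr0 mulr1 => /(_ (ltW r20)); apply: le_trans (cabs_ge0 _).
pose r := Num.min r1 r2.
have r0 : 0 < r by rewrite lt_min r10.
exists r, (C1 + C2), (fun k => c1 k - c2 k); split => // n d dr.
have dr1 : `|d| <= r1 by rewrite (le_trans dr)// ge_min lexx.
have dr2 : `|d| <= r2 by rewrite (le_trans dr)// ge_min lexx orbT.
have -> : \sum_(k < n) (c1 k - c2 k) * d%:C ^+ k =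
    \sum_(k < n) c1 k * d%:C ^+ k - \sum_(k < n) c2 k * d%:C ^+ k.
  by rewrite -sumrB; apply: eq_bigr => k _; rewrite mulrBl.
set S1 := \sum_(k < n) c1 k * _; set S2 := \sum_(k < n) c2 k * _.
rewrite (_ : _ - _ = h1 (s + d) - S1 - (h2 (s + d) - S2)); last by ring.
rewrite (le_trans (cabsB _ _))// mulrDl lerD//.
  rewrite (le_trans (H1 _ _ dr1))// ler_wpM2l// lerXn2r ?nnegrE ?divr_ge0 ?(ltW r10) ?(ltW r0)//.
  by rewrite ler_wpM2l// lef_pV2 ?posrE// ge_min lexx.
rewrite (le_trans (H2 _ _ dr2))// ler_wpM2l// lerXn2r ?nnegrE ?divr_ge0 ?(ltW r20) ?(ltW r0)//.
by rewrite ler_wpM2l// lef_pV2 ?posrE// ge_min lexx orbT.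
Qed.

Lemma le0_lim (x C : R) : 0 <= C -> (forall e : R, 0 < e -> x <= C * e) -> x <= 0.
Proof.
move=> C0 H; apply/ler_addgt0Pr => e e0; rewrite add0r.
have := H (e / (C + 1)); rewrite divr_gt0 ?ltr_wpDl// => /(_ isT) h.
by rewrite (le_trans h)// mulrC -mulrA ler_piMr ?(ltW e0)// ler_pdivrMl ?ltr_wpDl// mulr1 lerDl.
Qed.

(** If the earlier coefficients vanish, then |c n| d^n <= C (d / r)^(n+1) for small d > 0, because
    [h] is 0 there; letting d tend to 0 kills c n. With no terms left, |h (s + d)| <= C 2^-n for |d|
    <= r / 2 and every n. *)
Lemma local_expansion_eq0 h s : local_expansion h s ->
  (forall s', s < s' -> h s' = 0) -> exists2 r : R, 0 < r & forall d, `|d| <= r -> h (s + d) = 0.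
Proof.
move=> [r [C [c [r0 H]]]] h0.
have C0 : 0 <= C.
  by have := H 0 0; rewrite normr0 expr0 mulr1 => /(_ (ltW r0)); apply: le_trans (cabs_ge0 _).
have c0 n : c n = 0.
  elim/ltn_ind: n => n IH; apply/eqP; rewrite -cabs_eq0 eq_le cabs_ge0 andbT.
  apply: (@le0_lim _ (C / r ^+ n)); first by rewrite divr_ge0 ?exprn_ge0 ?(ltW r0).
  (* This [d] is admissible, being at most r, and satisfies d / r <= e. *)
  move=> e e0; pose d := r * Num.min e 1.
  have m0 : 0 < Num.min e 1 by rewrite lt_min e0 ltr01.
  have d0 : 0 < d by rewrite mulr_gt0.
  have dn : `|d| = d by rewrite gtr0_norm.
  have dr : `|d| <= r by rewrite dn /d ler_piMr ?(ltW r0)// ge_min lexx orbT.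
  have := H n.+1 d dr; rewrite h0 ?ltrDl// big_ord_recr /= big1; last first.
    by move=> k _; rewrite IH// mul0r.
  rewrite [X in cabs X](_ : _ = - (c n * d%:C ^+ n)); last by ring.
  rewrite cabsN cabsM cabsX cabs_real dn exprS => k.
  have dnp : 0 < d ^+ n by rewrite exprn_gt0.
  rewrite -(ler_pM2r dnp) (le_trans k)// expr_div_n.
  rewrite (_ : C * _ = d / r * (C / r ^+ n * d ^+ n)); last by ring.
  rewrite (_ : C / r ^+ n * e * d ^+ n = e * (C / r ^+ n * d ^+ n)); last by ring.
  rewrite ler_wpM2r//.
    by rewrite mulr_ge0 ?divr_ge0 ?exprn_ge0 ?(ltW r0) ?(ltW d0).
  by rewrite /d mulrC mulKf ?gt_eqF// ge_min lexx.
exists (r / 2); first by rewrite divr_gt0.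
move=> d dr; apply/eqP; rewrite -cabs_eq0 eq_le cabs_ge0 andbT.
apply: (@le0_lim _ C C0) => e e0.
have [n hn] : exists n, (2^-1 : R) ^+ n < e.
  have /cvgrPdist_lt/(_ _ e0)[n _ /(_ n (leqnn n))] : (fun n => (2^-1 : R) ^+ n) @ \oo --> (0 : R).
    by apply: cvg_expr; rewrite ger0_norm ?invr_ge0// invf_lt1// ltr1n.
  by rewrite sub0r normrN => hn; exists n; rewrite (le_lt_trans (ler_norm _)).
have dr' : `|d| <= r by rewrite (le_trans dr)// ler_pdivrMr// ler_peMr ?(ltW r0)// ler1n.
have := H n d dr'; rewrite big1 => [|k _]; last by rewrite c0 mul0r.
rewrite subr0 => k; rewrite (le_trans k)// ler_wpM2l// (le_trans _ (ltW hn))//.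
rewrite lerXn2r ?nnegrE ?divr_ge0 ?(ltW r0) ?invr_ge0//.
by rewrite ler_pdivrMr// mulrC.
Qed.

(* An expansion with geometric remainder at [s] forces [h] to vanish to the left of [s]
   as soon as it vanishes to the right. *)
Lemma identity_theorem h (s0 : R) :
  (forall s, 0 < s -> local_expansion h s) -> (forall s, s0 < s -> h s = 0) ->
  forall s, 0 < s -> h s = 0.
Proof.
move=> He H0 s1 s10; apply/eqP/contraT => hs1.
pose S := [set s | 0 < s /\ forall s', s < s' -> h s' = 0].
have Sne : S !=set0.
  exists (Num.max s0 1); split; first by rewrite lt_max ltr01 orbT.
  by move=> s'; rewrite gt_max => /andP[/H0].
have Slb : lbound S s1.
  by move=> s [s_gt0 Hs]; rewrite leNgt; apply: contra hs1 => /Hs ->.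
have hS : has_inf S by split => //; exists s1.
pose m := inf S.
have m0 : 0 < m by rewrite (lt_le_trans s10)//; exact: lb_le_inf.
have Hm s : m < s -> h s = 0.
  move=> ms; have e0 : 0 < s - m by rewrite subr_gt0.
  have [x [x0 Hx]] := inf_adherent e0 hS.
  by rewrite -/m addrC subrK => /Hx.
have [r r0 Hr] := local_expansion_eq0 (He m m0) Hm.
pose d := Num.min r (m / 2).
have d0 : 0 < d by rewrite lt_min r0 divr_gt0.
have : S (m - d).
  split.
    rewrite subr_gt0 (@le_lt_trans _ _ (m / 2)) ?ge_min ?lexx ?orbT//.
    by rewrite ltr_pdivrMr// ltr_pMr// ltr1n.
  move=> s' hs'; have [s'm|] := leP s' m; last exact: Hm.
  rewrite -(subrK m s') addrC; apply: Hr; rewrite ler_norml.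
  have : d <= r by rewrite ge_min lexx.
  by move=> dr; apply/andP; split; lra.
move=> /(ge_inf hS.2); rewrite -/m; lra.
Qed.

End LocalExpansion.

(** * Laplace integrals and their dependence on the parameter *)

Section HalfLine.
Context {R : realType}.
Notation mu := (@lebesgue_measure R).
Notation T := (measurableTypeR R).
Notation Dp := (`[(0 : R), +oo[%classic : set T).

Lemma cvg_expRN (c : R) : 0 < c -> expR (- (c * x)) @[x --> +oo] --> (0 : R).
Proof.
move=> c0; apply: (@cvg_comp _ _ _ (fun x => c * x) (fun x => expR (- x))); last exact: cvgr_expR.
exact: gt0_cvgMry.
Qed.

Lemma integrable_expRN (c : R) : 0 < c -> mu.-integrable Dp (EFin \o (fun x => expR (- (c * x)))).
Proof.
move=> c0.
have cE : continuous (fun x : R => expR (- (c * x))).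
  move=> x; apply: (@continuous_comp _ _ _ (fun x => - (c * x)) expR); last exact: continuous_expR.
  by apply: cvgN; apply: cvgM; [exact: cvg_cst|exact: cvg_id].
apply/integrableP; split.
  apply/measurable_EFinP; apply: measurable_funTS; exact: continuous_measurable_fun.
under eq_integral do rewrite gee0_abs ?lee_fin ?expR_ge0//.
rewrite (@ge0_continuous_FTC2y _ _ (fun x => - c^-1 * expR (- (c * x))) 0 (- c^-1 * 0)).
- by rewrite -EFinB ltry.
- by move=> x _; exact: expR_ge0.
- exact: continuous_subspaceT.
- by apply: cvgM; [exact: cvg_cst|exact: cvg_expRN].
- by move=> x _; apply: ex_derive.
- apply: cvg_at_right_filter; apply: cvgM; [exact: cvg_cst|exact: cE].
- move=> x _; rewrite derive1E.
  have H : is_derive x 1 (fun x => - c^-1 * expR (- (c * x))) (expR (- (c * x))).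
    apply: is_derive_eq; rewrite /GRing.scale /=; field; exact: lt0r_neq0.
  by have [_ ->] := H.
Qed.

Lemma expX_le (y : R) n : 0 <= y -> y ^+ n / n`!%:R <= expR y.
Proof.
case: n => [|n] y0; first by rewrite expr0 fact0 divr1 -expR0 ler_expR.
by rewrite (le_trans _ (expR_ge1Dxn n y0))// lerDr.
Qed.

(** The coefficients come from expanding the exponential under the integral. The weight exp(r x) is
    split in two: one half dominates (r x / 2)^n / n!, the other the exponential in the Taylor
    remainder, whence the radius r / 2. *)
Lemma laplace_expansion (g : T -> R[i]) (k : R[i]) (r : R) : 0 < r -> cabs k <= 1 ->
  cmeas Dp g -> mu.-integrable Dp (EFin \o (fun x => cabs (g x) * expR (r * x))) ->
  exists C (c : nat -> R[i]), forall n d, `|d| <= r / 2 ->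
    cabs (cintegral mu Dp (fun x => g x * cexp (k * (d * x)%:C)) -
          \sum_(j < n) c j * d%:C ^+ j) <= C * (`|d| / (r / 2)) ^+ n.
Proof.
move=> r0 k1 mg ig.
have mD : measurable Dp by [].
have r20 : 0 < r / 2 by rewrite divr_gt0.
pose gj j (x : T) := g x * ((k * x%:C) ^+ j / j`!%:R).
have mx : cmeas Dp (fun x : T => k * x%:C).
  by apply: cmeasM; [exact: cmeas_cst|apply: cmeas_real; exact: measurable_id].
have mX j : cmeas Dp (fun x : T => (k * x%:C) ^+ j).
  elim: j => [|j IH]; first by under [X in cmeas _ X]eq_fun do rewrite expr0; exact: cmeas_cst.
  by under [X in cmeas _ X]eq_fun do rewrite exprS; exact: cmeasM.
have mgj j : cmeas Dp (gj j).
  by apply: cmeasM => //; apply: cmeasM => //; exact: cmeas_cst.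
have x0 x : Dp x -> 0 <= x by rewrite /= in_itv /= andbT.
have kx (x : R) : 0 <= x -> cabs (k * x%:C) <= x.
  by move=> h; rewrite cabsM cabs_real ger0_norm// ler_piMl.
have fac j : (0 : R) < j`!%:R by rewrite ltr0n fact_gt0.
have facC j : cabs (j`!%:R : R[i]) = j`!%:R.
  by rewrite (_ : j`!%:R = (j`!%:R : R)%:C) ?cabs_real ?ger0_norm ?(ltW (fac j))// rmorph_nat.
have igj j : cintegrable mu Dp (gj j).
  have i2 : mu.-integrable Dp (EFin \o (fun x => r^-1 ^+ j * (cabs (g x) * expR (r * x)))).
    exact: integrable_scale.
  apply: (cintegrable_dom mD (mgj j) i2) => x /x0 hx.
  rewrite /gj cabsM mulrCA ler_wpM2l ?cabs_ge0// cabsM cabsV cabsX facC.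
  rewrite (@le_trans _ _ (x ^+ j / j`!%:R))//.
    by rewrite ler_wpM2r ?invr_ge0 ?(ltW (fac j))// lerXn2r ?nnegrE ?cabs_ge0 ?kx.
  have := @expX_le (r * x) j (mulr_ge0 (ltW r0) hx).
  rewrite exprMn -mulrA -ler_pdivlMl ?exprn_gt0// => h.
  by rewrite (le_trans h)// exprVn.
exists (Rintegral mu Dp (fun x => cabs (g x) * expR (r * x))).
exists (fun j => cintegral mu Dp (gj j)).
move=> n d dr.
have Pbound (x : R) : 0 <= x ->
    cabs (cexp (k * (d * x)%:C) - cexp_poly n (k * (d * x)%:C)) <=
    (`|d| / (r / 2)) ^+ n * expR (r * x).
  move=> hx; rewrite (le_trans (cexp_taylor _ _))//.
  have kdx : cabs (k * (d * x)%:C) <= `|d| * x.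
    by rewrite cabsM cabs_real normrM (ger0_norm hx) ler_piMl// mulr_ge0.
  have h1 : `|d| * x <= r / 2 * x by rewrite ler_wpM2r.
  rewrite (_ : expR (r * x) = expR (r / 2 * x) * expR (r / 2 * x)); last first.
    by rewrite -expRD -mulrDl -splitr.
  rewrite mulrA ler_pM ?expR_ge0//.
  - by rewrite divr_ge0 ?exprn_ge0 ?cabs_ge0 ?(ltW (fac n)).
  - rewrite (@le_trans _ _ ((`|d| * x) ^+ n / n`!%:R))//.
      by rewrite ler_wpM2r ?invr_ge0 ?(ltW (fac n))// lerXn2r ?nnegrE ?cabs_ge0 ?mulr_ge0.
    rewrite (_ : (`|d| * x) ^+ n / n`!%:R = (`|d| / (r / 2)) ^+ n * ((r / 2 * x) ^+ n / n`!%:R)); last first.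
      by rewrite mulrA -exprMn; congr (_ ^+ _ / _); field; exact: lt0r_neq0.
    apply: ler_wpM2l; first by rewrite exprn_ge0// divr_ge0// ltW.
    by apply: expX_le; rewrite mulr_ge0// ltW.
  - by rewrite ler_expR (le_trans kdx).
have mE : cmeas Dp (fun x : T => g x * cexp (k * (d * x)%:C)).
  apply: cmeasM => //; apply: cmeas_cexp; apply: cmeasM; first exact: cmeas_cst.
  by apply: cmeas_real; apply: measurable_funM => //; exact: measurable_cst.
have sumE : forall x : T, \sum_(j < n) d%:C ^+ j * gj j x = g x * cexp_poly n (k * (d * x)%:C).
  move=> x; rewrite /cexp_poly mulr_sumr; apply: eq_bigr => j _.
  rewrite /gj (_ : k * (d * x)%:C = d%:C * (k * x%:C)); last by rewrite rmorphM /= mulrCA.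
  by rewrite [in RHS]exprMn mulrCA !mulrA.
have isum : forall m, cintegrable mu Dp (fun x => \sum_(j < m) d%:C ^+ j * gj j x) /\
    cintegral mu Dp (fun x => \sum_(j < m) d%:C ^+ j * gj j x) =
    \sum_(j < m) cintegral mu Dp (gj j) * d%:C ^+ j.
  elim=> [|m [IH1 IH2]].
    rewrite (_ : (fun x : T => _) = (fun=> 0)); last by apply/funext => x; rewrite big_ord0.
    rewrite big_ord0; split; first by split; exact: integrable0.
    by rewrite /cintegral /Rintegral !integral0.
  have h := cintegrableZl (d%:C ^+ m) mD (igj m).
  rewrite (_ : (fun x : T => _) = (fun x => \sum_(j < m) d%:C ^+ j * gj j x + d%:C ^+ m * gj m x)); last first.
    by apply/funext => x; rewrite big_ord_recr.
  split; first exact: cintegrableD.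
  by rewrite cintegralD// cintegralZl// IH2 big_ord_recr /= [in RHS](mulrC _ (d%:C ^+ m)).
have [is1 is2] := isum n.
have dom x : Dp x -> cabs (g x * cexp (k * (d * x)%:C)) <= cabs (g x) * expR (r * x).
  move=> /x0 hx; rewrite cabsM ler_wpM2l ?cabs_ge0// (le_trans (cabs_cexp_le _))// ler_expR.
  rewrite cabsM cabs_real normrM (ger0_norm hx) (@le_trans _ _ (`|d| * x))//.
    by rewrite ler_piMl// mulr_ge0.
  by rewrite ler_wpM2r// (le_trans dr)// ler_pdivrMr// ler_peMr ?(ltW r0)// ler1n.
have iE := cintegrable_dom mD mE ig dom.
rewrite -is2 -cintegralB// mulrC -RintegralZl//.
apply: cabs_cintegral => //.
- by apply: cmeasB => //; exact: cintegrable_meas is1.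
- exact: integrable_scale.
- move=> x /x0 hx; rewrite sumE -mulrBr cabsM mulrCA ler_wpM2l ?cabs_ge0//.
  exact: Pbound.
Qed.

End HalfLine.

(** * Rotation of a half line onto the imaginary axis *)

Section Rotation.
Context {R : realType}.
Notation mu := (@lebesgue_measure R).
Notation T := (measurableTypeR R).
Notation Dp := (`[(0 : R), +oo[%classic : set T).

Lemma cintegral_lim (g : T -> R[i]) (e : R) : cintegrable mu Dp g -> 0 < e ->
  exists N : nat, forall n, (N <= n)%N ->
    cabs (cintegral mu `[0, n%:R] g - cintegral mu Dp g) <= e.
Proof.
move=> ig e0; have mD : measurable Dp by [].
pose F n (x : T) := (\1_(`[0, n%:R]%classic : set T) x)%:C * g x.
have FE n : cintegral mu `[0, n%:R] g = cintegral mu Dp (F n).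
  rewrite cintegral_mkcond [RHS]cintegral_mkcond; apply: eq_cintegral => x _.
  rewrite /F mulrA; congr (_ * _); rewrite -rmorphM /= !indicE -natrM mulnb.
  congr ((_%:R)%:C); congr (nat_of_bool _).
  apply/idP/andP => [h|[]//]; split => //.
  by move: h; rewrite !inE /= !in_itv /= andbT => /andP[].
have mg := cintegrable_meas ig.
have [|||||_] := @cintegral_dct _ _ T mu Dp F g (fun x => cabs (g x)) mD.
- move=> n; apply: cmeasM => //; apply: cmeas_real.
  by apply: measurable_indic.
- by [].
- exact: cintegrable_cabs.
- move=> n x _; rewrite /F cabsM cabs_real indicE ger0_norm ?ler0n//.
  by rewrite ler_piMl ?cabs_ge0// lern1 leq_b1.
- move=> x; rewrite /= in_itv /= andbT => x0.
  apply: cvg_near_cst; near=> n.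
  rewrite /F indicE mem_set ?mul1r ?subrr ?cabs0//= in_itv /= x0 /=.
  by near: n; exact: nbhs_infty_ger.
move=> /cvgrPdist_le/(_ _ e0)[N _ HN]; exists N => n /HN.
by rewrite sub0r normrN ger0_norm ?cabs_ge0// FE.
Unshelve. all: by end_near. Qed.

Lemma entire_mul_cexp (f : R[i] -> R[i]) (w : R[i]) : entire f -> entire (fun z => f z * cexp (w * z)).
Proof.
move=> /entireP ef; apply/entireP => z; have [d Hd] := ef z.
exists (d * cexp (w * z) + f z * (w * cexp (w * z))).
apply: cdiffM => //; have := @cdiff_comp_lin _ cexp w 0 z (cexp (w * z + 0)) (cdiff_cexp _).
by rewrite addr0; under eq_fun do rewrite addr0.
Qed.

Variables (f : R[i] -> R[i]) (M tau : R) (sg : R).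
Hypothesis ef : entire f.
Hypothesis fM : forall z, cabs (f z) <= M * expR (tau * cabs z).
Hypothesis tau0 : 0 <= tau.
Hypothesis sg1 : sg ^+ 2 = 1.

Let M0 : 0 <= M.
Proof. by have := fM 0; rewrite cabs0 mulr0 expR0 mulr1; apply: le_trans (cabs_ge0 _). Qed.

Let q : R[i] := - 'i * sg%:C.
(** The real part of [w s t] is s and that of [w s t * q] is t: the factor [cexp (- w s t * z)]
    decays at rate s along the positive axis and at rate t along the ray of [q]. *)
Let w (s t : R) : R[i] := s%:C + 'i * (sg * t)%:C.
Let F s t z := f z * cexp (- w s t * z).

Let cabs_q : cabs q = 1.
Proof.
rewrite /q cabsM cabsN cabs_i mul1r cabs_real.
by apply/eqP; rewrite -(@eqrXn2 _ 2)// -normrX sg1 normr1 expr1n.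
Qed.

Let wq s t : - w s t * q = - t%:C + 'i * (sg * s)%:C.
Proof.
have i2 : 'i * 'i = -1 :> R[i] by rewrite -expr2 sqr_i.
have sgC : sg%:C * sg%:C = 1 :> R[i] by rewrite -rmorphM -expr2 sg1.
rewrite /w /q !rmorphM /=.
transitivity (('i * 'i) * (sg%:C * sg%:C) * t%:C + 'i * sg%:C * s%:C :> R[i]); first by ring.
by rewrite i2 sgC; ring.
Qed.

Lemma cabs_rotated (s t x y : R) : 0 <= x -> 0 <= y ->
  cabs (F s t (x%:C + q * y%:C)) <= M * expR ((tau - s) * x + (tau - t) * y).
Proof.
move=> x0 y0; rewrite /F cabsM cabs_cexp.
have -> : - w s t * (x%:C + q * y%:C) = - w s t * x%:C + (- w s t * q) * y%:C by ring.
rewrite wq Re_add.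
have -> : complex.Re (- w s t * x%:C) = - (s * x).
  by rewrite Re_mul /w /=; ring.
have -> : complex.Re ((- t%:C + 'i * (sg * s)%:C) * y%:C) = - (t * y).
  by rewrite Re_mul /=; ring.
rewrite (le_trans (ler_wpM2r (expR_ge0 _) (fM _)))// -mulrA -expRD ler_wpM2l// ler_expR.
have h : cabs (x%:C + q * y%:C) <= x + y.
  by rewrite (le_trans (cabsD _ _))// cabsM cabs_q mul1r !cabs_real !ger0_norm.
have := ler_wpM2l tau0 h; lra.
Qed.

Let cF1 s t : ccont (fun x : R => F s t x%:C).
Proof.
have := entire_ccont 0 1 (@entire_mul_cexp f (- w s t) ef).
by under eq_fun do rewrite add0r mul1r.
Qed.

Let cF2 s t : ccont (fun y : R => F s t (q * y%:C)).
Proof.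
have := entire_ccont 0 q (@entire_mul_cexp f (- w s t) ef).
by under eq_fun do rewrite add0r.
Qed.

Let iF2 s t : tau < t -> cintegrable mu Dp (fun y => F s t (q * y%:C)).
Proof.
move=> tt; have c0 : 0 < t - tau by rewrite subr_gt0.
have mD : measurable Dp by [].
apply: (cintegrable_dom mD _ (integrable_scale M mD (integrable_expRN c0))).
  exact: ccont_cmeas.
move=> y; rewrite /= in_itv /= andbT => y0.
have := @cabs_rotated s t 0 y (lexx _) y0; rewrite add0r mulr0 add0r => h.
by rewrite (le_trans h)// ler_wpM2l// ler_expR -mulNr opprB.
Qed.

(** Goursat's theorem on the square of side n with directions 1 and q. When both rates exceed the
    type, the two far sides are O(n exp(- c n)) and disappear as n grows. *)
Lemma rotation_large (s t : R) : tau < s -> tau < t ->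
  cintegral mu Dp (fun x => F s t x%:C) = q * cintegral mu Dp (fun y => F s t (q * y%:C)).
Proof.
move=> ts tt; have mD : measurable Dp by [].
have c0 : 0 < s - tau by rewrite subr_gt0.
have i1 : cintegrable mu Dp (fun x => F s t x%:C).
  apply: (cintegrable_dom mD _ (integrable_scale M mD (integrable_expRN c0))).
    exact: ccont_cmeas.
  move=> x; rewrite /= in_itv /= andbT => x0.
  have := @cabs_rotated s t x 0 x0 (lexx _); rewrite !mulr0 !addr0 => h.
  by rewrite (le_trans h)// ler_wpM2l// ler_expR -mulNr opprB.
have i2 := iF2 s tt.
pose c := Num.min (s - tau) (t - tau).
have cp : 0 < c by rewrite lt_min !subr_gt0 ts.
apply/eqP; rewrite -subr_eq0 -cabs_eq0 eq_le cabs_ge0 andbT.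
have H (n : nat) : (0 < n)%N ->
    cabs (cintegral mu `[0, n%:R] (fun x => F s t x%:C) -
      q * cintegral mu `[0, n%:R] (fun y => F s t (q * y%:C))) <= 2 * (M * expR (- (c * n%:R))) * n%:R.
  move=> n0; have n0' : 0 < n%:R :> R by rewrite ltr0n.
  have := goursat 1 q (@entire_mul_cexp f (- w s t) ef) 0 0 n0'.
  rewrite /boundary_integral !mul1r !mulr0 !add0r /segment_integral !add0r -/(F s t).
  rewrite -/(q * _).
  have -> : cintegral mu `[0, n%:R] (fun x => f (0 + 1 * x%:C) * cexp (- w s t * (0 + 1 * x%:C))) =
      cintegral mu `[0, n%:R] (fun x => F s t x%:C).
    by apply: eq_cintegral => x _; rewrite add0r mul1r.
  have -> : cintegral mu `[0, n%:R] (fun x => f (0 + q * x%:C) * cexp (- w s t * (0 + q * x%:C))) =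
      cintegral mu `[0, n%:R] (fun x => F s t (q * x%:C)).
    by apply: eq_cintegral => x _; rewrite add0r.
  set I1 := cintegral mu _ (fun x : R => F s t x%:C); set I2 := cintegral mu _ (fun x : R => F s t (q * x%:C)).
  set J1 := cintegral mu _ (fun x : R => _ * cexp (_ * (q * _ + _))); set J2 := cintegral mu _ (fun x : R => f (n%:R%:C + _) * _) => E.
  have -> : I1 - q * I2 = J1 - q * J2.
    by apply/eqP; rewrite -subr_eq0; apply/eqP; rewrite -E; ring.
  have e1 : n%:R - 0 = n%:R :> R by rewrite subr0.
  have b1 : cabs J1 <= M * expR (- (c * n%:R)) * n%:R.
    rewrite -[X in _ * X]e1 -Rintegral_itv_cst ?ler0n//; apply: cabs_cintegral => //.
    - by apply: ccont_cmeas => //; exact: (entire_ccont _ 1 (@entire_mul_cexp f (- w s t) ef)).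
    - exact: integrable_itv_cst.
    - move=> x; rewrite /= in_itv /= => /andP[x0 xn].
      have := @cabs_rotated s t x n%:R x0 (ltW n0').
      rewrite /F mul1r (addrC x%:C) => h; rewrite (le_trans h)// ler_wpM2l// ler_expR.
      have : c <= t - tau by rewrite ge_min lexx orbT.
      by move=> /(ler_wpM2r (ltW n0')); have := mulr_ge0 (ltW c0) x0; lra.
  have b2 : cabs J2 <= M * expR (- (c * n%:R)) * n%:R.
    rewrite -[X in _ * X]e1 -Rintegral_itv_cst ?ler0n//; apply: cabs_cintegral => //.
    - by apply: ccont_cmeas => //; exact: (entire_ccont _ q (@entire_mul_cexp f (- w s t) ef)).
    - exact: integrable_itv_cst.
    - move=> x; rewrite /= in_itv /= => /andP[x0 xn].
      have := @cabs_rotated s t n%:R x (ltW n0') x0.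
      rewrite /F => h; rewrite (le_trans h)// ler_wpM2l// ler_expR.
      have : c <= s - tau by rewrite ge_min lexx.
      have tt' : 0 <= t - tau by rewrite subr_ge0 ltW.
      by move=> /(ler_wpM2r (ltW n0')); have := mulr_ge0 tt' x0; lra.
  rewrite (le_trans (cabsB _ _))// cabsM cabs_q mul1r.
  rewrite (_ : 2 * _ * _ = M * expR (- (c * n%:R)) * n%:R + M * expR (- (c * n%:R)) * n%:R); last by ring.
  exact: lerD.
apply: (@le0_lim _ _ 3) => // e e0.
have [N1 HN1] := cintegral_lim i1 e0; have [N2 HN2] := cintegral_lim i2 e0.
(* The last entry makes the far sides small: exp(c n) >= (c n)^2 / 2 bounds 2 M n exp(- c n) by 4 M
   / (c^2 n). *)
pose n := (maxn 1 (maxn (maxn N1 N2) (Num.truncn (4 * M / (c ^+ 2 * e))).+1))%N.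
have n0 : (0 < n)%N by rewrite leq_max.
have {}H := H n n0.
have {}HN1 := HN1 n; have {}HN2 := HN2 n.
have nN1 : (N1 <= n)%N by rewrite /n !leq_max leqnn !orbT.
have nN2 : (N2 <= n)%N by rewrite /n !leq_max leqnn !orbT.
have n3 : 4 * M / (c ^+ 2 * e) <= n%:R.
  apply: (@le_trans _ _ (Num.truncn (4 * M / (c ^+ 2 * e))).+1%:R).
    by rewrite ltW// truncnS_gt.
  by rewrite ler_nat /n !leq_max leqnn !orbT.
have {}HN1 := HN1 nN1; have {}HN2 := HN2 nN2.
have small : 2 * (M * expR (- (c * n%:R))) * n%:R <= e.
  have n0' : 0 < n%:R :> R by rewrite ltr0n.
  have cn : 0 < c * n%:R by rewrite mulr_gt0.
  have := @expX_le _ (c * n%:R) 2 (ltW cn).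
  rewrite expRN => h.
  have c2 : 0 < c ^+ 2 * n%:R ^+ 2 / 2 by rewrite divr_gt0// mulr_gt0// exprn_gt0.
  have h2 : (expR (c * n%:R))^-1 <= (c ^+ 2 * n%:R ^+ 2 / 2)^-1.
    by rewrite lef_pV2 ?posrE ?expR_gt0// -exprMn.
  apply: (@le_trans _ _ (2 * (M * (c ^+ 2 * n%:R ^+ 2 / 2)^-1) * n%:R)).
    by rewrite ler_wpM2r ?(ltW n0')// ler_wpM2l// ler_wpM2l.
  have -> : 2 * (M * (c ^+ 2 * n%:R ^+ 2 / 2)^-1) * n%:R = 4 * M / c ^+ 2 / n%:R.
    by field; rewrite !gt_eqF.
  by rewrite ler_pdivrMr// (mulrC e); move: n3; rewrite invfM mulrA ler_pdivrMr.
set A := cintegral mu Dp _; set B := cintegral mu Dp _.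
set A' := cintegral mu _ (fun x : R => F s t x%:C) in HN1 H.
set B' := cintegral mu _ (fun y : R => F s t (q * y%:C)) in HN2 H.
have -> : A - q * B = (A' - q * B') - (A' - A) + q * (B' - B) by ring.
rewrite (le_trans (cabsD _ _))// cabsM cabs_q mul1r.
have := cabsB (A' - q * B') (A' - A).
rewrite -/A in HN1; rewrite -/B in HN2.
move: (cabs (A' - q * B' - (A' - A))) (cabs (B' - B)) (cabs (A' - A)) (cabs (A' - q * B')) H HN1 HN2 => *.
lra.
Qed.

(* Rotating the half line directly needs [tau < s]; both sides have local expansions
   in [s], so the identity extends to all [0 < s]. *)
Lemma rotation (s t : R) : 0 < s -> tau < t ->
  mu.-integrable Dp (EFin \o (fun x => cabs (f x%:C) ^+ 2)) ->
  cintegral mu Dp (fun x => F s t x%:C) = q * cintegral mu Dp (fun y => F s t (q * y%:C)).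
Proof.
move=> s0 tt if2; have mD : measurable Dp by [].
have ct : 0 < t - tau by rewrite subr_gt0.
have mF1 s1 : cmeas Dp (fun x : T => F s1 t x%:C) by apply: ccont_cmeas => //; exact: cF1.
have mF2 s1 : cmeas Dp (fun x : T => F s1 t (q * x%:C)) by apply: ccont_cmeas => //; exact: cF2.
pose U (s : R) := cintegral mu Dp (fun x => F s t x%:C).
pose V (s : R) := cintegral mu Dp (fun y => q * F s t (q * y%:C)).
have VE s1 : V s1 = q * cintegral mu Dp (fun y => F s1 t (q * y%:C)).
  by rewrite /V cintegralZl//; exact: iF2.
suff : U s - V s = 0 by rewrite VE => /eqP; rewrite subr_eq0 => /eqP.
apply: (@identity_theorem _ (fun s => U s - V s) tau) s0 => [s1 s10|s1 ts1]; last first.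
  by rewrite VE /U rotation_large// subrr.
apply: local_expansionB.
- have r0 : 0 < s1 / 2 by rewrite divr_gt0.
  have [|||C [c H]] := @laplace_expansion _ (fun x : T => F s1 t x%:C) (-1) (s1 / 2) r0.
  + by rewrite cabsN cabs1.
  + exact: mF1.
  (* For s1 below the type, the growth bound on [f] gives no decay. Square integrability replaces
     it, by |f| exp(- s1 x / 2) <= |f|^2 + exp(- s1 x). *)
  + apply: (integrable_dom mD _ (integrable_add mD if2 (integrable_expRN s10))).
      apply: measurable_funM; first exact: cmeas_cabs.
      apply: measurable_funTS; apply: continuous_measurable_fun => x.
      apply: (@continuous_comp _ _ _ (fun x => s1 / 2 * x) expR); last exact: continuous_expR.
      by apply: cvgM; [exact: cvg_cst|exact: cvg_id].
    move=> x; rewrite /= in_itv /= andbT => x0.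
    rewrite ger0_norm ?mulr_ge0 ?cabs_ge0 ?expR_ge0//.
    rewrite /F cabsM cabs_cexp.
    have -> : complex.Re (- w s1 t * x%:C) = - (s1 * x) by rewrite Re_mul /w /=; ring.
    rewrite -mulrA -expRD (_ : - (s1 * x) + s1 / 2 * x = - (s1 / 2 * x)); last by field.
    rewrite (_ : expR (- (s1 * x)) = expR (- (s1 / 2 * x)) ^+ 2); last first.
      by rewrite expr2 -expRD; congr expR; field.
    have := sqr_ge0 (cabs (f x%:C) - expR (- (s1 / 2 * x))).
    have := expR_ge0 (- (s1 / 2 * x)); have := cabs_ge0 (f x%:C).
    move: (cabs _) (expR _) => a b a0 b0; rewrite sqrrB => h.
    by have := mulr_ge0 a0 b0; rewrite mulr2n in h; lra.
  + exists (s1 / 2 / 2), C, c; split; first by rewrite divr_gt0.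
    move=> n d /H; rewrite /U (_ : (fun x : T => F s1 t x%:C * cexp (-1 * (d * x)%:C)) =
      (fun x : T => F (s1 + d) t x%:C))//.
    apply/funext => x; rewrite /F -mulrA -cexpD; congr (_ * cexp _).
    by rewrite /w !rmorphD !rmorphM /=; ring.
- have r0 : 0 < (t - tau) / 2 by rewrite divr_gt0.
  have [|||C [c H]] := @laplace_expansion _ (fun x : T => q * F s1 t (q * x%:C)) ('i * sg%:C) ((t - tau) / 2) r0.
  + by rewrite -cabsN -mulNr cabs_q.
  + by apply: cmeasM => //; exact: cmeas_cst.
  + apply: (integrable_dom mD _ (integrable_scale M mD (integrable_expRN r0))).
      apply: measurable_funM; first by apply: cmeas_cabs; apply: cmeasM => //; exact: cmeas_cst.
      apply: measurable_funTS; apply: continuous_measurable_fun => x.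
      apply: (@continuous_comp _ _ _ (fun x => (t - tau) / 2 * x) expR); last exact: continuous_expR.
      by apply: cvgM; [exact: cvg_cst|exact: cvg_id].
    move=> x; rewrite /= in_itv /= andbT => x0.
    rewrite ger0_norm ?mulr_ge0 ?cabs_ge0 ?expR_ge0//.
    rewrite cabsM cabs_q mul1r.
    have := @cabs_rotated s1 t 0 x (lexx _) x0; rewrite add0r mulr0 add0r => h.
    apply: (le_trans (ler_wpM2r (expR_ge0 _) h)).
    rewrite -[leLHS]mulrA; apply: ler_wpM2l => //.
    by rewrite -expRD ler_expR; lra.
  + exists ((t - tau) / 2 / 2), C, c; split; first by rewrite divr_gt0.
    move=> n d /H; rewrite /V (_ : (fun x : T => q * F s1 t (q * x%:C) * cexp ('i * sg%:C * (d * x)%:C)) =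
      (fun x : T => q * F (s1 + d) t (q * x%:C)))//.
    apply/funext => x; rewrite -[LHS]mulrA; congr (_ * _).
    rewrite /F -[LHS]mulrA -cexpD; congr (_ * cexp _).
    by rewrite !(mulrA _ q) !wq !rmorphM !rmorphD /=; ring.
Qed.

End Rotation.

(** * Orthogonality to frequencies beyond the exponential type *)

Section WholeLine.
Context {R : realType}.
Notation mu := (@lebesgue_measure R).
Notation T := (measurableTypeR R).
Notation Dp := (`[(0 : R), +oo[%classic : set T).

Lemma continuous_opp_comp (v : R -> R) : continuous v -> continuous (fun x => v (- x)).
Proof. by move=> cv x; apply: (@continuous_comp _ _ _ (fun x : R => - x) v); [exact: opp_continuous|exact: cv]. Qed.

Lemma ge0_integral_fold (v : R -> R) : (forall x, 0 <= v x) -> continuous v ->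
  (\int[mu]_x (v x)%:E = \int[mu]_(x in Dp) (v x + v (- x))%:E)%E.
Proof.
move=> v0 cv; have mv : measurable_fun [set: T] v by exact: continuous_measurable_fun.
have mv' : measurable_fun [set: T] (fun x => v (- x)).
  by apply: continuous_measurable_fun; exact: continuous_opp_comp.
have mD : measurable (Dp : set T) by [].
rewrite -(setUv Dp) ge0_integral_setU//=; last 4 first.
- exact: measurableC.
- by apply/measurable_EFinP; rewrite setUv.
- by move=> x _; rewrite lee_fin.
- exact/disj_setPCl.
under [RHS]eq_integral do rewrite EFinD.
rewrite ge0_integralD//; last 4 first.
- by move=> x _; rewrite lee_fin.
- by apply/measurable_EFinP; exact: measurable_funTS.
- by move=> x _; rewrite lee_fin.
- by apply/measurable_EFinP; exact: measurable_funTS.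
congr (_ + _)%E.
rewrite setCitvr integral_itv_bndo_bndc; last exact/measurable_EFinP/measurable_funTS.
rewrite -{1}oppr0 ge0_integration_by_substitutionNy//.
exact: continuous_subspaceT.
Qed.

Lemma integrable_fold (u : R -> R) : continuous u ->
  mu.-integrable setT (EFin \o u) <->
  mu.-integrable Dp (EFin \o (fun x => `|u x| + `|u (- x)|)).
Proof.
move=> cu; have cn : continuous (fun x => `|u x|).
  by move=> x; apply: (continuous_comp (cu x)); exact: norm_continuous.
have mn : measurable_fun [set: T] (fun x => `|u x| + `|u (- x)|).
  by apply: continuous_measurable_fun => x; apply: cvgD; [exact: cn|exact: (continuous_opp_comp cn)].
have E := ge0_integral_fold (fun x => normr_ge0 (u x)) cn.
split => /integrableP[_ h]; apply/integrableP; split.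
- by apply/measurable_EFinP; exact: measurable_funTS.
- rewrite (eq_integral (fun x : T => (`|u x| + `|u (- x)|)%:E)); last first.
    by move=> x _; rewrite /= ger0_norm ?addr_ge0.
  by rewrite -E.
- by apply/measurable_EFinP; exact: continuous_measurable_fun.
- rewrite /= E; move: h; rewrite (eq_integral (fun x : T => (`|u x| + `|u (- x)|)%:E))//.
  by move=> x _; rewrite /= ger0_norm ?addr_ge0.
Qed.

(** Both |u| + u and |u| are nonnegative, so the nonnegative case applies to each, and their
    difference is [u]. *)
Lemma Rintegral_fold (u : R -> R) : continuous u -> mu.-integrable setT (EFin \o u) ->
  Rintegral mu setT u = Rintegral mu Dp (fun x => u x + u (- x)).
Proof.
move=> cu iu; have mD : measurable (Dp : set T) by [].
have cn : continuous (fun x => `|u x|).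
  by move=> x; apply: (continuous_comp (cu x)); exact: norm_continuous.
have cp : continuous (fun x => `|u x| + u x).
  by move=> x; apply: cvgD; [exact: cn|exact: cu].
have := (integrable_fold cu).1 iu => i2.
have mo := continuous_opp_comp cu.
have iD : mu.-integrable Dp (EFin \o (fun x => u x + u (- x))).
  apply: (integrable_dom mD _ i2).
    apply: measurable_funTS; apply: continuous_measurable_fun => x.
    by apply: cvgD; [exact: cu|exact: mo].
  by move=> x _; exact: ler_normD.
have p0 x : 0 <= `|u x| + u x by have := ler_norm (- u x); rewrite normrN; lra.
have e1 : Rintegral mu setT (fun x => `|u x|) = Rintegral mu Dp (fun x => `|u x| + `|u (- x)|).
  by rewrite /Rintegral (ge0_integral_fold (fun x => normr_ge0 (u x)) cn).
have e2 : Rintegral mu setT (fun x => `|u x| + u x) =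
    Rintegral mu Dp (fun x => `|u x| + `|u (- x)| + (u x + u (- x))).
  rewrite /Rintegral (ge0_integral_fold p0 cp); congr fine; apply: eq_integral => x _.
  by congr (_%:E); ring.
have in_ : mu.-integrable setT (EFin \o (fun x => `|u x|)) by exact: (integrable_norm iu).
have e3 := RintegralD measurableT in_ iu; have e4 := RintegralD mD i2 iD.
by move: e2; rewrite e3 e1 e4 => /addrI.
Qed.

Lemma cintegral_fold (g : R -> R[i]) : ccont g -> cintegrable mu setT g ->
  cintegral mu setT g = cintegral mu Dp (fun x => g x + g (- x)).
Proof.
move=> [cr ci] [ir ii]; rewrite /cintegral (Rintegral_fold cr ir) (Rintegral_fold ci ii).
by congr Complex; apply: eq_Rintegral => x _; rewrite ?Re_add ?Im_add.
Qed.

Lemma cintegrable_fold (g : R -> R[i]) : ccont g -> cintegrable mu setT g ->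
  cintegrable mu Dp g /\ cintegrable mu Dp (fun x => g (- x)).
Proof.
move=> cg ig; have mD : measurable (Dp : set T) by [].
have /(integrable_fold (ccont_cabs cg)).1 i2 := cintegrable_cabs measurableT ig.
split; apply: (cintegrable_dom mD _ i2).
- exact: ccont_cmeas.
- by move=> x _; rewrite ger0_norm ?cabs_ge0// lerDl.
- by apply: ccont_cmeas => //; apply: ccont_comp => //; exact: opp_continuous.
- by move=> x _; rewrite (@ger0_norm _ (cabs (g (- x)))) ?cabs_ge0// lerDr.
Qed.

Lemma continuous_invD1sqr : continuous (fun x : R => (1 + x ^+ 2)^-1).
Proof.
move=> x; apply: cvgV; first by rewrite gt_eqF// ltr_wpDr ?sqr_ge0.
apply: cvgD; first exact: cvg_cst.
by under eq_fun do rewrite expr2; apply: cvgM; exact: cvg_id.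
Qed.

Lemma integrable_invD1sqr : mu.-integrable setT (EFin \o (fun x : R => (1 + x ^+ 2)^-1)).
Proof.
apply/integrableP; split.
  by apply/measurable_EFinP; apply: continuous_measurable_fun; exact: continuous_invD1sqr.
have p0 (x : R) : 0 <= (1 + x ^+ 2)^-1 by rewrite invr_ge0 addr_ge0 ?sqr_ge0.
rewrite (eq_integral (fun x : T => ((1 + x ^+ 2)^-1)%:E)); last first.
  by move=> x _; rewrite /= ger0_norm.
rewrite (ge0_symfun_integralT p0 continuous_invD1sqr); last by move=> x /=; rewrite sqrrN.
have := @integral0y_oneDsqr R; rewrite set_itvcy /oneDsqr => ->.
by rewrite -EFinM ltry.
Qed.

Lemma integrable_expRN_norm (c : R) : 0 < c ->
  mu.-integrable setT (EFin \o (fun x : R => expR (- (c * `|x|)))).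
Proof.
move=> c0; have cE : continuous (fun x : R => expR (- (c * `|x|))).
  move=> x; apply: (@continuous_comp _ _ _ (fun x => - (c * `|x|)) expR); last exact: continuous_expR.
  by apply: cvgN; apply: cvgM; [exact: cvg_cst|exact: norm_continuous].
apply/(integrable_fold cE).
have mD : measurable (Dp : set T) by [].
apply: (integrable_dom mD _ (integrable_scale 2 mD (integrable_expRN c0))).
  have cn : continuous (fun x : R => `|expR (- (c * `|x|))|).
    by move=> x; apply: (continuous_comp (cE x)); exact: norm_continuous.
  apply: measurable_funTS; apply: continuous_measurable_fun => x.
  by apply: cvgD; [exact: cn|exact: (continuous_opp_comp cn)].
move=> x; rewrite /= in_itv /= andbT => x0.
by rewrite normrN ger0_norm ?addr_ge0// !(ger0_norm (expR_ge0 _)) (ger0_norm x0) mulr_natl mulr2n.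
Qed.

Lemma cexp_i_lip (a b : R) : cabs (cexp ('i * a%:C) - cexp ('i * b%:C)) <= `|a - b|.
Proof.
wlog ba : a b / b <= a.
  by move=> H; have [/H//|/ltW/H] := leP b a; rewrite cabsBC distrC.
have dF (x : R) : cder (fun x => cexp ('i * x%:C)) x ('i * cexp ('i * x%:C)).
  exact: cder_cexp (cder_lin 'i x).
have := @cabs_increment _ _ _ id (fun=> 1) b a ba dF (fun x => is_derive_id x 1).
rewrite [`|_|]ger0_norm ?subr_ge0//; apply.
by move=> x _; rewrite cabsM cabs_i mul1r cabs_cexp_i.
Qed.

End WholeLine.

(** * Damped Fourier transforms beyond the type *)

Section SpectralGap.
Context {R : realType}.
Notation mu := (@lebesgue_measure R).
Notation T := (measurableTypeR R).
Notation Dp := (`[(0 : R), +oo[%classic : set T).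

Definition L2 (g : R -> R[i]) := mu.-integrable setT (EFin \o (fun x => cabs (g x) ^+ 2)).

(** From |g m| <= |g|^2 + |m|^2. The integrability of the majorant is returned too, since it serves
    again in dominated convergence. *)
Lemma integrable_mul_L2 (g m : R -> R[i]) (v : R -> R) : cmeas setT (g : T -> R[i]) -> cmeas setT (m : T -> R[i]) ->
  L2 g -> mu.-integrable setT (EFin \o v) -> (forall x, cabs (m x) ^+ 2 <= v x) ->
  mu.-integrable setT (EFin \o (fun x => cabs (g x) ^+ 2 + v x)) /\
  cintegrable mu setT (fun x => g x * m x).
Proof.
move=> mg mm Lg iv mv; have i2 := integrable_add measurableT Lg iv; split => //.
apply: (cintegrable_dom _ _ i2) => //; first exact: cmeasM.
move=> x _; rewrite cabsM (le_trans _ (lerD (lexx _) (mv x)))//.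
have := sqr_ge0 (cabs (g x) - cabs (m x)); have := cabs_ge0 (g x); have := cabs_ge0 (m x).
move: (cabs (g x)) (cabs (m x)) => a b a0 b0; rewrite sqrrB => h.
by have := mulr_ge0 a0 b0; rewrite mulr2n in h; lra.
Qed.

(** A square integrable function need not be integrable; the damping makes the integral absolutely
    convergent. The frequency [xi] is angular. *)
Definition damped_fourier (f : R[i] -> R[i]) (eps xi : R) : R[i] :=
  cintegral mu setT (fun x : R => f x%:C * (expR (- (eps * `|x|)))%:C * cexp ('i * (xi * x)%:C)).

Lemma ccont_restrict (f : R[i] -> R[i]) : entire f -> ccont (fun x : R => f x%:C).
Proof.
move=> ef; have := entire_ccont 0 1 ef.
by under eq_fun do rewrite add0r mul1r.
Qed.

Lemma continuous_expRN_norm (eps : R) : continuous (fun x : R => expR (- (eps * `|x|))).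
Proof.
move=> x; apply: (@continuous_comp _ _ _ (fun x => - (eps * `|x|)) expR); last exact: continuous_expR.
by apply: cvgN; apply: cvgM; [exact: cvg_cst|exact: norm_continuous].
Qed.

Lemma entire_opp (f : R[i] -> R[i]) : entire f -> entire (fun z => f (- z)).
Proof.
move=> /entireP ef; apply/entireP => z; have [d Hd] := ef (- z).
exists (- 1 * d); have := @cdiff_comp_lin _ f (- 1) 0 z d.
rewrite (_ : (fun w => f (-1 * w + 0)) = (fun w => f (- w))); last first.
  by apply/funext => w; rewrite addr0 mulN1r.
by apply; rewrite addr0 mulN1r.
Qed.

Lemma ccont_cexp_i (xi : R) : ccont (fun x : R => cexp ('i * (xi * x)%:C)).
Proof.
apply: ccont_cexp; apply: ccontM; first exact: ccont_cst.
by apply: ccont_real => x; apply: cvgM; [exact: cvg_cst|exact: cvg_id].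
Qed.

Lemma damped_cont (f : R[i] -> R[i]) (eps : R) : entire f ->
  ccont (fun x : R => f x%:C * (expR (- (eps * `|x|)))%:C).
Proof.
move=> ef; apply: ccontM; first exact: ccont_restrict.
by apply: ccont_real; exact: continuous_expRN_norm.
Qed.

Lemma damped_integrable (f : R[i] -> R[i]) (eps : R) : entire f -> L2 (fun x => f x%:C) -> 0 < eps ->
  cintegrable mu setT (fun x : R => f x%:C * (expR (- (eps * `|x|)))%:C).
Proof.
move=> ef Lf e0; have e20 : 0 < eps + eps by rewrite addr_gt0.
have [|||_ H] := @integrable_mul_L2 (fun x => f x%:C) (fun x => (expR (- (eps * `|x|)))%:C) _ _ _ Lf
  (integrable_expRN_norm e20).
- by apply: ccont_cmeas => //; exact: ccont_restrict.
- by apply: ccont_cmeas => //; apply: ccont_real; exact: continuous_expRN_norm.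
- by move=> x; rewrite cabs_real ger0_norm ?expR_ge0// expr2 -expRD ler_expR mulrDl opprD.
- exact: H.
Qed.

Lemma cexp_polar (a b : R) : cexp (- a%:C + 'i * b%:C) = (expR (- a))%:C * cexp ('i * b%:C).
Proof.
by rewrite cexpD (_ : - a%:C = (- a)%:C) ?cexp_real// rmorphN.
Qed.

(* After rotating both half lines, [eps] only enters through the phases
   [exp (i eps y)] and [exp (- i eps y)], and the two integrals cancel at [eps = 0]. *)
Lemma damped_fourier_decay (f : R[i] -> R[i]) (tau lam : R) :
  entire f -> exp_type_le tau f -> 0 <= tau -> L2 (fun x => f x%:C) -> tau < lam ->
  exists2 C, 0 <= C & forall eps xi, 0 < eps -> lam <= `|xi| ->
    cabs (damped_fourier f eps xi) <= C * eps.
Proof.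
move=> ef gf tau0 Lf taulam; have mD : measurable (Dp : set T) by [].
(* Half of the gap is given to the growth of [f], now of rate t1 = tau + c; the other half remains
   as decay of rate c after the rotation. *)
pose c := (lam - tau) / 2; have c0 : 0 < c by rewrite divr_gt0// subr_gt0.
have [M HM] := gf c c0; pose t1 := tau + c.
have t10 : 0 <= t1 by rewrite addr_ge0// ltW.
have M0 : 0 <= M by have := HM 0; rewrite cabs0 mulr0 expR0 mulr1; apply: le_trans (cabs_ge0 _).
have c20 : 0 < c / 2 by rewrite divr_gt0.
have iC := integrable_scale (4 * M / c) mD (integrable_expRN c20).
have KC : 0 <= 4 * M / c by exact: divr_ge0 (mulr_ge0 (ler0n _ 4) M0) (ltW c0).
(* The rotated integrand is at most M exp(- c y) * 2 eps y, and y exp(- c y / 2) <= 2 / c. *)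
exists (Rintegral mu Dp (fun x => 4 * M / c * expR (- (c / 2 * x)))).
  by apply: Rintegral_ge0 => x _; rewrite mulr_ge0 ?expR_ge0.
move=> eps xi e0 lxi.
(* [sg] is opposite to the sign of [xi], so that the exponent on the positive half line reads - (eps
   + i sg t) x. *)
pose t := `|xi|; pose sg : R := if xi <= 0 then 1 else -1.
have sg1 : sg ^+ 2 = 1 by rewrite /sg; case: ifP; rewrite ?sqrrN expr1n.
have sgN1 : (- sg) ^+ 2 = 1 by rewrite sqrrN.
have xiE : xi = - (sg * t).
  rewrite /sg /t; case: leP => h; first by rewrite ler0_norm// mul1r opprK.
  by rewrite gtr0_norm// mulN1r opprK.
have t1t : t1 < t by rewrite (lt_le_trans _ lxi)// /t1 /c; lra.
have Lf1 : mu.-integrable Dp (EFin \o (fun x => cabs (f x%:C) ^+ 2)).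
  exact: (integrableS measurableT mD (@subsetT _ _) Lf).
have cfN : ccont (fun x : R => f (- x%:C)).
  exact: (ccont_restrict (entire_opp ef)).
have Lf2 : mu.-integrable Dp (EFin \o (fun x => cabs (f (- x%:C)) ^+ 2)).
  have cu : continuous (fun x : R => cabs (f x%:C) ^+ 2).
    move=> x; under eq_fun do rewrite expr2.
    by apply: cvgM; exact: (ccont_cabs (ccont_restrict ef)).
  apply: (integrable_dom mD _ ((integrable_fold cu).1 Lf)).
    apply: measurable_funTS; apply: continuous_measurable_fun => x.
    under eq_fun do rewrite expr2.
    by apply: cvgM; exact: (ccont_cabs cfN).
  by move=> x _; rewrite rmorphN lerDr.
have gM : forall z, cabs (f z) <= M * expR (t1 * cabs z) by [].
have gMN : forall z, cabs (f (- z)) <= M * expR (t1 * cabs z) by move=> z; rewrite -[cabs z]cabsN.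
pose q : R[i] := - 'i * sg%:C.
have wq s y : - (s%:C + 'i * (sg * t)%:C) * (q * y%:C) = - (t * y)%:C + 'i * (sg * s * y)%:C.
  have i2 : 'i * 'i = -1 :> R[i] by rewrite -expr2 sqr_i.
  have sgC : sg%:C * sg%:C = 1 :> R[i] by rewrite -rmorphM -expr2 sg1.
  rewrite /q !rmorphM /=.
  transitivity (('i * 'i) * (sg%:C * sg%:C) * t%:C * y%:C + 'i * sg%:C * s%:C * y%:C :> R[i]); first by ring.
  by rewrite i2 sgC; ring.
have wqN s y : - (s%:C + 'i * (- sg * t)%:C) * (- q * y%:C) = - (t * y)%:C + 'i * (- sg * s * y)%:C.
  have i2 : 'i * 'i = -1 :> R[i] by rewrite -expr2 sqr_i.
  have sgC : sg%:C * sg%:C = 1 :> R[i] by rewrite -rmorphM -expr2 sg1.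
  rewrite /q !rmorphM !rmorphN /=.
  transitivity (('i * 'i) * (sg%:C * sg%:C) * t%:C * y%:C - 'i * sg%:C * s%:C * y%:C :> R[i]); first by ring.
  by rewrite i2 sgC; ring.
(* The reflected function is rotated along - q. Since f(- (- q y)) = f(q y), both half lines end on
   the same ray, with prefactors q and - q. *)
have r1 := rotation ef gM t10 sg1 e0 t1t Lf1.
have r2 := rotation (entire_opp ef) gMN t10 sgN1 e0 t1t Lf2.
have ig : cintegrable mu setT (fun x : R => f x%:C * (expR (- (eps * `|x|)))%:C * cexp ('i * (xi * x)%:C)).
  apply: (cintegrable_dom measurableT _ (cintegrable_cabs measurableT (damped_integrable ef Lf e0))).
    by apply: ccont_cmeas => //; apply: ccontM; [exact: damped_cont|exact: ccont_cexp_i].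
  by move=> x _; rewrite [leLHS]cabsM cabs_cexp_i mulr1.
have cg : ccont (fun x : R => f x%:C * (expR (- (eps * `|x|)))%:C * cexp ('i * (xi * x)%:C)).
  by apply: ccontM; [exact: damped_cont|exact: ccont_cexp_i].
have [i1 i2] := cintegrable_fold cg ig.
rewrite /damped_fourier cintegral_fold// cintegralD//.
have -> : cintegral mu Dp (fun x : R => f x%:C * (expR (- (eps * `|x|)))%:C * cexp ('i * (xi * x)%:C)) =
    cintegral mu Dp (fun x : R => f x%:C * cexp (- (eps%:C + 'i * (sg * t)%:C) * x%:C)).
  apply: eq_cintegral => x; rewrite inE /= in_itv /= andbT => x0.
  rewrite -mulrA -cexp_real -cexpD ger0_norm// xiE; congr (_ * cexp _).
  by rewrite !rmorphN !rmorphM !rmorphN !rmorphM /=; ring.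
have -> : cintegral mu Dp (fun x : R => f (- x)%:C * (expR (- (eps * `|- x|)))%:C * cexp ('i * (xi * - x)%:C)) =
    cintegral mu Dp (fun x : R => f (- x%:C) * cexp (- (eps%:C + 'i * (- sg * t)%:C) * x%:C)).
  apply: eq_cintegral => x; rewrite inE /= in_itv /= andbT => x0.
  rewrite normrN -mulrA -cexp_real -cexpD ger0_norm// xiE rmorphN; congr (_ * cexp _).
  by rewrite !rmorphN !rmorphM !rmorphN !rmorphM /=; ring.
rewrite r1 r2 -/q.
have qN : - 'i * (- sg)%:C = - q by rewrite /q rmorphN mulrN.
rewrite qN.
have -> : cintegral mu Dp (fun y : R => f (q * y%:C) * cexp (- (eps%:C + 'i * (sg * t)%:C) * (q * y%:C))) =
    cintegral mu Dp (fun y : R => f (q * y%:C) * cexp (- (t * y)%:C + 'i * (sg * eps * y)%:C)).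
  by apply: eq_cintegral => y _; rewrite wq.
have -> : cintegral mu Dp (fun y : R => f (- (- q * y%:C)) * cexp (- (eps%:C + 'i * (- sg * t)%:C) * (- q * y%:C))) =
    cintegral mu Dp (fun y : R => f (q * y%:C) * cexp (- (t * y)%:C + 'i * (- sg * eps * y)%:C)).
  by apply: eq_cintegral => y _; rewrite wqN mulNr opprK.
have cq : cabs q = 1.
  rewrite /q cabsM cabsN cabs_i mul1r cabs_real.
  by rewrite /sg; case: ifP; rewrite ?normrN normr1.
have cfq : ccont (fun y : R => f (q * y%:C)).
  by have := entire_ccont 0 q ef; under eq_fun do rewrite add0r.
have ce a : ccont (fun y : R => cexp (- (t * y)%:C + 'i * (a * y)%:C)).
  apply: ccont_cexp; apply: ccontD.
    apply: ccontN; apply: ccont_real => x; apply: cvgM; [exact: cvg_cst|exact: cvg_id].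
  apply: ccontM; first exact: ccont_cst.
  by apply: ccont_real => x; apply: cvgM; [exact: cvg_cst|exact: cvg_id].
have fb y : 0 <= y -> cabs (f (q * y%:C)) * expR (- (t * y)) <= M * expR (- (c * y)).
  move=> y0; rewrite (le_trans (ler_wpM2r (expR_ge0 _) (gM _)))// -mulrA -expRD ler_wpM2l// ler_expR.
  rewrite cabsM cq mul1r cabs_real ger0_norm//.
  have : c <= t - t1.
    by have : lam <= t by []; rewrite /t1 /c; lra.
  by move=> /(ler_wpM2r y0); lra.
have is_ a : cintegrable mu Dp (fun y : R => f (q * y%:C) * cexp (- (t * y)%:C + 'i * (a * y)%:C)).
  apply: (cintegrable_dom mD _ (integrable_scale M mD (integrable_expRN c0))).
    by apply: ccont_cmeas => //; exact: ccontM.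
  move=> y; rewrite /= in_itv /= andbT => y0; rewrite cabsM.
  rewrite cexp_polar cabsM cabs_cexp_i mulr1 cabs_real (ger0_norm (expR_ge0 _)).
  exact: fb.
rewrite mulNr -mulrBr -cintegralB// cabsM cq mul1r.
have -> : Rintegral mu Dp (fun x => 4 * M / c * expR (- (c / 2 * x))) * eps =
    Rintegral mu Dp (fun x => eps * (4 * M / c * expR (- (c / 2 * x)))).
  by rewrite [RHS]RintegralZl// [LHS]mulrC.
apply: cabs_cintegral => //.
- by apply: ccont_cmeas => //; apply: ccontB; exact: ccontM.
- exact: integrable_scale.
- move=> y; rewrite /= in_itv /= andbT => y0.
  rewrite -mulrBr !cexp_polar -mulrBr mulrA cabsM cabsM cabs_real (ger0_norm (expR_ge0 _)).
  have h := cexp_i_lip (sg * eps * y) (- sg * eps * y).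
  have h2 : `|sg * eps * y - - sg * eps * y| = 2 * eps * y.
    rewrite (_ : _ - _ = sg * (2 * eps * y)); last by ring.
    rewrite normrM (_ : `|sg| = 1); last by rewrite /sg; case: ifP; rewrite ?normrN normr1.
    by rewrite mul1r ger0_norm// !mulr_ge0// ltW.
  rewrite h2 in h.
  have k := fb y y0.
  apply: (@le_trans _ _ (M * expR (- (c * y)) * (2 * eps * y))).
    by apply: ler_pM; rewrite ?mulr_ge0 ?cabs_ge0 ?expR_ge0.
  have := @expX_le _ (c / 2 * y) 1 (mulr_ge0 (ltW c20) y0); rewrite expr1 divr1 => h3.
  rewrite (_ : expR (- (c * y)) = expR (- (c / 2 * y)) * expR (- (c / 2 * y))); last first.
    by rewrite -expRD; congr expR; field.
  have h4 : y * expR (- (c / 2 * y)) <= 2 / c.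
    rewrite expRN ler_pdivrMr ?expR_gt0//.
    rewrite [leLHS](_ : y = 2 / c * (c / 2 * y)); last by field; exact: lt0r_neq0.
    by apply: ler_wpM2l h3; exact: divr_ge0 (ler0n _ 2) (ltW c0).
  have := expR_ge0 (- (c / 2 * y)).
  move: (expR _) h4 => E h4 E0.
  rewrite (_ : M * (E * E) * (2 * eps * y) = 2 * eps * M * E * (y * E)); last by ring.
  rewrite (_ : eps * (4 * M / c * E) = 2 * eps * M * E * (2 / c)); last by field; exact: lt0r_neq0.
  apply: ler_wpM2l h4.
  exact: mulr_ge0 (mulr_ge0 (mulr_ge0 (ler0n _ 2) (ltW e0)) M0) E0.
Qed.

End SpectralGap.

(** * Removal of the damping *)

Section SpectralOrthogonality.
Context {R : realType}.
Notation mu := (@lebesgue_measure R).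
Notation T := (measurableTypeR R).

Lemma cvg_harmonic_bound (u : nat -> R[i]) (K : R) :
  (forall n, cabs (u n) <= K * harmonic n) -> (fun n => cabs (u n)) @ \oo --> (0 : R).
Proof.
move=> H.
have h0 : (fun n => K * harmonic n) @ \oo --> (0 : R).
  by rewrite -(mulr0 K); apply: cvgM; [exact: cvg_cst|exact: cvg_harmonic].
by apply: (squeeze_cvgr _ (cvg_cst 0) h0); apply: nearW => n; rewrite cabs_ge0 H.
Qed.

Lemma cvg_eq0 (a : nat -> R[i]) (l : R[i]) (K : R) :
  (fun n => cabs (a n - l)) @ \oo --> (0 : R) ->
  (forall n, cabs (a n) <= K * harmonic n) -> l = 0.
Proof.
move=> al H; apply/eqP; rewrite -cabs_eq0 eq_le cabs_ge0 andbT.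
have h0 : (fun n => cabs (a n - l) + K * harmonic n) @ \oo --> (0 : R).
  rewrite -[X in _ --> X](addr0 0); apply: cvgD => //.
  by rewrite -(mulr0 K); apply: cvgM; [exact: cvg_cst|exact: cvg_harmonic].
apply/ler_addgt0Pr => e e0; rewrite add0r.
have /cvgrPdist_lt/(_ _ e0)[N _ /(_ N (leqnn N))] := h0.
rewrite sub0r normrN => hN; apply/ltW; apply: le_lt_trans hN.
apply: le_trans (ler_norm _); rewrite (_ : l = a N - (a N - l)); last by ring.
rewrite (le_trans (cabsB _ _))// addrC lerD//.
by rewrite (_ : a N - (a N - (a N - l)) = a N - l)//; ring.
Qed.

(** From (1 + |x|)^2 >= 1 + x^2: first-order decay yields an explicit integrable majorant of the
    square. *)
Lemma decay_sqr (z : R[i]) (C x : R) : 0 <= C -> cabs z <= C / (1 + `|x|) ->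
  cabs z ^+ 2 <= C ^+ 2 * (1 + x ^+ 2)^-1.
Proof.
move=> C0 h; have x0 := normr_ge0 x.
have p1 : 0 < 1 + `|x| by rewrite ltr_wpDr.
have p2 : 0 < 1 + x ^+ 2 by rewrite ltr_wpDr ?sqr_ge0.
apply: (@le_trans _ _ ((C / (1 + `|x|)) ^+ 2)).
  by rewrite lerXn2r ?nnegrE ?cabs_ge0// divr_ge0// ltW.
rewrite exprMn ler_wpM2l ?sqr_ge0// exprVn lef_pV2 ?posrE ?exprn_gt0//.
rewrite -[x ^+ 2]real_normK ?num_real// sqrrD expr1n mul1r.
by rewrite lerD2r lerDl mulrn_wge0.
Qed.

Lemma damped_cexp_integrable (f : R[i] -> R[i]) (eps xi : R) :
  entire f -> L2 (fun x => f x%:C) -> 0 < eps ->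
  cintegrable mu setT
    (fun x : R => f x%:C * (expR (- (eps * `|x|)))%:C * cexp ('i * (xi * x)%:C)).
Proof.
move=> ef Lf e0; have ifd := damped_integrable ef Lf e0.
apply: (cintegrable_dom _ _ (cintegrable_cabs measurableT ifd)) => //.
  by apply: ccont_cmeas => //; apply: ccontM; [exact: damped_cont|exact: ccont_cexp_i].
by move=> x _; rewrite cabsM cabs_cexp_i mulr1.
Qed.

(** The scale [s] is kept apart from [x]: the value - 2 pi gives the Fourier transform, and
    multiplying [s] by k > 1 moves all frequencies outwards while only dilating the argument. *)
Definition trig_transform (psi : R -> R[i]) (s x : R) : R[i] :=
  cintegral mu setT (fun g : R => psi g * cexp ('i * (s * (x * g))%:C)).

Section Kernel.
Variables (psi : R -> R[i]) (B H : R).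
Hypothesis mpsi : cmeas setT (psi : T -> R[i]).
Hypothesis psiB : forall g, cabs (psi g) <= B.
Hypothesis psiH : forall g, H < `|g| -> psi g = 0.

Let bH (g : R) : R := B * \1_(`[- H, H]%classic : set R) g.

Lemma integrable_indic_itv (M a b : R) :
  mu.-integrable setT (EFin \o (fun g : R => M * \1_(`[a, b]%classic : set R) g)).
Proof.
apply: integrable_scale => //.
have mI : measurable (`[a, b]%classic : set T) by [].
have := (integrable_mkcond _ mI).1 (integrable_itv_cst a b (1 : R)).
apply: eq_integrable => //= g _; rewrite patchE indicE /=.
by case: ifP.
Qed.

Let ibH : mu.-integrable setT (EFin \o bH).
Proof. exact: integrable_indic_itv. Qed.

Let B0 : 0 <= B. Proof. exact: le_trans (cabs_ge0 _) (psiB 0). Qed.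

Let psi_bH g : cabs (psi g) <= bH g.
Proof.
rewrite /bH indicE; have [h|h] := leP `|g| H.
  by rewrite mem_set ?mulr1// /= in_itv /= -ler_norml.
by rewrite psiH// cabs0 mulr_ge0.
Qed.

Lemma trig_integrable s x : cintegrable mu setT (fun g : R => psi g * cexp ('i * (s * (x * g))%:C)).
Proof.
apply: (cintegrable_dom _ _ ibH) => //; last first.
  by move=> g _; rewrite cabsM cabs_cexp_i mulr1.
apply: cmeasM => //; apply: ccont_cmeas => //.
by have := ccont_cexp_i (s * x); under eq_fun do rewrite -mulrA.
Qed.

Lemma trig_lip s x y :
  cabs (trig_transform psi s x - trig_transform psi s y) <=
  Rintegral mu setT bH * (`|s| * `|H|) * `|x - y|.
Proof.
rewrite /trig_transform -cintegralB//; [|exact: trig_integrable..].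
have -> : Rintegral mu setT bH * (`|s| * `|H|) * `|x - y| =
    Rintegral mu setT (fun g => (`|s| * `|H| * `|x - y|) * bH g).
  by rewrite [RHS]RintegralZl//; ring.
apply: cabs_cintegral => //.
- by apply: cmeasB; apply: cintegrable_meas; exact: trig_integrable.
- exact: integrable_scale.
- move=> g _; rewrite -mulrBr cabsM.
  have [h|h] := leP `|g| H; last first.
    by rewrite psiH// cabs0 mul0r !mulr_ge0// /bH mulr_ge0// indicE ler0n.
  rewrite mulrC; apply: ler_pM; rewrite ?cabs_ge0//.
  rewrite (le_trans (cexp_i_lip _ _))//.
  rewrite (_ : s * (x * g) - s * (y * g) = s * g * (x - y)); last by ring.
  rewrite !normrM ler_wpM2r// ler_wpM2l//.
  by rewrite (le_trans h)// ler_norm.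
Qed.

Lemma ccont_trig s : ccont (trig_transform psi s).
Proof.
pose K := Rintegral mu setT bH * (`|s| * `|H|).
have K0 : 0 <= K.
  rewrite /K mulr_ge0// ?mulr_ge0//; apply: Rintegral_ge0 => g _.
  by rewrite /bH mulr_ge0// indicE ler0n.
suff W : forall x (e : R), 0 < e -> exists2 r : R, 0 < r & forall y, `|x - y| < r ->
    cabs (trig_transform psi s x - trig_transform psi s y) < e.
  split => x; apply/cvgrPdist_lt => e e0; have [r r0 W'] := W x e e0;
  near=> y; (apply: le_lt_trans (W' y _); last by near: y; exact: cvgr_dist_lt).
    by rewrite -Re_opp -Re_add Re_le_cabs.
  by rewrite -Im_opp -Im_add Im_le_cabs.
move=> x e e0; exists (e / (K + 1)); first by rewrite divr_gt0// ltr_wpDl.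
move=> y; rewrite ltr_pdivlMr ?ltr_wpDl// => h.
apply: le_lt_trans (trig_lip s x y) _; apply: le_lt_trans h.
by rewrite mulrC ler_wpM2l// lerDl.
Unshelve. all: by end_near. Qed.

Lemma trig_fubini (f : R[i] -> R[i]) (eps s : R) : entire f -> L2 (fun x => f x%:C) -> 0 < eps ->
  cintegral mu setT (fun x : R => f x%:C * (expR (- (eps * `|x|)))%:C * trig_transform psi s x) =
  cintegral mu setT (fun g : R => psi g * damped_fourier f eps (s * g)).
Proof.
move=> ef Lf e0; have ifd := damped_integrable ef Lf e0.
pose a x := cabs (f x%:C * (expR (- (eps * `|x|)))%:C).
pose F x g := (f x%:C * (expR (- (eps * `|x|)))%:C) * (psi g * cexp ('i * (s * (x * g))%:C)).
have [||||_ E] := @cfubini _ F a bH.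
- have mx : measurable_fun setT (fst : T * T -> T) by exact: measurable_fst.
  have mg : measurable_fun setT (snd : T * T -> T) by exact: measurable_snd.
  have mfx : cmeas setT (fun z : T * T => f z.1%:C * (expR (- (eps * `|z.1|)))%:C).
    have [fr fi] := cintegrable_meas ifd.
    by split; [exact: (measurableT_comp fr mx)|exact: (measurableT_comp fi mx)].
  have mpx : cmeas setT (fun z : T * T => psi z.2).
    by split; [exact: (measurableT_comp mpsi.1 mg)|exact: (measurableT_comp mpsi.2 mg)].
  apply: cmeasM => //; apply: cmeasM => //; apply: cmeas_cexp.
  apply: cmeasM; first exact: cmeas_cst.
  apply: cmeas_real; apply: measurable_funM; first exact: measurable_cst.
  exact: measurable_funM.
- exact: cintegrable_cabs.
- exact: ibH.
- move=> x g; rewrite /F cabsM [X in _ * X]cabsM cabs_cexp_i mulr1.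
  by rewrite ler_wpM2l ?cabs_ge0.
transitivity (cintegral mu setT (fun x : T => cintegral mu setT (F x))).
  apply: eq_cintegral => x _; symmetry.
  exact: (cintegralZl _ measurableT (trig_integrable s x)).
rewrite {}E; apply: eq_cintegral => g _.
have ig := damped_cexp_integrable (s * g) ef Lf e0.
rewrite /damped_fourier -(cintegralZl _ measurableT ig).
apply: eq_cintegral => x _; rewrite /F mulrCA (_ : s * (x * g) = s * g * x)//.
by rewrite mulrCA mulrC.
Qed.


(* Fubini turns the damped integral into an average of the damped Fourier
   transform over frequencies beyond the exponential type, where it is O(eps). *)
Lemma damped_orthogonality (f : R[i] -> R[i]) (tau h s : R) :
  entire f -> exp_type_le tau f -> 0 <= tau -> L2 (fun x => f x%:C) ->
  tau < `|s| * h -> (forall g, `|g| < h -> psi g = 0) ->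
  exists C, forall eps, 0 < eps ->
  cabs (cintegral mu setT (fun x : R => f x%:C * (expR (- (eps * `|x|)))%:C * trig_transform psi s x))
    <= C * eps.
Proof.
move=> ef gf tau0 Lf sh psih.
have [C C0 HC] := damped_fourier_decay ef gf tau0 Lf sh.
exists (C * Rintegral mu setT bH) => eps e0.
rewrite trig_fubini//.
have -> : C * Rintegral mu setT bH * eps = Rintegral mu setT (fun g => C * eps * bH g).
  by rewrite [RHS]RintegralZl//; ring.
have bd g : cabs (psi g * damped_fourier f eps (s * g)) <= C * eps * bH g.
  rewrite cabsM mulrC; have [gh|gh] := ltP `|g| h.
    rewrite psih// cabs0 mulr0.
    exact: mulr_ge0 (mulr_ge0 C0 (ltW e0)) (le_trans (cabs_ge0 _) (psi_bH g)).
  apply: ler_pM; rewrite ?cabs_ge0// HC// normrM.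
  by apply: ler_wpM2l.
apply: cabs_cintegral => //.
- have ifd := damped_integrable ef Lf e0.
  have [||||mm _] := @cfubini _ (fun g x => psi g * (f x%:C * (expR (- (eps * `|x|)))%:C * cexp ('i * (s * g * x)%:C)))
    bH (fun x => cabs (f x%:C * (expR (- (eps * `|x|)))%:C)).
  + have mx : measurable_fun setT (snd : T * T -> T) by exact: measurable_snd.
    have mg : measurable_fun setT (fst : T * T -> T) by exact: measurable_fst.
    have mfx : cmeas setT (fun z : T * T => f z.2%:C * (expR (- (eps * `|z.2|)))%:C).
      have [fr fi] := cintegrable_meas ifd.
      by split; [exact: (measurableT_comp fr mx)|exact: (measurableT_comp fi mx)].
    have mpx : cmeas setT (fun z : T * T => psi z.1).
      by split; [exact: (measurableT_comp mpsi.1 mg)|exact: (measurableT_comp mpsi.2 mg)].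
    apply: cmeasM => //; apply: cmeasM => //; apply: cmeas_cexp.
    apply: cmeasM; first exact: cmeas_cst.
    apply: cmeas_real; apply: measurable_funM => //.
    by apply: measurable_funM => //; exact: measurable_cst.
  + exact: ibH.
  + exact: cintegrable_cabs.
  + move=> g x; rewrite cabsM [X in _ * X]cabsM cabs_cexp_i mulr1.
    by rewrite ler_wpM2r ?cabs_ge0.
  have E : (fun g : T => psi g * damped_fourier f eps (s * g)) =
     (fun g : T => cintegral mu setT (fun x : R => psi g * (f x%:C * (expR (- (eps * `|x|)))%:C * cexp ('i * (s * g * x)%:C)))).
    apply/funext => g; symmetry.
    exact: (cintegralZl _ measurableT (damped_cexp_integrable (s * g) ef Lf e0)).
  by rewrite E.
- exact: integrable_scale.
Qed.

Lemma cmeas_trig s (D : set T) : measurable D -> cmeas D (trig_transform psi s : T -> R[i]).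
Proof. by move=> mD; apply: ccont_cmeas => //; exact: ccont_trig. Qed.

Lemma trig_transform_scale s k x : trig_transform psi (k * s) x = trig_transform psi s (k * x).
Proof.
apply: eq_cintegral => g _; congr (_ * cexp ('i * _%:C)).
by rewrite -mulrA mulrCA !mulrA.
Qed.

(** Along eps = 1 / (n + 1) the damped integrals are O(eps), while dominated convergence sends them
    to the undamped one; the majorant is the modulus of the undamped integrand. *)
Lemma spectral_orthogonality_strict (f : R[i] -> R[i]) (tau h s C : R) :
  entire f -> exp_type_le tau f -> 0 <= tau -> L2 (fun x => f x%:C) ->
  tau < `|s| * h -> (forall g, `|g| < h -> psi g = 0) ->
  0 <= C -> (forall x, cabs (trig_transform psi s x) <= C / (1 + `|x|)) ->
  cintegral mu setT (fun x : R => f x%:C * trig_transform psi s x) = 0.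
Proof.
move=> ef gf tau0 Lf sh psih C0 HC.
have [K HK] := damped_orthogonality ef gf tau0 Lf sh psih.
have mf : cmeas setT (fun x : T => f x%:C) by apply: ccont_cmeas => //; exact: ccont_restrict.
have mm := cmeas_trig s (@measurableT _ T).
have iv := integrable_scale (C ^+ 2) (@measurableT _ T) integrable_invD1sqr.
have [idom im] := integrable_mul_L2 mf mm Lf iv (fun x => decay_sqr C0 (HC x)).
pose en n : R := harmonic n.
have en0 n : 0 < en n by rewrite /en /harmonic /= invr_gt0.
pose F n x : R[i] := f x%:C * (expR (- (en n * `|x|)))%:C * trig_transform psi s x.
have [|||||_ lim] := @cintegral_dct _ _ T mu setT F (fun x => f x%:C * trig_transform psi s x)
  (fun x => cabs (f x%:C * trig_transform psi s x)) measurableT.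
- move=> n; apply: cmeasM => //; apply: ccont_cmeas => //; exact: damped_cont.
- exact: cmeasM.
- exact: cintegrable_cabs.
- move=> n x _; rewrite /F mulrAC [leLHS]cabsM cabs_real ger0_norm ?expR_ge0// ler_piMr ?cabs_ge0//.
  by rewrite -expR0 ler_expR oppr_le0 mulr_ge0// ltW.
- move=> x _; apply: (@cvg_harmonic_bound _ (cabs (f x%:C * trig_transform psi s x) * `|x|)) => n.
  rewrite [X in cabs X](_ : _ = f x%:C * trig_transform psi s x *
    ((expR (- (en n * `|x|)))%:C - 1)); last by rewrite /F; ring.
  rewrite cabsM -mulrA; apply: ler_wpM2l; first exact: cabs_ge0.
  rewrite (_ : (1 : R[i]) = (1 : R)%:C)// -rmorphB /= cabs_real distrC.
  have u0 : 0 <= en n * `|x| by rewrite mulr_ge0// ltW.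
  rewrite ger0_norm; last by rewrite subr_ge0 -expR0 ler_expR oppr_le0.
  rewrite (_ : `|x| * harmonic n = en n * `|x|); last by rewrite mulrC.
  by have := expR_ge1Dx (- (en n * `|x|)); lra.
apply: (cvg_eq0 lim (K := K)) => n.
exact: HK.
Qed.

(* The case [tau = |s| h] is the limit of the frequencies [k s] with [k > 1], whose
   transforms have a common dominating function. *)
Lemma spectral_orthogonality (f : R[i] -> R[i]) (tau h s C : R) :
  entire f -> exp_type_le tau f -> 0 < tau -> L2 (fun x => f x%:C) ->
  tau <= `|s| * h -> (forall g, `|g| < h -> psi g = 0) ->
  0 <= C -> (forall x, cabs (trig_transform psi s x) <= C / (1 + `|x|)) ->
  cintegral mu setT (fun x : R => f x%:C * trig_transform psi s x) = 0.
Proof.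
move=> ef gf tau0 Lf sh psih C0 HC.
have mf : cmeas setT (fun x : T => f x%:C) by apply: ccont_cmeas => //; exact: ccont_restrict.
have iv := integrable_scale (C ^+ 2) (@measurableT _ T) integrable_invD1sqr.
have mm := cmeas_trig s (@measurableT _ T).
have [idom im] := integrable_mul_L2 mf mm Lf iv (fun x => decay_sqr C0 (HC x)).
pose kn n : R := 1 + harmonic n.
have hn0 n : 0 < harmonic n :> R by rewrite /harmonic /= invr_gt0.
have kn1 n : 1 < kn n by rewrite /kn ltrDl.
have kn0 n : 0 < kn n by exact: lt_trans (kn1 n).
have HCn n x : cabs (trig_transform psi (kn n * s) x) <= C / (1 + `|x|).
  rewrite trig_transform_scale (le_trans (HC _))// ler_wpM2l// lef_pV2 ?posrE ?ltr_wpDr//.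
  by rewrite lerD2l normrM ler_peMl// ger0_norm ltW// kn0.
pose F n x : R[i] := f x%:C * trig_transform psi (kn n * s) x.
have [|||||_ lim] := @cintegral_dct _ _ T mu setT F (fun x => f x%:C * trig_transform psi s x)
  (fun x => cabs (f x%:C) ^+ 2 + C ^+ 2 * (1 + x ^+ 2)^-1) measurableT.
- by move=> n; apply: cmeasM => //; exact: cmeas_trig.
- exact: cmeasM.
- exact: idom.
- move=> n x _; rewrite /F cabsM (le_trans _ (lerD (lexx _) (decay_sqr C0 (HCn n x))))//.
  have := sqr_ge0 (cabs (f x%:C) - cabs (trig_transform psi (kn n * s) x)).
  have := cabs_ge0 (f x%:C); have := cabs_ge0 (trig_transform psi (kn n * s) x).
  move: (cabs (f x%:C)) (cabs (trig_transform _ _ _)) => a b b0 a0; rewrite sqrrB => hh.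
  by have := mulr_ge0 a0 b0; rewrite mulr2n in hh; lra.
- move=> x _; pose L := Rintegral mu setT bH * (`|s| * `|H|).
  apply: (@cvg_harmonic_bound _ (cabs (f x%:C) * (L * `|x|))) => n.
  rewrite /F -mulrBr cabsM -mulrA ler_wpM2l ?cabs_ge0// trig_transform_scale.
  have := trig_lip s (kn n * x) x; rewrite -/L.
  rewrite (_ : kn n * x - x = harmonic n * x); last by rewrite /kn; ring.
  by rewrite normrM (ger0_norm (ltW (hn0 n))) -(mulrA L) (mulrC `|x|).
apply: (cvg_eq0 lim (K := 0)) => n.
rewrite mul0r /F (spectral_orthogonality_strict ef gf (ltW tau0) Lf _ psih C0 (HCn n)) ?cabs0//.
rewrite normrM (gtr0_norm (kn0 n)) -mulrA (le_lt_trans sh)// ltr_pMl//.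
exact: lt_le_trans tau0 sh.
Qed.

End Kernel.
End SpectralOrthogonality.

(** * Recovering the value at the origin *)

Section PoissonKernel.
Context {R : realType}.
Notation mu := (@lebesgue_measure R).
Notation T := (measurableTypeR R).
Notation Dp := (`[(0 : R), +oo[%classic : set T).

(** The transform of exp(- r |g|) at frequency s x, which is a scaled Poisson kernel of the half
    plane. Its total mass 2 pi / s is the constant in [sinc_reproducing]. *)
Definition poisson (s r x : R) : R := 2 * r / (r ^+ 2 + s ^+ 2 * x ^+ 2).

Lemma poisson_den (s r x : R) : 0 < r -> 0 < r ^+ 2 + s ^+ 2 * x ^+ 2.
Proof.
move=> r0; have := exprn_gt0 2 r0; have := mulr_ge0 (sqr_ge0 s) (sqr_ge0 x); lra.
Qed.

Lemma poisson_ge0 (s r x : R) : 0 < r -> 0 <= poisson s r x.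
Proof. by move=> r0; rewrite divr_ge0 ?(ltW (poisson_den _ _ r0))// mulr_ge0// ltW. Qed.

Lemma continuous_poisson (s r : R) : 0 < r -> continuous (poisson s r).
Proof.
move=> r0 x; apply: cvgM; first exact: cvg_cst.
apply: cvgV; first by rewrite gt_eqF// poisson_den.
apply: cvgD; first exact: cvg_cst.
apply: cvgM; first exact: cvg_cst.
by under eq_fun do rewrite expr2; apply: cvgM; exact: cvg_id.
Qed.

Lemma integral0_poisson (s r : R) : 0 < s -> 0 < r ->
  (\int[mu]_(x in Dp) (poisson s r x)%:E = (pi / s)%:E)%E.
Proof.
move=> s0 r0; have r1 : r != 0 by rewrite gt_eqF.
have s1 : s != 0 by rewrite gt_eqF.
pose F x : R := 2 / s * atan (s / r * x).
have dF (x : R) : is_derive x 1 F (poisson s r x).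
  have dl : is_derive x 1 (fun x : R => s / r * x) (s / r).
    by apply: is_derive_eq; rewrite /GRing.scale /= mulr1.
  have da := @is_derive1_comp _ atan _ _ _ _ (is_derive1_atan _) dl.
  have H := @is_deriveZ _ _ _ _ (2 / s) _ _ _ da.
  apply: is_derive_eq H _.
  rewrite /poisson /GRing.scale /=; field.
  by rewrite s1 r1 exprMn !andbT gt_eqF ?poisson_den.
rewrite (@ge0_continuous_FTC2y _ _ F 0 (2 / s * (pi / 2))).
- by rewrite -EFinB /F mulr0 atan0 mulr0 subr0; congr EFin; field.
- by move=> x _; exact: poisson_ge0.
- by apply: continuous_subspaceT; exact: continuous_poisson.
- apply: cvgM; first exact: cvg_cst.
  apply: (@cvg_comp _ _ _ (fun x => s / r * x) atan); last exact: cvgy_atan.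
  by apply: gt0_cvgMry => //; rewrite divr_gt0.
- by move=> x _; have [] := dF x.
- apply: cvg_at_right_filter; apply: differentiable_continuous; apply/derivable1_diffP.
  by have [] := dF 0.
- by move=> x _; rewrite derive1E; have [_] := dF x.
Qed.

(** The inequality 2 r s |x| <= r^2 + s^2 x^2. Being uniform in r, it controls the peak at the
    origin once a factor |x| is available. *)
Lemma poisson_bound1 (s r x : R) : 0 < s -> 0 < r -> poisson s r x * `|x| <= s^-1.
Proof.
move=> s0 r0; rewrite /poisson mulrAC ler_pdivrMr ?poisson_den//.
rewrite ler_pdivlMl//.
have := sqr_ge0 (r - s * `|x|).
rewrite sqrrB exprMn real_normK ?num_real// mulr2n.
by move=> h; rewrite (_ : s * (2 * r * `|x|) = r * (s * `|x|) + r * (s * `|x|)); [lra|ring].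
Qed.

Lemma poisson_bound2 (s r x : R) : 0 < r -> poisson s r x * (s ^+ 2 * x ^+ 2) <= 2 * r.
Proof.
move=> r0; rewrite /poisson mulrAC ler_pdivrMr ?poisson_den//.
by apply: ler_wpM2l; [rewrite mulr_ge0// ltW|rewrite lerDr sqr_ge0].
Qed.

Lemma integral_poisson (s r : R) : 0 < s -> 0 < r ->
  mu.-integrable setT (EFin \o poisson s r) /\ Rintegral mu setT (poisson s r) = 2 * pi / s.
Proof.
move=> s0 r0; have cp := @continuous_poisson s r r0.
have E : (\int[mu]_x (poisson s r x)%:E = (2 * pi / s)%:E)%E.
  rewrite (ge0_symfun_integralT (fun x => @poisson_ge0 s r x r0) cp).
    have := integral0_poisson s0 r0; rewrite set_itvcy => ->.
    by rewrite -EFinM mulrA.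
  by move=> x; rewrite /poisson /= sqrrN.
split; last by rewrite /Rintegral E.
apply/integrableP; split; first by apply/measurable_EFinP; exact: continuous_measurable_fun.
rewrite (eq_integral (fun x : T => (poisson s r x)%:E)) ?E ?ltry//.
by move=> x _; rewrite /= ger0_norm// poisson_ge0.
Qed.

(* The Poisson kernels form an approximate identity; differentiability at 0
   makes [f x - f 0] absorb their singularity at the origin. *)
Lemma poisson_approx (f : R[i] -> R[i]) (s : R) : entire f -> L2 (fun x => f x%:C) -> 0 < s ->
  (fun n => cabs (cintegral mu setT (fun x : R => f x%:C * (poisson s (harmonic n) x)%:C) -
                  f 0 * (2 * pi / s)%:C)) @ \oo --> (0 : R).
Proof.
move=> ef Lf s0.
have hn0 n : 0 < harmonic n :> R by rewrite /harmonic /= invr_gt0.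
have hn1 n : harmonic n <= 1 :> R by rewrite /harmonic /= invf_le1// ler1n.
have mf : cmeas setT (fun x : T => f x%:C) by apply: ccont_cmeas => //; exact: ccont_restrict.
have mP n : cmeas setT (fun x : T => (poisson s (harmonic n) x)%:C).
  by apply: ccont_cmeas => //; apply: ccont_real; exact: continuous_poisson.
have [d /cdiff_bound[dl dl0 Hd]] := (entireP f).1 ef 0.
pose K := cabs d + 1; have K0 : 0 < K by rewrite ltr_wpDl ?cabs_ge0.
(* Chosen so that 1 <= b x^2 / (1 + x^2) whenever |x| >= [dl]. *)
pose b := 1 + (dl ^+ 2)^-1; have b0 : 0 < b by rewrite ltr_wpDr// invr_ge0 sqr_ge0.
pose C1 := K / s * (1 + dl ^+ 2).
pose C2 := 2 / s ^+ 2 * (b ^+ 2 + cabs (f 0) * b).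
pose C3 := 2 / s ^+ 2.
have C10 : 0 <= C1.
  by apply: mulr_ge0; [apply: divr_ge0; exact: ltW|rewrite addr_ge0// sqr_ge0].
have C30 : 0 <= C3 by rewrite divr_ge0// sqr_ge0.
have C20 : 0 <= C2.
  by apply: mulr_ge0 => //; rewrite addr_ge0 ?sqr_ge0// mulr_ge0 ?cabs_ge0// ltW.
(* [C1] dominates the part near 0, where |f x - f 0| <= K |x| cancels the peak; [C2] and [C3]
   dominate the rest, where the kernel is O(1 / (1 + x^2)). *)
pose v (x : R) := C3 * cabs (f x%:C) ^+ 2 + (C1 + C2) * (1 + x ^+ 2)^-1.
have iv : mu.-integrable setT (EFin \o v).
  apply: integrable_add => //; first exact: integrable_scale.
  by apply: integrable_scale => //; exact: integrable_invD1sqr.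
pose G n (x : R) := (f x%:C - f 0) * (poisson s (harmonic n) x)%:C.
have Gv n x : cabs (G n x) <= v x.
  rewrite /G cabsM cabs_real ger0_norm ?poisson_ge0//.
  have px : 0 < 1 + x ^+ 2 by rewrite ltr_wpDr ?sqr_ge0.
  have [h|h] := ltP `|x| dl.
    have := Hd x%:C; rewrite subr0 cabs_real => /(_ h) k.
    apply: (@le_trans _ _ (K * `|x| * poisson s (harmonic n) x)).
      by apply: ler_wpM2r k; exact: poisson_ge0.
    rewrite -mulrA (mulrC `|x|).
    apply: (@le_trans _ _ (K * s^-1)).
      by apply: ler_wpM2l; [exact: ltW|exact: poisson_bound1].
    rewrite /v; apply: (@le_trans _ _ (C1 * (1 + x ^+ 2)^-1)).
      rewrite /C1 -mulrA ler_peMr//; first by apply: divr_ge0; exact: ltW.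
      rewrite ler_pdivlMr// mul1r lerD2l -[x ^+ 2]real_normK ?num_real//.
      by rewrite lerXn2r ?nnegrE// ltW.
    rewrite mulrDl.
    have : 0 <= C3 * cabs (f x%:C) ^+ 2 by rewrite mulr_ge0 ?sqr_ge0.
    have : 0 <= C2 * (1 + x ^+ 2)^-1 by rewrite mulr_ge0// invr_ge0 ltW.
    lra.
  have x2 : 0 < x ^+ 2.
    by rewrite -[x ^+ 2]real_normK ?num_real// exprn_gt0// (lt_le_trans dl0).
  have Pb : poisson s (harmonic n) x <= C3 * (b * (1 + x ^+ 2)^-1).
    have := @poisson_bound2 s (harmonic n) x (hn0 n) => k.
    have s2x : 0 < s ^+ 2 * x ^+ 2 by rewrite mulr_gt0// exprn_gt0.
    rewrite -ler_pdivlMr// in k; apply: (le_trans k).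
    rewrite ler_pdivrMr//.
    apply: (@le_trans _ _ 2); first by have := hn1 n; lra.
    rewrite (_ : C3 * (b / (1 + x ^+ 2)) * (s ^+ 2 * x ^+ 2) = 2 * (b * x ^+ 2 / (1 + x ^+ 2))); last first.
      by rewrite /C3; field; rewrite !gt_eqF.
    rewrite ler_peMr// ler_pdivlMr// mul1r /b mulrDl mul1r addrC lerD2l.
    rewrite mulrC ler_pdivlMr ?exprn_gt0// mul1r -[x ^+ 2]real_normK ?num_real//.
    by rewrite lerXn2r ?nnegrE// ltW.
  set u := (1 + x ^+ 2)^-1 in Pb *; have u0 : 0 <= u by rewrite invr_ge0 ltW.
  have u1 : u <= 1 by rewrite invf_le1// lerDl sqr_ge0.
  apply: (@le_trans _ _ ((cabs (f x%:C) + cabs (f 0)) * (C3 * (b * u)))).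
    by apply: ler_pM; rewrite ?cabs_ge0 ?poisson_ge0// cabsB.
  rewrite /v /C2 -/C3 -/u.
  have t1 : cabs (f x%:C) * (b * u) <= cabs (f x%:C) ^+ 2 + b ^+ 2 * u.
    have := sqr_ge0 (cabs (f x%:C) - b * u); rewrite sqrrB mulr2n => h1.
    have h2 : (b * u) ^+ 2 <= b ^+ 2 * u.
      by rewrite exprMn ler_wpM2l ?sqr_ge0// expr2 ler_piMl.
    have h3 : 0 <= cabs (f x%:C) * (b * u) by rewrite mulr_ge0 ?cabs_ge0// mulr_ge0// ltW.
    lra.
  have := ler_wpM2l C30 t1; have := mulr_ge0 C10 u0.
  rewrite -/C3; move: (cabs (f x%:C)) (cabs (f 0)) => A B; lra.
have mG n : cmeas setT (fun x : T => G n x).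
  by apply: cmeasM => //; apply: cmeasB => //; exact: cmeas_cst.
have [||||ig lim] := @cintegral_dct _ _ T mu setT (fun n x => G n x) (fun=> 0) v measurableT mG.
- exact: cmeas_cst.
- exact: iv.
- by move=> n x _; exact: Gv.
- move=> x _; have [->|x0] := eqVneq x 0.
    by rewrite /G; under eq_fun do rewrite subrr mul0r subr0 cabs0; exact: cvg_cst.
  pose Kx := cabs (f x%:C - f 0) * (2 / (s ^+ 2 * x ^+ 2)).
  apply: (@cvg_harmonic_bound _ _ Kx) => n; rewrite subr0 /G cabsM /Kx -mulrA.
  apply: ler_wpM2l; first exact: cabs_ge0.
  rewrite cabs_real ger0_norm ?poisson_ge0//.
  have s2x : 0 < s ^+ 2 * x ^+ 2.
    by apply: mulr_gt0; [exact: exprn_gt0|rewrite lt_def sqrf_eq0 x0 sqr_ge0].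
  have := @poisson_bound2 s (harmonic n) x (hn0 n).
  by rewrite -ler_pdivlMr// mulrAC.
rewrite (_ : (fun n => _) = (fun n => cabs (cintegral mu setT (fun x : R => G n x) - cintegral mu setT (fun=> 0 : R[i])))); first exact: lim.
apply/funext => n; congr cabs.
have -> : cintegral mu setT (fun=> 0 : R[i]) = 0 by rewrite /cintegral /Rintegral !integral0.
have [iP eP] := integral_poisson s0 (hn0 n).
have iG : cintegrable mu setT (fun x : R => G n x).
  by apply: (cintegrable_dom measurableT (mG n) iv) => x _; exact: Gv.
have iP2 := cintegrableZl (f 0) measurableT (cintegrable_real iP).
have -> : f 0 * (2 * pi / s)%:C = cintegral mu setT (fun x : R => f 0 * (poisson s (harmonic n) x)%:C).
  by rewrite cintegralZl ?cintegral_real ?eP//; exact: cintegrable_real.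
rewrite subr0 -cintegralB//; last first.
  apply: eq_cintegrable (cintegrableD measurableT iG iP2) => // x _.
  by rewrite /G -mulrDl subrK.
by apply: eq_cintegral => x _; rewrite /G mulrBl.
Qed.

Section Truncation.
Variables (s r N : R).
Hypotheses (r0 : 0 < r) (N0 : 0 <= N).

(** For r = 0 this is the plain window; for r > 0 and growing N it tends to the profile whose
    transform is the Poisson kernel. *)
Definition exp_profile (r N g : R) : R[i] :=
  (expR (- (r * `|g|)) * \1_(`[- N, N]%classic : set R) g)%:C.

Let w x : R[i] := r%:C - 'i * (s * x)%:C.
Let wc x : R[i] := r%:C + 'i * (s * x)%:C.

Let Rew x : complex.Re (w x) = r.
Proof. by rewrite Re_add Re_opp Re_iM /= oppr0 subr0. Qed.

Let Rewc x : complex.Re (wc x) = r.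
Proof. by rewrite Re_add Re_iM /= oppr0 addr0. Qed.

Let w0 x : w x != 0.
Proof. by apply: contraTneq r0 => wx0; rewrite -(Rew x) wx0 ltxx. Qed.

Let wc0 x : wc x != 0.
Proof. by apply: contraTneq r0 => wx0; rewrite -(Rewc x) wx0 ltxx. Qed.

Lemma trig_exp_profile x : trig_transform (exp_profile r N) s x =
  (1 - cexp (- w x * N%:C)) / w x + (1 - cexp (- wc x * N%:C)) / wc x.
Proof.
have -> : trig_transform (exp_profile r N) s x =
    cintegral mu `[- N, N] (fun g : R => (expR (- (r * `|g|)))%:C * cexp ('i * (s * (x * g))%:C)).
  rewrite cintegral_mkcond; apply: eq_cintegral => g _.
  by rewrite /exp_profile rmorphM /= mulrAC mulrC.
have ce : ccont (fun g : R => cexp ('i * (s * (x * g))%:C)).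
  by have := ccont_cexp_i (s * x); under eq_fun do rewrite -mulrA.
rewrite (@cintegral_split _ _ (- N) 0 N); first last.
- exact: N0.
- by rewrite oppr_le0.
- by apply: ccontM => //; apply: ccont_real; exact: continuous_expRN_norm.
have cl (k : R[i]) : ccont (fun g : R => cexp (k * g%:C)) by apply: ccont_cexp; exact: ccont_lin.
rewrite addrC; congr (_ + _).
  have -> : cintegral mu `[0, N] (fun g : R => (expR (- (r * `|g|)))%:C * cexp ('i * (s * (x * g))%:C)) =
      cintegral mu `[0, N] (fun g : R => cexp (- w x * g%:C)).
    apply: eq_cintegral => g; rewrite inE /= in_itv /= => /andP[g0 _].
    rewrite -cexp_real -cexpD ger0_norm//; congr cexp.
    by rewrite /w rmorphN !rmorphM /=; ring.
  have dF (g : R) : cder (fun g => - (w x)^-1 * cexp (- w x * g%:C)) g (cexp (- w x * g%:C)).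
    apply: cder_eq (cderZ _ (cder_cexp (cder_lin (- w x) g))) _.
    by field; exact: w0.
  rewrite (cintegral_FTC N0 (cl _) dF) mulr0 cexp0.
  by field; exact: w0.
have -> : cintegral mu `[- N, 0] (fun g : R => (expR (- (r * `|g|)))%:C * cexp ('i * (s * (x * g))%:C)) =
    cintegral mu `[- N, 0] (fun g : R => cexp (wc x * g%:C)).
  apply: eq_cintegral => g; rewrite inE /= in_itv /= => /andP[_ g0].
  rewrite -cexp_real -cexpD ler0_norm//; congr cexp.
  by rewrite /wc rmorphN !rmorphM rmorphN /=; ring.
have dF (g : R) : cder (fun g => (wc x)^-1 * cexp (wc x * g%:C)) g (cexp (wc x * g%:C)).
  apply: cder_eq (cderZ _ (cder_cexp (cder_lin (wc x) g))) _.
  by field; exact: wc0.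
have N0' : - N <= 0 by rewrite oppr_le0.
rewrite (cintegral_FTC N0' (cl _) dF) mulr0 cexp0 rmorphN mulrN -mulNr.
by field; exact: wc0.
Qed.

Lemma poissonE x : (poisson s r x)%:C = (w x)^-1 + (wc x)^-1.
Proof.
have d0 : r ^+ 2 + s ^+ 2 * x ^+ 2 != 0 by rewrite gt_eqF// poisson_den.
have i2 : 'i * 'i = -1 :> R[i] by rewrite -expr2 sqr_i.
have ww : w x * wc x = (r ^+ 2 + s ^+ 2 * x ^+ 2)%:C.
  rewrite /w /wc !rmorphD !rmorphM /=.
  transitivity (r%:C ^+ 2 - ('i * 'i) * (s%:C ^+ 2 * x%:C ^+ 2) :> R[i]); first by ring.
  by rewrite i2; ring.
have -> : (w x)^-1 + (wc x)^-1 = (w x + wc x) / (w x * wc x).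
  by field; rewrite w0 wc0.
rewrite ww /poisson rmorphM fmorphV /=; congr (_ * _).
by rewrite /w /wc rmorphM /= rmorph_nat; ring.
Qed.

(** Both [w x] and [wc x] have real part r and an imaginary part of modulus |s x|. *)
Lemma cabs_w_ge x : Num.max r (`|s| * `|x|) <= cabs (w x) /\ Num.max r (`|s| * `|x|) <= cabs (wc x).
Proof.
have h1 := Re_le_cabs (w x); have h2 := Im_le_cabs (w x).
have h3 := Re_le_cabs (wc x); have h4 := Im_le_cabs (wc x).
rewrite Rew ger0_norm ?(ltW r0)// in h1; rewrite Rewc ger0_norm ?(ltW r0)// in h3.
move: h2 h4; rewrite /w /wc !Im_add Im_opp Im_iM /= add0r add0r normrN normrM => h2 h4.
by rewrite !ge_max h1 h2 h3 h4.
Qed.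

Lemma exp_profile_le1 g : cabs (exp_profile r N g) <= 1.
Proof.
rewrite /exp_profile cabs_real ger0_norm ?mulr_ge0 ?expR_ge0 ?indicE ?ler0n//.
rewrite -[leRHS]mulr1 ler_pM ?expR_ge0 ?ler0n ?lern1 ?leq_b1//.
by rewrite -expR0 ler_expR oppr_le0 mulr_ge0// ltW.
Qed.

Lemma exp_profile_supp g : N < `|g| -> exp_profile r N g = 0.
Proof.
move=> h; rewrite /exp_profile indicE memNset ?mulr0//= in_itv /= -ler_norml => /(lt_le_trans h).
by rewrite ltxx.
Qed.

Lemma cmeas_exp_profile : cmeas setT (exp_profile r N : T -> R[i]).
Proof.
apply: cmeas_real; apply: measurable_funM.
  by apply: continuous_measurable_fun; exact: continuous_expRN_norm.
exact: measurable_indic.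
Qed.

Lemma trig_exp_profile_tail x : cabs (trig_transform (exp_profile r N) s x - (poisson s r x)%:C) <=
  expR (- (r * N)) * (2 / Num.max r (`|s| * `|x|)).
Proof.
rewrite trig_exp_profile poissonE.
have m0 : 0 < Num.max r (`|s| * `|x|) by rewrite lt_max r0.
have [h1 h2] := cabs_w_ge x.
rewrite (_ : _ - _ = - (cexp (- w x * N%:C) / w x + cexp (- wc x * N%:C) / wc x)); last by ring.
rewrite cabsN (le_trans (cabsD _ _))// (cabsM (cexp _)) (cabsM (cexp (- wc x * _))) !cabsV !cabs_cexp.
have re (z : R[i]) : complex.Re (- z * N%:C) = - (complex.Re z * N).
  by rewrite Re_mul Re_opp /= mulr0 subr0 mulNr.
rewrite !re Rew Rewc -mulrDr; apply: ler_wpM2l; first exact: expR_ge0.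
rewrite (_ : 2 / Num.max r (`|s| * `|x|) = (Num.max r (`|s| * `|x|))^-1 + (Num.max r (`|s| * `|x|))^-1); last by ring.
by apply: lerD; rewrite lef_pV2 ?posrE// (lt_le_trans m0).
Qed.

Lemma trig_exp_profile_le x : cabs (trig_transform (exp_profile r N) s x) <= 4 / Num.max r (`|s| * `|x|).
Proof.
rewrite trig_exp_profile.
have m0 : 0 < Num.max r (`|s| * `|x|) by rewrite lt_max r0.
have [h1 h2] := cabs_w_ge x.
have re (z : R[i]) : complex.Re z = r -> cabs (1 - cexp (- z * N%:C)) <= 2.
  move=> zr; rewrite (le_trans (cabsB _ _))// cabs1 cabs_cexp Re_mul Re_opp zr /= mulr0 subr0 mulNr.
  rewrite (_ : (2 : R) = 1 + 1)// lerD2l -expR0 ler_expR oppr_le0 mulr_ge0 ?(ltW r0)//.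
rewrite (le_trans (cabsD _ _))// !cabsM !cabsV.
rewrite (_ : 4 / _ = 2 / Num.max r (`|s| * `|x|) + 2 / Num.max r (`|s| * `|x|)); last by ring.
by apply: lerD; apply: ler_pM; rewrite ?invr_ge0 ?cabs_ge0 ?re//;
  rewrite lef_pV2 ?posrE// (lt_le_trans m0).
Qed.

End Truncation.

Lemma cabs_le_decay (z : R[i]) (A B x : R) : 0 <= A -> 0 <= B ->
  cabs z <= A -> cabs z * `|x| <= B -> cabs z <= (A + B) / (1 + `|x|).
Proof.
move=> A0 B0 h1 h2; rewrite ler_pdivlMr; last by rewrite ltr_wpDr.
by rewrite mulrDr mulr1; exact: lerD.
Qed.

Lemma max_decay (s r x c : R) : 0 < s -> 0 < r -> 0 <= c ->
  c / Num.max r (`|s| * `|x|) <= (c / r + c / s) / (1 + `|x|).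
Proof.
move=> s0 r0 c0; have m0 : 0 < Num.max r (`|s| * `|x|) by rewrite lt_max r0.
have c1 : 0 <= c / Num.max r (`|s| * `|x|) by rewrite divr_ge0// ltW.
have E : c / Num.max r (`|s| * `|x|) = cabs (c / Num.max r (`|s| * `|x|))%:C.
  by rewrite cabs_real (ger0_norm c1).
rewrite [leLHS]E; apply: cabs_le_decay; rewrite ?divr_ge0 ?(ltW r0) ?(ltW s0)// -E.
  by rewrite ler_wpM2l// lef_pV2 ?posrE// le_max lexx.
rewrite mulrAC ler_pdivrMr// -mulrA ler_wpM2l// ler_pdivlMl//.
by rewrite le_max (gtr0_norm s0) lexx orbT.
Qed.

(* The two truncations differ only at frequencies [h <= |g| <= N], which [f] does not see. *)
Lemma trig_exp_profile_poisson (f : R[i] -> R[i]) (tau s r h : R) :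
  entire f -> exp_type_le tau f -> 0 < tau -> L2 (fun x => f x%:C) ->
  0 < s -> 0 < r -> 0 < h -> tau <= s * h ->
  cintegral mu setT (fun x : R => f x%:C * trig_transform (exp_profile r h) s x) =
  cintegral mu setT (fun x : R => f x%:C * (poisson s r x)%:C).
Proof.
move=> ef gf tau0 Lf s0 r0 h0 sh.
have mf : cmeas setT (fun x : T => f x%:C) by apply: ccont_cmeas => //; exact: ccont_restrict.
have sn : `|s| = s by rewrite gtr0_norm.
have mp N := cmeas_exp_profile r N.
have pb N g := @exp_profile_le1 r N r0 g.
have ps N g := @exp_profile_supp r N g.
have mt N : cmeas setT (trig_transform (exp_profile r N) s : T -> R[i]).
  exact: (@cmeas_trig _ _ 1 N (mp N) (pb N) (ps N)).
pose C4 := 4 / r + 4 / s.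
have C40 : 0 <= C4 by rewrite addr_ge0 ?divr_ge0 ?(ltW r0) ?(ltW s0).
have dec N : 0 <= N -> forall x, cabs (trig_transform (exp_profile r N) s x) <= C4 / (1 + `|x|).
  by move=> N0 x; rewrite (le_trans (trig_exp_profile_le s r0 N0 x))// max_decay.
have iv C := integrable_scale (C ^+ 2) (@measurableT _ T) integrable_invD1sqr.
have im N (N0 : 0 <= N) := (integrable_mul_L2 mf (mt N) Lf (iv C4) (fun x => decay_sqr C40 (dec N N0 x))).2.
have same N : h < N -> cintegral mu setT (fun x : R => f x%:C * trig_transform (exp_profile r h) s x) =
    cintegral mu setT (fun x : R => f x%:C * trig_transform (exp_profile r N) s x).
  move=> hN; have N0 : 0 <= N by rewrite ltW// (lt_trans h0).
  apply/esym/eqP; rewrite -subr_eq0 -cintegralB//; [|exact: im|by apply: im; exact: ltW].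
  pose psi (g : R) := exp_profile r N g - exp_profile r h g.
  have mpsi : cmeas setT (psi : T -> R[i]) by exact: cmeasB.
  have psib g : cabs (psi g) <= 2.
    by rewrite (le_trans (cabsB _ _))// (_ : (2 : R) = 1 + 1)// lerD.
  have psis g : N < `|g| -> psi g = 0.
    by move=> Ng; rewrite /psi !ps ?subrr// (lt_trans hN).
  have psi0 g : `|g| < h -> psi g = 0.
    move=> gh; rewrite /psi /exp_profile !indicE !mem_set ?subrr//= in_itv /= -ler_norml ltW//.
    exact: lt_trans gh hN.
  have trigE x : trig_transform psi s x =
      trig_transform (exp_profile r N) s x - trig_transform (exp_profile r h) s x.
    rewrite /trig_transform -cintegralB//.
    - by apply: eq_cintegral => g _; rewrite mulrBl.
    - exact: (@trig_integrable _ _ 1 N (mp N) (pb N) (ps N)).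
    - exact: (@trig_integrable _ _ 1 h (mp h) (pb h) (ps h)).
  have := @spectral_orthogonality _ psi 2 N mpsi psib psis f tau h s (C4 + C4) ef gf tau0 Lf.
  rewrite sn => /(_ sh psi0 (addr_ge0 C40 C40)) H.
  apply/eqP; rewrite -[RHS]H; first by apply: eq_cintegral => x _; rewrite trigE mulrBr.
  by move=> x; rewrite trigE (le_trans (cabsB _ _))// mulrDl lerD// dec// ltW.
have [iP _] := integral_poisson s0 r0.
pose C2 := 2 / r + 2 / s.
have C20 : 0 <= C2 by rewrite addr_ge0 ?divr_ge0 ?(ltW r0) ?(ltW s0).
have mP : cmeas setT (fun x : T => (poisson s r x)%:C).
  by apply: ccont_cmeas => //; apply: ccont_real; exact: continuous_poisson.
(* The profile truncated at 0 has transform 0, so there the truncation error is the Poisson kernel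
   itself and inherits the bound on that error. *)
have Pdec x : cabs (poisson s r x)%:C <= C4 / (1 + `|x|).
  have N0 := lexx (0 : R); have := trig_exp_profile_tail s r0 N0 x.
  rewrite mulr0 oppr0 expR0 mul1r.
  have -> : trig_transform (exp_profile r 0) s x = 0.
    by rewrite trig_exp_profile// !mulr0 cexp0 !subrr !mul0r addr0.
  rewrite sub0r cabsN => k; rewrite (le_trans k)// (le_trans (max_decay x s0 r0 _))//.
  apply: ler_wpM2r; first by rewrite invr_ge0 addr_ge0.
  by rewrite /C4; apply: lerD; apply: ler_wpM2r; rewrite ?invr_ge0 ?(ltW r0) ?(ltW s0)// ler_nat.
have iP2 := (integrable_mul_L2 mf mP Lf (iv C4) (fun x => decay_sqr C40 (Pdec x))).2.
apply/eqP; rewrite -subr_eq0 -cabs_eq0 eq_le cabs_ge0 andbT.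
pose K := Rintegral mu setT (fun x : R => cabs (f x%:C) ^+ 2 + C2 ^+ 2 * (1 + x ^+ 2)^-1).
have iK := integrable_add measurableT Lf (iv C2).
have K0 : 0 <= K.
  apply: Rintegral_ge0 => x _; rewrite addr_ge0 ?sqr_ge0// mulr_ge0 ?sqr_ge0// invr_ge0.
  by rewrite addr_ge0 ?sqr_ge0.
apply: (le0_lim K0) => e e0.
have [N [hN eN]] : exists N, h < N /\ expR (- (r * N)) <= e.
  (* This [N] exceeds h and gives exp(r N) >= 1 + r N >= 1 / e. *)
  pose N := h + 1 + e^-1 / r; exists N; split.
    by rewrite /N -addrA ltrDl ltr_wpDr ?divr_ge0 ?invr_ge0 ?ltW.
  rewrite expRN -[leRHS]invrK lef_pV2 ?posrE ?expR_gt0 ?invr_gt0//.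
  apply: le_trans (expR_ge1Dx _); rewrite /N mulrDr mulrCA divff ?gt_eqF// mulr1.
  have := mulr_ge0 (ltW r0) (ltW h0); lra.
have N0 : 0 <= N by rewrite ltW// (lt_trans h0).
rewrite (same N hN) -cintegralB//; last exact: im.
have -> : K * e = Rintegral mu setT (fun x : R => e * (cabs (f x%:C) ^+ 2 + C2 ^+ 2 * (1 + x ^+ 2)^-1)).
  by rewrite [RHS]RintegralZl// [LHS]mulrC.
apply: cabs_cintegral => //.
- by apply: cmeasB; apply: cmeasM.
- exact: integrable_scale.
- move=> x _; rewrite -mulrBr cabsM.
  have k := trig_exp_profile_tail s r0 N0 x.
  have m0 : 0 < Num.max r (`|s| * `|x|) by rewrite lt_max r0.
  have d0 : 0 <= 2 / Num.max r (`|s| * `|x|) by rewrite divr_ge0// ltW.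
  have k2 : cabs (trig_transform (exp_profile r N) s x - (poisson s r x)%:C) <= e * (2 / Num.max r (`|s| * `|x|)).
    by apply: (le_trans k); apply: ler_wpM2r.
  apply: (@le_trans _ _ (cabs (f x%:C) * (e * (2 / Num.max r (`|s| * `|x|))))).
    by apply: ler_wpM2l => //; exact: cabs_ge0.
  rewrite mulrCA; apply: ler_wpM2l; first exact: ltW.
  have h2 : (2 / Num.max r (`|s| * `|x|)) ^+ 2 <= C2 ^+ 2 * (1 + x ^+ 2)^-1.
    have E : 2 / Num.max r (`|s| * `|x|) = cabs (2 / Num.max r (`|s| * `|x|))%:C.
      by rewrite cabs_real (ger0_norm d0).
    by rewrite [X in X ^+ 2]E; apply: decay_sqr => //; rewrite -E; exact: max_decay.
  have := sqr_ge0 (cabs (f x%:C) - 2 / Num.max r (`|s| * `|x|)).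
  have := cabs_ge0 (f x%:C).
  move: (cabs (f x%:C)) (2 / Num.max r _) d0 h2 => a b b0 h2 a0; rewrite sqrrB => hh.
  by have := mulr_ge0 a0 b0; rewrite mulr2n in hh; lra.
Qed.

Lemma cvg_cabs_unique (a : nat -> R[i]) (l l' : R[i]) :
  (fun n => cabs (a n - l)) @ \oo --> (0 : R) ->
  (fun n => cabs (a n - l')) @ \oo --> (0 : R) -> l = l'.
Proof.
move=> al al'; apply/eqP; rewrite -subr_eq0 -cabs_eq0 eq_le cabs_ge0 andbT.
apply/ler_addgt0Pr => e e0; rewrite add0r.
have e2 : 0 < e / 2 by rewrite divr_gt0.
have /cvgrPdist_lt/(_ _ e2)[N1 _ H1] := al; have /cvgrPdist_lt/(_ _ e2)[N2 _ H2] := al'.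
have := H1 (maxn N1 N2) (leq_maxl _ _); have := H2 (maxn N1 N2) (leq_maxr _ _).
rewrite !sub0r !normrN !(ger0_norm (cabs_ge0 _)); move: (a _) => I h1 h2.
rewrite (_ : l - l' = (I - l') - (I - l)); last by ring.
by rewrite (le_trans (cabsB _ _))//; lra.
Qed.

(** Let r tend to 0 in [trig_exp_profile_poisson]. On the left the profiles tend to the window,
    whose transform is a scaled sinc; on the right Poisson kernels of mass 2 pi / s concentrate at
    0. *)
Theorem sinc_reproducing (f : R[i] -> R[i]) (tau s h : R) :
  entire f -> exp_type_le tau f -> 0 < tau -> L2 (fun x => f x%:C) ->
  0 < s -> 0 < h -> tau <= s * h ->
  cintegral mu setT (fun x : R => f x%:C * trig_transform (exp_profile 0 h) s x) = f 0 * (2 * pi / s)%:C.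
Proof.
move=> ef gf tau0 Lf s0 h0 sh.
have mf : cmeas setT (fun x : T => f x%:C) by apply: ccont_cmeas => //; exact: ccont_restrict.
have hn0 n : 0 < harmonic n :> R by rewrite /harmonic /= invr_gt0.
have hn1 n : harmonic n <= 1 :> R by rewrite /harmonic /= invf_le1// ler1n.
have pb r g : 0 <= r -> cabs (exp_profile r h g) <= 1.
  move=> r0; rewrite /exp_profile cabs_real ger0_norm ?mulr_ge0 ?expR_ge0 ?indicE ?ler0n//.
  rewrite -[leRHS]mulr1 ler_pM ?expR_ge0 ?ler0n ?lern1 ?leq_b1//.
  by rewrite -expR0 ler_expR oppr_le0 mulr_ge0.
have ps r g := @exp_profile_supp r h g.
have mp r := cmeas_exp_profile r h.
have mt r (r0 : 0 <= r) : cmeas setT (trig_transform (exp_profile r h) s : T -> R[i]).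
  exact: (@cmeas_trig _ _ 1 h (mp r) (fun g => pb r g r0) (ps r)).
have ib := integrable_indic_itv 1 (- h) h.
pose J := Rintegral mu setT (fun g : R => 1 * \1_(`[- h, h]%classic : set R) g).
have J0 : 0 <= J by apply: Rintegral_ge0 => g _; rewrite mul1r indicE ler0n.
have trigJ r x : 0 <= r -> cabs (trig_transform (exp_profile r h) s x) <= J.
  move=> r0; apply: cabs_cintegral => //.
    exact: cintegrable_meas (@trig_integrable _ _ 1 h (mp r) (fun g => pb r g r0) (ps r) s x).
  move=> g _; rewrite cabsM cabs_cexp_i mulr1 /exp_profile cabs_real ger0_norm ?mulr_ge0 ?expR_ge0 ?indicE ?ler0n//.
  by apply: ler_wpM2r; rewrite ?ler0n// -expR0 ler_expR oppr_le0 mulr_ge0.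
(* A majorant uniform in r: the mass [J] of the window controls small x, where 4 / max(r, s |x|)
   degenerates, and 4 / (s |x|) controls large x. *)
pose C := J + 4 / s.
have C0 : 0 <= C by rewrite addr_ge0// divr_ge0// ltW.
have dec n x : cabs (trig_transform (exp_profile (harmonic n) h) s x) <= C / (1 + `|x|).
  apply: cabs_le_decay => //; first by rewrite divr_ge0// ltW.
    by apply: trigJ; exact: ltW.
  have := trig_exp_profile_le s (hn0 n) (ltW h0) x => k.
  have m0 : 0 < Num.max (harmonic n) (`|s| * `|x|) by rewrite lt_max hn0.
  apply: (le_trans (ler_wpM2r (normr_ge0 x) k)).
  rewrite mulrAC ler_pdivrMr// -mulrA ler_wpM2l// ler_pdivlMl//.
  by rewrite le_max (gtr0_norm s0) lexx orbT.
have iv := integrable_scale (C ^+ 2) (@measurableT _ T) integrable_invD1sqr.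
have i2 := integrable_add measurableT Lf iv.
pose F n (x : R) := f x%:C * trig_transform (exp_profile (harmonic n) h) s x.
have [|||||_ lim] := @cintegral_dct _ _ T mu setT F
  (fun x => f x%:C * trig_transform (exp_profile 0 h) s x)
  (fun x => cabs (f x%:C) ^+ 2 + C ^+ 2 * (1 + x ^+ 2)^-1) measurableT.
- by move=> n; apply: cmeasM => //; apply: mt; exact: ltW.
- by apply: cmeasM => //; exact: mt.
- exact: i2.
- move=> n x _; rewrite /F cabsM (le_trans _ (lerD (lexx _) (decay_sqr C0 (dec n x))))//.
  have := sqr_ge0 (cabs (f x%:C) - cabs (trig_transform (exp_profile (harmonic n) h) s x)).
  have := cabs_ge0 (f x%:C); have := cabs_ge0 (trig_transform (exp_profile (harmonic n) h) s x).
  move: (cabs (f x%:C)) (cabs (trig_transform _ _ _)) => a b b0 a0; rewrite sqrrB => hh.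
  by have := mulr_ge0 a0 b0; rewrite mulr2n in hh; lra.
- move=> x _; apply: (@cvg_harmonic_bound _ _ (cabs (f x%:C) * (J * h))) => n.
  rewrite /F -mulrBr cabsM -mulrA; apply: ler_wpM2l; first exact: cabs_ge0.
  have ti r (r0 : 0 <= r) := @trig_integrable _ _ 1 h (mp r) (fun g => pb r g r0) (ps r) s x.
  have t1 := ti _ (ltW (hn0 n)); have t2 := ti _ (lexx 0).
  rewrite /trig_transform -cintegralB//.
  have -> : J * h * harmonic n = Rintegral mu setT (fun g : R => h * harmonic n * (1 * \1_(`[- h, h]%classic : set R) g)).
    by rewrite [RHS]RintegralZl// -mulrA [LHS]mulrC.
  apply: cabs_cintegral => //.
  + exact: cmeasB (cintegrable_meas t1) (cintegrable_meas t2).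
  + exact: integrable_scale.
  + move=> g _; rewrite -mulrBl cabsM cabs_cexp_i mulr1 /exp_profile -rmorphB -mulrBl cabs_real.
    rewrite mul1r indicE mul0r oppr0 expR0 normrM.
    have [gi|gi] := boolP (g \in _); last by rewrite normr0 !mulr0.
    rewrite normr1 !mulr1.
    move: gi; rewrite inE /= in_itv /= -ler_norml => gh.
    have u0 : 0 <= harmonic n * `|g| by rewrite mulr_ge0// ltW.
    rewrite distrC ger0_norm; last by rewrite subr_ge0 -expR0 ler_expR oppr_le0.
    have k1 := ler_wpM2l (ltW (hn0 n)) gh.
    have k2 := expR_ge1Dx (- (harmonic n * `|g|)).
    by rewrite [leRHS]mulrC (le_trans _ k1)// lerBlDr -lerBlDl.
have P := poisson_approx ef Lf s0.
have E n : cintegral mu setT (F n) =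
    cintegral mu setT (fun x : R => f x%:C * (poisson s (harmonic n) x)%:C).
  exact: trig_exp_profile_poisson ef gf tau0 Lf s0 (hn0 n) h0 sh.
apply: (cvg_cabs_unique lim); move: P; rewrite (_ : (fun n => cabs (_ - _)) =
  (fun n => cabs (cintegral mu setT (F n) - f 0 * (2 * pi / s)%:C)))//.
by apply/funext => n; rewrite E.
Qed.

End PoissonKernel.

(** * The measure and its Fourier transform *)

Section Density.
Context {R : realType}.
Notation mu := (@lebesgue_measure R).
Notation T := (measurableTypeR R).
Variables (nu : {measure set T -> \bar R}) (D : set T) (c : R) (w : R -> R).
Hypotheses (mD : measurable D) (c0 : 0 <= c) (w0 : forall x, 0 <= w x).
Hypothesis mw : measurable_fun setT (w : T -> R).
Hypothesis nuE : forall X : set T, measurable X ->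
  nu X = (c%:E * \d_(0%R : T) X + \int[mu]_(a in X `&` D) (w a)%:E)%E.
Implicit Types (u v : T -> R).

Let density_indic (E : set T) : measurable E ->
  (\int[nu]_x (\1_E x)%:E = (c * \1_E 0)%:E + \int[mu]_(x in D) (w x * \1_E x)%:E)%E.
Proof.
move=> mE; rewrite integral_indic// setIT nuE// EFinM diracE indicE; congr (_ + _)%E.
rewrite [LHS]integral_mkcond [RHS]integral_mkcond; apply: eq_integral => x _.
rewrite !patchE in_setI indicE; case: (x \in E); case: (x \in D) => //=; by rewrite ?mulr1 ?mulr0.
Qed.

Import HBNNSimple.

Let density_nnsfun (f : {nnsfun T >-> R}) :
  (\int[nu]_x (f x)%:E = (c * f 0)%:E + \int[mu]_(x in D) (w x * f x)%:E)%E.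
Proof.
under [LHS]eq_integral do rewrite fimfunE -fsumEFin//.
rewrite [LHS]ge0_integral_fsum//; last 2 first.
  - by move=> r; exact/measurable_EFinP/measurableT_comp.
  - by move=> n x _; rewrite EFinM nnfun_muleindic_ge0.
rewrite (_ : (c * f 0)%:E = \sum_(r \in range f) (r * (c * \1_(f @^-1` [set r]) 0))%:E)%E; last first.
  rewrite fsumEFin// fimfunE; congr EFin.
  rewrite mulr_fsumr//; apply: eq_fsbigr => r _; ring.
under [X in (_ + X)%E]eq_integral.
  move=> x xD; rewrite EFinM fimfunE -fsumEFin// ge0_mule_fsumr; last first.
    by move=> r; rewrite EFinM nnfun_muleindic_ge0.
  over.
rewrite [X in (_ + X)%E]ge0_integral_fsum//; last 2 first.
  - move=> r; apply/measurable_funTS; apply/measurable_EFinP; apply: measurable_funM => //.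
    exact: measurableT_comp.
  - by move=> r x _; apply: mule_ge0; rewrite ?lee_fin// -lee_fin EFinM nnfun_muleindic_ge0.
rewrite -fsbig_split//=; apply: eq_fsbigr => r; rewrite inE => -[y _ yr].
have r0 : 0 <= r by rewrite -yr.
have mE : measurable (f @^-1` [set r]) by rewrite -[X in measurable X]setTI; exact: measurable_funP.
under [LHS]eq_integral do rewrite EFinM.
rewrite ge0_integralZl//; last first.
  exact/measurable_EFinP/measurable_indic.
rewrite density_indic// ge0_muleDr; last 2 first.
  - by rewrite lee_fin mulr_ge0// indicE ler0n.
  - by apply: integral_ge0 => x _; rewrite lee_fin mulr_ge0// indicE ler0n.
congr (_ + _)%E; rewrite -ge0_integralZl//.
- by apply: eq_integral => x _; rewrite !EFinM muleCA.
- apply/measurable_funTS/measurable_EFinP; apply: measurable_funM => //; exact: measurable_indic.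
- by move=> x _; rewrite lee_fin mulr_ge0// indicE ler0n.
Qed.

(** The formula for sets passes to simple functions by linearity and to nonnegative functions by
    monotone convergence; the point mass contributes the value at 0. *)
Lemma ge0_integral_density v : measurable_fun setT v -> (forall x, 0 <= v x) ->
  (\int[nu]_x (v x)%:E = (c * v 0)%:E + \int[mu]_(x in D) (w x * v x)%:E)%E.
Proof.
move=> mv v0; have mf : measurable_fun setT (EFin \o v) by exact/measurable_EFinP.
pose f_ := nnsfun_approx measurableT mf.
have fv x : (EFin \o f_ ^~ x @ \oo --> (v x)%:E)%E.
  by apply: cvg_nnsfun_approx => // y _; rewrite lee_fin.
have nd x : {homo (fun n => f_ n x) : m n / (m <= n)%N >-> m <= n}.
  by move=> m n mn; exact/lefP/nd_nnsfun_approx.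
have L : (\int[nu]_x (f_ n x)%:E @[n --> \oo] --> \int[nu]_x (v x)%:E)%E.
  rewrite [X in _ --> X](_ : _ = \int[nu]_x limn (fun n => (f_ n x)%:E))%E; last first.
    by apply: eq_integral => x _; apply/esym/cvg_lim => //; exact: fv.
  apply: cvg_monotone_convergence => //.
  - by move=> n; exact/measurable_EFinP.
  - by move=> n x _; rewrite lee_fin.
  - by move=> x _ m n mn; rewrite lee_fin nd.
have L' : ((c * f_ n 0)%:E + \int[mu]_(x in D) (w x * f_ n x)%:E @[n --> \oo] -->
           (c * v 0)%:E + \int[mu]_(x in D) (w x * v x)%:E)%E.
  apply: cvgeD => //.
  - by under eq_fun do rewrite EFinM; rewrite EFinM; apply: cvgeZl => //; exact: fv.
  - rewrite [X in _ --> X](_ : _ = \int[mu]_(x in D) limn (fun n => (w x * f_ n x)%:E))%E; last first.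
      apply: eq_integral => x _; apply/esym/cvg_lim => //.
      by under eq_fun do rewrite EFinM; rewrite EFinM; apply: cvgeZl => //; exact: fv.
    apply: cvg_monotone_convergence => //.
    + move=> n; apply/measurable_funTS/measurable_EFinP; exact: measurable_funM.
    + by move=> n x _; rewrite lee_fin mulr_ge0.
    + by move=> x _ m n mn; rewrite lee_fin ler_wpM2l// nd.
have E : (fun n => \int[nu]_x (f_ n x)%:E)%E = (fun n => (c * f_ n 0)%:E + \int[mu]_(x in D) (w x * f_ n x)%:E)%E.
  by apply/funext => n; exact: density_nnsfun.
by rewrite E in L; exact: cvg_unique L L'.
Qed.

Hypothesis iw : mu.-integrable D (EFin \o w).

Let iwu u (M : R) : measurable_fun setT u -> (forall x, `|u x| <= M) ->
  mu.-integrable D (EFin \o (fun x => w x * u x)).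
Proof.
move=> mu_ uM; apply: (@integrable_dom _ _ _ mu D (fun x => w x * u x) (fun x => M * w x)) => //.
- by apply: measurable_funTS; exact: measurable_funM.
- exact: integrable_scale.
- by move=> x _; rewrite normrM (ger0_norm (w0 x)) mulrC; apply: ler_wpM2r.
Qed.

Lemma Rintegral_density_ge0 v (M : R) : measurable_fun setT v -> (forall x, 0 <= v x <= M) ->
  nu.-integrable setT (EFin \o v) /\
  Rintegral nu setT v = c * v 0 + Rintegral mu D (fun x => w x * v x).
Proof.
move=> mv vM; have v0 x : 0 <= v x by have /andP[] := vM x.
have iwv : mu.-integrable D (EFin \o (fun x => w x * v x)).
  by apply: (iwu (M := M) mv) => x; rewrite ger0_norm//; have /andP[] := vM x.
have E := ge0_integral_density mv v0.
split; last by rewrite /Rintegral E fineD// integrable_fin_num.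
apply/integrableP; split; first exact/measurable_EFinP.
under eq_integral do rewrite gee0_abs ?lee_fin//.
by rewrite E; apply: lte_add_pinfty; rewrite ?ltry// ltey_eq (integrable_fin_num _ iwv).
Qed.

(** Adding the constant [M] makes the function nonnegative, and the contribution of the constant is
    then subtracted on both sides. *)
Lemma Rintegral_density u (M : R) : measurable_fun setT u -> (forall x, `|u x| <= M) ->
  nu.-integrable setT (EFin \o u) /\
  Rintegral nu setT u = c * u 0 + Rintegral mu D (fun x => w x * u x).
Proof.
move=> mu_ uM.
have [|i1 E1] := @Rintegral_density_ge0 (fun x => u x + M) (2 * M) (measurable_funD mu_ (measurable_cst M)).
  by move=> x; have := uM x; rewrite ler_norml; lra.
have [|i2 E2] := @Rintegral_density_ge0 (fun=> M) M (measurable_cst M).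
  by move=> x; have := le_trans (normr_ge0 _) (uM x); rewrite lexx => ->.
have uE : u = (fun x => (u x + M) - M) by apply/funext => x; rewrite addrK.
split.
  by rewrite {}[in X in integrable _ _ X]uE; exact: (integrableB measurableT i1 i2).
have j1 : mu.-integrable D (EFin \o (fun x => w x * (u x + M))).
  apply: (@iwu _ (2 * M) (measurable_funD mu_ (measurable_cst M))) => x.
  by have := uM x; rewrite /= !ler_norml => /andP[h1 h2]; apply/andP; split; lra.
have j2 : mu.-integrable D (EFin \o (fun x => w x * M)).
  apply: (@iwu _ M (measurable_cst M)) => x.
  by have := le_trans (normr_ge0 _) (uM x) => ?; rewrite ger0_norm.
rewrite [in LHS]uE RintegralB// E1 E2.
rewrite (_ : Rintegral mu D (fun x => w x * u x) =
  Rintegral mu D (fun x => w x * (u x + M)) - Rintegral mu D (fun x => w x * M)); last first.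
  by rewrite -RintegralB//; apply: eq_Rintegral => x _; ring.
ring.
Qed.

Lemma cintegral_density (g : R -> R[i]) (M : R) : cmeas setT (g : T -> R[i]) -> (forall x, cabs (g x) <= M) ->
  cintegrable nu setT g /\
  cintegral nu setT g = c%:C * g 0 + cintegral mu D (fun x => (w x)%:C * g x).
Proof.
move=> [mr mi] gM.
have [ir Er] := Rintegral_density mr (fun x => le_trans (Re_le_cabs _) (gM x)).
have [ii Ei] := Rintegral_density mi (fun x => le_trans (Im_le_cabs _) (gM x)).
split; first by split.
rewrite /cintegral Er Ei; apply: complex_ext.
  rewrite Re_add Re_mul /= mul0r subr0; congr (_ + _); apply: eq_Rintegral => x _.
  by rewrite Re_mul /= mul0r subr0.
rewrite Im_add Im_mul /= mul0r addr0; congr (_ + _); apply: eq_Rintegral => x _.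
by rewrite Im_mul /= mul0r addr0.
Qed.

End Density.

(** * A trigonometric inequality with the constant 3/5 *)

Section CosineBound.
Context {R : realType}.
Implicit Types s : R.

(** The square of |exp(i s) - 1| <= |s|, in which the left side becomes 2 - 2 cos s. *)
Lemma cos_ge1B s : 1 - s ^+ 2 / 2 <= cos s.
Proof.
have k := cexp_i_lip s (0 : R); rewrite subr0 in k.
have : cabs (cexp ('i * s%:C) - cexp ('i * (0 : R)%:C)) ^+ 2 <= `|s| ^+ 2.
  by rewrite lerXn2r// nnegrE ?cabs_ge0.
rewrite !cexp_i cos0 sin0 cabs_sqr /= subr0 real_normK ?num_real//; have := cos2Dsin2 s; lra.
Qed.

(** Three doublings of the angle, starting from cos (1/2) >= 7/8; the last one squares a lower bound
    and therefore needs cos 2 < 0. The value is compared with cos c = - 3/5 at a critical point of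
    [oscillation]. *)
Lemma cos4_lt : cos (4 : R) < - (3 / 5).
Proof.
have dbl x : cos (2 * x) = 2 * cos x ^+ 2 - 1 :> R.
  by rewrite mulr_natl cos_mulr2n [in RHS]mulr_natl.
have q : 7 / 8 <= cos (2^-1 : R) by have := cos_ge1B 2^-1; lra.
have c1 : 17 / 32 <= cos (1 : R).
  have -> : (1 : R) = 2 * 2^-1 by rewrite divff.
  by rewrite dbl; nra.
have c2l : -1 + 2 * (17 / 32) ^+ 2 <= cos (2 : R).
  have -> : (2 : R) = 2 * 1 by rewrite mulr1.
  by rewrite dbl; nra.
have c2u := cos2_lt0 R.
have -> : (4 : R) = 2 * 2 by rewrite -natrM.
by rewrite dbl; nra.
Qed.

(** The primitive of s (3/5 + cos s) that vanishes at 0. *)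
Definition oscillation s := 3 / 10 * s ^+ 2 + s * sin s + cos s - 1.

Lemma derive_oscillation s : is_derive s 1 oscillation (s * (3 / 5 + cos s)).
Proof.
rewrite /oscillation; apply: is_derive_eq.
by rewrite /GRing.scale /=; field.
Qed.

(* At an interior minimum [cos s = - 3 / 5] and [sin s] is [4 / 5] or [- 4 / 5];
   the latter requires [4 <= s], where the quadratic [3 s^2 - 8 s - 16] is nonnegative. *)
Lemma oscillation_ge0 s : 0 <= oscillation s.
Proof.
wlog s0 : s / 0 <= s.
  move=> H; have [/H//|/ltW s0] := leP 0 s.
  have := H (- s); rewrite oppr_ge0 => /(_ s0).
  by rewrite /oscillation sqrrN sinN cosN mulrNN.
(* By Cauchy-Schwarz |x sin x + cos x| is at most the square root of 1 + x^2, and 3/10 x^2 - 1 is at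
   least that for x >= 5. *)
have far x : 5 <= x -> 0 <= oscillation x.
  move=> x5; rewrite /oscillation.
  have X : (x * sin x + cos x) ^+ 2 <= 1 + x ^+ 2.
    have := cos2Dsin2 x; have := sqr_ge0 (x * cos x - sin x); nra.
  have Y : 1 + x ^+ 2 <= (3 / 10 * x ^+ 2 - 1) ^+ 2.
    have : 25 <= x ^+ 2 by nra.
    move: (x ^+ 2) => y; nra.
  have Z : 0 <= 3 / 10 * x ^+ 2 - 1 by nra.
  move: (x * sin x) X => u X; nra.
have [//|s5] := leP 5 s; first exact: far.
have cO : continuous oscillation.
  by move=> x; apply: differentiable_continuous; apply/derivable1_diffP; case: (derive_oscillation x).
have [] := @EVT_min R oscillation 0 5 (ler0n _ _).
  exact: continuous_subspaceT.
move=> c; rewrite in_itv /= => /andP[c0 c5] cmin.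
apply: (@le_trans _ _ (oscillation c)); last by apply: cmin; rewrite in_itv /= s0 ltW.
move: c0; rewrite le_eqVlt => /predU1P[<-|c0].
  by rewrite /oscillation expr0n /= mulr0 mul0r !add0r cos0 subrr.
move: c5; rewrite le_eqVlt => /predU1P[->|c5]; first exact: far.
have : is_derive c 1 oscillation 0.
  apply: (@derive1_at_min _ oscillation 0 5) => //.
  - by rewrite in_itv /= c0.
  - by move=> t t05; apply: cmin; apply: subset_itvW t05.
move=> [_]; have [_ ->] := derive_oscillation c.
move=> /eqP; rewrite mulf_eq0 gt_eqF//= => /eqP cc.
have cE : cos c = - (3 / 5) by lra.
have : (sin c - 4 / 5) * (sin c + 4 / 5) = 0 by have := cos2Dsin2 c; rewrite cE => k; lra.
move=> /eqP; rewrite mulf_eq0 => /orP[/eqP|/eqP] sc.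
  have := cos_ge1B c; rewrite cE => k.
  have sE : sin c = 4 / 5 by lra.
  by rewrite /oscillation cE sE; nra.
have sE : sin c = - (4 / 5) by lra.
have [c4|c4] := leP 4 c; first by rewrite /oscillation cE sE; nra.
have p1 := pihalf_ge1 R; have p2 := pihalf_lt2 R.
have cpi : pi < c.
  by rewrite ltNge; apply/negP => h; have := @sin_ge0_pi _ c; rewrite sE ltW//= h => /(_ isT); lra.
(* For c between pi and 4, both 2 pi - c and 2 pi - 4 lie in [0, pi], where cos decreases; so cos c
   < cos 4 < - 3/5, against cos c = - 3/5. *)
have : cos (2 * pi - c) < cos (2 * pi - 4) :> R.
  by rewrite ltr_cos ?in_itv /=; lra.
have per x : cos (2 * pi - x) = cos x :> R.
  by rewrite mulr_natl addrC cosD2pi cosN.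
by rewrite !per cE; have := cos4_lt; lra.
Qed.

End CosineBound.

Section ChangeOfVariables.
Context {R : realType}.
Notation mu := (@lebesgue_measure R).
Implicit Types (a b t : R) (u : R -> R) (v : R -> R[i]).

Lemma Rintegral_shift u a b t : continuous u -> a <= b ->
  Rintegral mu `[a, b] (fun x => u (x + t)) = Rintegral mu `[a + t, b + t] u.
Proof.
move=> cu; rewrite le_eqVlt => /predU1P[->|ab]; first by rewrite !set_itv1 !Rintegral_set1.
have Dt : derive1 (fun x : R => x + t) = (fun=> 1).
  by apply/funext => z; rewrite derive1E derive_val addr0.
rewrite /Rintegral; congr fine; apply/esym.
rewrite (@integration_by_substitution_increasing R (fun x => x + t) u a b (ltW ab)); rewrite ?Dt.
- by apply: eq_integral => x _; congr EFin; exact: mulr1.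
- by move=> x y _ _ xy; rewrite ltrD2r.
- by move=> x _; exact: cvg_cst.
- by apply/cvg_ex; exists 1; exact: cvg_cst.
- by apply/cvg_ex; exists 1; exact: cvg_cst.
- have ct : continuous (fun x : R => x + t) by move=> x; apply: cvgD; [exact: cvg_id|exact: cvg_cst].
  split; [by move=> x _; exact: ex_derive| |].
    by apply: cvg_at_right_filter; exact: ct.
  by apply: cvg_at_left_filter; exact: ct.
- exact: continuous_subspaceT.
Qed.

Lemma Rintegral_opp u b : continuous u -> 0 <= b ->
  Rintegral mu `[- b, 0] u = Rintegral mu `[0, b] (fun x => u (- x)).
Proof.
move=> cu b0; rewrite /Rintegral; congr fine.
have := @integration_by_substitution_oppr R u 0 b b0; rewrite oppr0; apply.
exact: continuous_subspaceT.
Qed.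

Lemma cintegral_shift v a b t : ccont v -> a <= b ->
  cintegral mu `[a, b] (fun x => v (x + t)) = cintegral mu `[a + t, b + t] v.
Proof. by move=> [vr vi] ab; congr Complex; [exact: Rintegral_shift vr ab|exact: Rintegral_shift vi ab]. Qed.

Lemma cintegral_sym v b : ccont v -> 0 <= b ->
  cintegral mu `[- b, b] v = cintegral mu `[0, b] (fun x => v x + v (- x)).
Proof.
move=> cv b0; have [vr vi] := cv.
have cvN : ccont (fun x => v (- x)) by apply: ccont_comp => // x; exact: opp_continuous.
rewrite (@cintegral_split _ _ _ 0)// ?oppr_le0//.
rewrite (@cintegralD _ _ _ mu _ v (fun x => v (- x)))//; [|exact: ccont_integrable..].
by rewrite addrC; congr (_ + _); rewrite /cintegral !Rintegral_opp.
Qed.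

End ChangeOfVariables.

(** * Boundedness and positivity of the transform of the measure *)

Section NuHat.
Context {R : realType}.
Notation mu := (@lebesgue_measure R).
Notation T := (measurableTypeR R).
Implicit Types (x t a : R).

Definition density (c2 c3 : R) a : R := c2 * `|a| * expR (- (c3 * `|a|)).

Lemma continuous_density (c2 c3 : R) : continuous (density c2 c3).
Proof.
move=> x; apply: cvgM.
  by apply: cvgM; [exact: cvg_cst|exact: norm_continuous].
exact: continuous_expRN_norm.
Qed.

Lemma density_ge0 (c2 c3 : R) a : 0 <= c2 -> 0 <= density c2 c3 a.
Proof. by move=> c0; rewrite /density !mulr_ge0// expR_ge0. Qed.

Let ci (u : R -> R) (b : R) : continuous u -> mu.-integrable `[0, b] (EFin \o u).
Proof.
by move=> cu; apply: continuous_compact_integrable; [exact: segment_compact|exact: continuous_subspaceT].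
Qed.

(* Integration by parts against the primitive [oscillation (t * a) / t ^+ 2]. *)
Lemma Rintegral_expR_cos_ge0 (d c t : R) : 0 <= d -> 0 <= c ->
  0 <= Rintegral mu `[0, d] (fun a => expR (- (c * a)) * (a * (3 / 5 + cos (t * a)))).
Proof.
move=> d0 c0.
have cE : continuous (fun a : R => expR (- (c * a))).
  move=> x; apply: (@continuous_comp _ _ _ (fun x => - (c * x)) expR); last exact: continuous_expR.
  by apply: cvgN; apply: cvgM; [exact: cvg_cst|exact: cvg_id].
have ccos : continuous (fun a : R => cos (t * a)).
  move=> x; apply: (@continuous_comp _ _ _ (fun x => t * x) cos); last exact: continuous_cos.
  by apply: cvgM; [exact: cvg_cst|exact: cvg_id].
have cu : continuous (fun a : R => expR (- (c * a)) * (a * (3 / 5 + cos (t * a)))).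
  move=> x; apply: cvgM; first exact: cE.
  by apply: cvgM; [exact: cvg_id|apply: cvgD; [exact: cvg_cst|exact: ccos]].
have [->|t0] := eqVneq t 0.
  apply: Rintegral_ge0 => a; rewrite /= in_itv /= => /andP[a0 _].
  by rewrite mul0r cos0 mulr_ge0 ?expR_ge0// mulr_ge0// addr_ge0.
pose N a := oscillation (t * a) / t ^+ 2.
have N0 a : 0 <= N a by rewrite divr_ge0 ?oscillation_ge0 ?sqr_ge0.
have dN a : is_derive a 1 N (a * (3 / 5 + cos (t * a))).
  have dt := is_derive_mul (is_derive_cst t a 1) (is_derive_id a 1).
  rewrite mul0r add0r mulr1 in dt.
  have := is_derive1_comp (derive_oscillation (t * a)) dt => dO.
  apply: is_derive_eq (is_derive_mul dO (is_derive_cst (t ^- 2) a 1)) _.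
  by rewrite /cst /= mulr0 addr0; field.
have cN : continuous N.
  by move=> x; apply: differentiable_continuous; apply/derivable1_diffP; case: (dN x).
have dF a : is_derive a 1 (fun a => expR (- (c * a)) * N a)
    (expR (- (c * a)) * (a * (3 / 5 + cos (t * a))) - c * (expR (- (c * a)) * N a)).
  have dE : is_derive a 1 (fun a => expR (- (c * a))) (- c * expR (- (c * a))).
    apply: is_derive_eq; rewrite /GRing.scale /=; ring.
  by apply: is_derive_eq (is_derive_mul dE (dN a)) _; ring.
have cG : continuous (fun a => c * (expR (- (c * a)) * N a)).
  by move=> x; apply: cvgM; [exact: cvg_cst|apply: cvgM; [exact: cE|exact: cN]].
have cF : continuous (fun a => expR (- (c * a)) * (a * (3 / 5 + cos (t * a))) - c * (expR (- (c * a)) * N a)).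
  by move=> x; apply: cvgB; [exact: cu|exact: cG].
have := Rintegral_FTC d0 cF dF.
rewrite RintegralB//; [|exact: ci..].
have : 0 <= Rintegral mu `[0, d] (fun a => c * (expR (- (c * a)) * N a)).
  by apply: Rintegral_ge0 => a _; exact: mulr_ge0 c0 (mulr_ge0 (expR_ge0 _) (N0 a)).
have : 0 <= expR (- (c * d)) * N d by exact: mulr_ge0 (expR_ge0 _) (N0 d).
have -> : N 0 = 0 by rewrite /N mulr0 /oscillation expr0n /= mulr0 mul0r !add0r cos0 subrr mul0r.
rewrite mulr0; lra.
Qed.

(** On [0, d] one has exp(- c a) <= 1 / (1 + c a) <= 1 - k a, the last being the chord of a convex
    function. Compared with d^2 / 2 this gains a cubic term, which keeps the spectral density
    positive even when (c2 / c1) Delta^2 = 5/3. *)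
Lemma Rintegral_idM_expR_le (d c : R) : 0 < d -> 0 < c ->
  Rintegral mu `[0, d] (fun a => expR (- (c * a)) * a) <= d ^+ 2 / 2 - c / (1 + c * d) * d ^+ 3 / 3.
Proof.
move=> d0 c0; set k := c / (1 + c * d).
have cd0 : 0 < 1 + c * d by rewrite ltr_wpDr// mulr_ge0// ltW.
have dP a : is_derive a 1 (fun a => a ^+ 2 / 2 - k * a ^+ 3 / 3) (a - k * a ^+ 2).
  by apply: is_derive_eq; rewrite /GRing.scale /=; field.
have cP : continuous (fun a => a - k * a ^+ 2).
  move=> x; apply: cvgB; first exact: cvg_id.
  by apply: cvgM; [exact: cvg_cst|exact: exprn_continuous].
have := Rintegral_FTC (ltW d0) cP dP.
rewrite !expr0n /= !mulr0 !mul0r !subr0 => <-.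
apply: le_Rintegral => //; [|exact: ci|].
  apply: ci => x; apply: cvgM; last exact: cvg_id.
  apply: (@continuous_comp _ _ _ (fun x => - (c * x)) expR); last exact: continuous_expR.
  by apply: cvgN; apply: cvgM; [exact: cvg_cst|exact: cvg_id].
move=> a; rewrite /= in_itv /= => /andP[a0 ad].
rewrite (_ : a - k * a ^+ 2 = (1 - k * a) * a); last by ring.
apply: ler_wpM2r => //.
have ca0 : 0 <= c * a by rewrite mulr_ge0// ltW.
have ca1 : 0 < 1 + c * a by rewrite ltr_wpDr.
apply: (@le_trans _ _ (1 + c * a)^-1).
  by rewrite expRN lef_pV2 ?posrE ?expR_gt0// expR_ge1Dx.
rewrite -subr_ge0 (_ : _ - _ = (c * a) * (c * (d - a)) / ((1 + c * d) * (1 + c * a))).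
  have da : 0 <= d - a by rewrite subr_ge0.
  exact: divr_ge0 (mulr_ge0 ca0 (mulr_ge0 (ltW c0) da)) (mulr_ge0 (ltW cd0) (ltW ca1)).
by rewrite /k; field; rewrite !gt_eqF.
Qed.


Lemma trig_bounded (psi : R -> R[i]) (B H s x : R) : cmeas setT (psi : T -> R[i]) ->
  (forall g, cabs (psi g) <= B) -> (forall g, H < `|g| -> psi g = 0) ->
  cabs (trig_transform psi s x) <= Rintegral mu setT (fun g => B * \1_(`[- H, H]%classic : set R) g).
Proof.
move=> mpsi psiB psiH; have B0 : 0 <= B := le_trans (cabs_ge0 _) (psiB 0).
apply: cabs_cintegral => //.
- exact: cintegrable_meas (trig_integrable mpsi psiB psiH s x).
- exact: integrable_indic_itv.
- move=> g _; rewrite cabsM cabs_cexp_i mulr1 indicE.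
  have [h|h] := leP `|g| H; last by rewrite psiH// cabs0 mulr_ge0.
  by rewrite mem_set ?mulr1// /= in_itv /= -ler_norml.
Qed.

Section Measure.
Variables (Delta c1 c2 c3 : R) (nu : {measure set T -> \bar R}).
Hypotheses (D0 : 0 < Delta) (c10 : 0 < c1) (c20 : 0 < c2) (c30 : 0 < c3).
Hypothesis nuP : is_nu Delta c1 c2 c3 nu.
Notation w := (density c2 c3).
Notation D := (`[- Delta, Delta]%classic : set T).

Definition tail_density (a : R) : R[i] := (w a * \1_D a)%:C.

Lemma cmeas_tail_density : cmeas setT (tail_density : T -> R[i]).
Proof.
apply: cmeas_real; apply: measurable_funM; last exact: measurable_indic.
by apply: continuous_measurable_fun; exact: continuous_density.
Qed.

Lemma tail_density_le a : cabs (tail_density a) <= c2 * Delta.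
Proof.
have c2D : 0 <= c2 * Delta by rewrite mulr_ge0 ?ltW.
rewrite /tail_density cabs_real indicE; have [|aD] := boolP (a \in _); last by rewrite mulr0 normr0.
rewrite inE /= in_itv /= -ler_norml mulr1 => aD.
rewrite (ger0_norm (density_ge0 c3 a (ltW c20))) /density -[leRHS]mulr1.
apply: ler_pM; rewrite ?expR_ge0 ?mulr_ge0 ?(ltW c20)//.
  by rewrite ler_wpM2l// ltW.
by rewrite -expR0 ler_expR oppr_le0 mulr_ge0// ltW.
Qed.

Lemma tail_density_supp a : Delta < `|a| -> tail_density a = 0.
Proof.
move=> h; rewrite /tail_density indicE memNset ?mulr0//= in_itv /= -ler_norml => /(lt_le_trans h).
by rewrite ltxx.
Qed.

Lemma nu_hat_trig x : nu_hat nu x = c1%:C + trig_transform tail_density (- (2 * pi)) x.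
Proof.
have mw : measurable_fun setT (w : T -> R) by apply: continuous_measurable_fun; exact: continuous_density.
have iw : mu.-integrable D (EFin \o w).
  by apply: continuous_compact_integrable; [exact: segment_compact|apply: continuous_subspaceT; exact: continuous_density].
pose g (a : R) : R[i] := cexp (- (2 * 'i * (pi * x * a)%:C)).
have gE a : g a = cexp ('i * (- (2 * pi) * (x * a))%:C).
  by rewrite /g; congr cexp; rewrite !rmorphM rmorphN rmorphM /=; ring.
have mg : cmeas setT (g : T -> R[i]).
  apply: ccont_cmeas => //; rewrite (_ : g = fun a => cexp (- (2 * 'i * (pi * x)%:C) * a%:C)).
    by apply: ccont_cexp; exact: ccont_lin.
  by apply/funext => a; rewrite /g; congr cexp; rewrite !rmorphM /=; ring.
have g1 a : cabs (g a) <= 1 by rewrite gE cabs_cexp_i.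
change (nu_hat nu x) with (cintegral nu setT g).
have [_ ->] := cintegral_density (measurable_itv _) (ltW c10) (fun a => density_ge0 c3 a (ltW c20)) mw nuP iw mg g1.
rewrite {1}/g mulr0 mulr0 oppr0 cexp0 mulr1; congr (_ + _).
rewrite cintegral_mkcond; apply: eq_cintegral => a _.
by rewrite -gE /tail_density [X in _ = X * _]rmorphM; move: (g a) => z; ring.
Qed.

Lemma ccont_nu_hat : ccont (nu_hat nu).
Proof.
have -> : nu_hat nu = fun x => c1%:C + trig_transform tail_density (- (2 * pi)) x.
  by apply/funext => x; exact: nu_hat_trig.
apply: ccontD; first exact: ccont_cst.
exact: ccont_trig cmeas_tail_density tail_density_le tail_density_supp _.
Qed.

Lemma nu_hat_bounded : exists M : R, forall x, cabs (nu_hat nu x) <= M.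
Proof.
eexists => x; rewrite nu_hat_trig; apply: le_trans (cabsD _ _) _; apply: lerD; first exact: lexx.
exact: trig_bounded cmeas_tail_density tail_density_le tail_density_supp.
Qed.

Definition spectral_density x : R :=
  c1 + 2 * Rintegral mu `[0, Delta] (fun a => w a * cos (2 * pi * x * a)).

Lemma nu_hat_real x : nu_hat nu x = (spectral_density x)%:C.
Proof.
rewrite nu_hat_trig /spectral_density rmorphD /=; congr (_ + _).
rewrite -RintegralZl//; last first.
  apply: ci => y; apply: cvgM; first exact: continuous_density.
  apply: (@continuous_comp _ _ _ (fun y => 2 * pi * x * y) cos); last exact: continuous_cos.
  by apply: cvgM; [exact: cvg_cst|exact: cvg_id].
rewrite -cintegral_real.
have cv : ccont (fun a : R => (w a)%:C * cexp ('i * (- (2 * pi) * (x * a))%:C)).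
  apply: ccontM; first by apply: ccont_real; exact: continuous_density.
  by have := ccont_cexp_i (- (2 * pi) * x); under eq_fun do rewrite -mulrA.
transitivity (cintegral mu D (fun a : R => (w a)%:C * cexp ('i * (- (2 * pi) * (x * a))%:C))).
  rewrite [RHS]cintegral_mkcond; apply: eq_cintegral => a _.
  by rewrite /tail_density rmorphM; ring.
rewrite (cintegral_sym cv (ltW D0)); apply: eq_cintegral => a _.
rewrite !cexp_i /density normrN; apply: complex_ext.
  rewrite !(Re_add, Re_mul) /= (_ : - (2 * pi) * (x * - a) = 2 * pi * x * a); last by ring.
  rewrite (_ : - (2 * pi) * (x * a) = - (2 * pi * x * a)); last by ring.
  by rewrite cosN; ring.
rewrite !(Im_add, Im_mul) /= (_ : - (2 * pi) * (x * - a) = 2 * pi * x * a); last by ring.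
rewrite (_ : - (2 * pi) * (x * a) = - (2 * pi * x * a)); last by ring.
by rewrite sinN; ring.
Qed.

Hypothesis small : c2 / c1 * Delta ^+ 2 <= 5 / 3.

(** Write cos = (3/5 + cos) - 3/5. The first part has a nonnegative integral; the second costs at
    most 6/5 c2 (Delta^2 / 2 - k Delta^3 / 3). Since [small] says 3/5 c2 Delta^2 <= c1, the cubic
    term survives as a lower bound. *)
Lemma spectral_density_gt0 : exists2 d : R, 0 < d & forall x, d <= spectral_density x.
Proof.
set k := c3 / (1 + c3 * Delta).
have k0 : 0 < k by rewrite divr_gt0// ltr_wpDr// mulr_ge0// ltW.
exists (2 / 5 * c2 * (k * Delta ^+ 3)).
  by apply: mulr_gt0 (mulr_gt0 _ c20) (mulr_gt0 k0 (exprn_gt0 _ D0)).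
move=> x; rewrite /spectral_density.
pose E (a : R) := expR (- (c3 * a)).
pose u (a : R) := E a * (a * (3 / 5 + cos (2 * pi * x * a))).
pose v (a : R) := E a * a.
have cE : continuous E.
  move=> y; apply: (@continuous_comp _ _ _ (fun x => - (c3 * x)) expR); last exact: continuous_expR.
  by apply: cvgN; apply: cvgM; [exact: cvg_cst|exact: cvg_id].
have cv : continuous v by move=> y; apply: cvgM; [exact: cE|exact: cvg_id].
have cu : continuous u.
  move=> y; apply: cvgM; first exact: cE.
  apply: cvgM; [exact: cvg_id|apply: cvgD; first exact: cvg_cst].
  apply: (@continuous_comp _ _ _ (fun y => 2 * pi * x * y) cos); last exact: continuous_cos.
  by apply: cvgM; [exact: cvg_cst|exact: cvg_id].
have -> : Rintegral mu `[0, Delta] (fun a => w a * cos (2 * pi * x * a)) =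
    c2 * Rintegral mu `[0, Delta] u - 3 / 5 * c2 * Rintegral mu `[0, Delta] v.
  rewrite -!RintegralZl//; [|exact: ci..].
  rewrite -RintegralB//.
  - apply: eq_Rintegral => a; rewrite inE /= in_itv /= => /andP[a0 _].
    by rewrite /density ger0_norm// /u /v /E; ring.
  - by apply: ci => y; apply: cvgM; [exact: cvg_cst|exact: cu].
  - by apply: ci => y; apply: cvgM; [exact: cvg_cst|exact: cv].
have U0 := Rintegral_expR_cos_ge0 (2 * pi * x) (ltW D0) (ltW c30).
have V0 := Rintegral_idM_expR_le D0 c30.
rewrite -/u -/v -/k in U0 V0 *.
have c1l : 3 / 5 * (c2 * Delta ^+ 2) <= c1.
  by move: small; rewrite mulrAC ler_pdivrMr//; lra.
have k1 := mulr_ge0 (ltW c20) U0.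
have k2 := ler_wpM2l (ltW c20) V0.
rewrite -/E /E in k1 k2 *; lra.
Qed.

End Measure.

End NuHat.

(** * Windowed Fourier transforms *)

Section WindowedTransform.
Context {R : realType}.
Notation mu := (@lebesgue_measure R).
Notation T := (measurableTypeR R).
Variable h : R.
Hypothesis h0 : 0 <= h.
Notation I := (`[- h, h]%classic : set T).
Implicit Types (phi : R -> R[i]) (z w : R[i]) (x g M : R).

(** The operator T of the introduction, at a complex argument. *)
Definition fourier phi z : R[i] :=
  cintegral mu I (fun g : R => phi g * cexp (- ((2 * pi)%:C * 'i * z) * g%:C)).

Definition windowed phi g : R[i] := (\1_I g)%:C * phi g.

Let Nhh : - h <= h. Proof. by rewrite (le_trans _ h0)// oppr_le0. Qed.

Let cpi z : cabs (- ((2 * pi)%:C * 'i * z)) = 2 * pi * cabs z.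
Proof. by rewrite cabsN !cabsM cabs_i mulr1 cabs_real ger0_norm// mulr_ge0 ?pi_ge0. Qed.

Lemma ccont_fourier_integrand phi z : ccont phi ->
  ccont (fun g : R => phi g * cexp (- ((2 * pi)%:C * 'i * z) * g%:C)).
Proof. by move=> cphi; apply: ccontM => //; apply: ccont_cexp; exact: ccont_lin. Qed.

Lemma cabs_fourier_kernel z g : `|g| <= h ->
  cabs (cexp (- ((2 * pi)%:C * 'i * z) * g%:C)) <= expR (2 * pi * h * cabs z).
Proof.
move=> gh; apply: le_trans (cabs_cexp_le _) _; rewrite ler_expR cabsM cpi cabs_real.
by rewrite [leRHS]mulrAC ler_wpM2l// !mulr_ge0 ?pi_ge0// cabs_ge0.
Qed.

Lemma cabs_fourier_le phi M z : ccont phi -> (forall g, `|g| <= h -> cabs (phi g) <= M) ->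
  cabs (fourier phi z) <= 2 * h * M * expR (2 * pi * h * cabs z).
Proof.
move=> cphi phiM.
have -> : 2 * h * M * expR (2 * pi * h * cabs z) =
    Rintegral mu I (fun=> M * expR (2 * pi * h * cabs z)).
  by rewrite Rintegral_itv_cst//; ring.
apply: cabs_cintegral => //.
- by apply: ccont_cmeas => //; exact: ccont_fourier_integrand.
- exact: integrable_itv_cst.
- move=> g; rewrite /= in_itv /= -ler_norml => gh; rewrite cabsM.
  by apply: ler_pM; rewrite ?cabs_ge0 ?phiM// cabs_fourier_kernel.
Qed.

Lemma fourier_windowed phi x : fourier phi x%:C = trig_transform (windowed phi) (- (2 * pi)) x.
Proof.
rewrite /fourier cintegral_mkcond; apply: eq_cintegral => g _.
rewrite /windowed -[RHS]mulrA; congr (_ * (_ * cexp _)).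
by rewrite !rmorphM rmorphN rmorphM /=; ring.
Qed.

Lemma cmeas_windowed phi : ccont phi -> cmeas setT (windowed phi : T -> R[i]).
Proof.
move=> cphi; apply: cmeasM; last exact: ccont_cmeas.
by apply: cmeas_real; exact: measurable_indic.
Qed.

Lemma windowed_in phi g : `|g| <= h -> windowed phi g = phi g.
Proof. by move=> gh; rewrite /windowed indicE mem_set ?mul1r// /= in_itv /= -ler_norml. Qed.

Lemma windowed_out phi g : h < `|g| -> windowed phi g = 0.
Proof.
move=> gh; rewrite /windowed indicE memNset ?mul0r//= in_itv /= -ler_norml => /(lt_le_trans gh).
by rewrite ltxx.
Qed.

Lemma windowed_bounded phi : ccont phi -> exists2 M, 0 <= M & forall g, cabs (windowed phi g) <= M.
Proof.
move=> cphi; have [M [M0 HM]] := ccont_bounded (- h) h cphi; exists M => // g.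
have [gh|gh] := leP `|g| h; last by rewrite windowed_out// cabs0.
by rewrite windowed_in// HM// -ler_norml.
Qed.

Lemma exp_type_fourier phi : ccont phi -> exp_type_le (2 * pi * h) (fourier phi).
Proof.
move=> cphi e e0; have [M [M0 HM]] := ccont_bounded (- h) h cphi.
exists (2 * h * M) => z.
have phiM g : `|g| <= h -> cabs (phi g) <= M by move=> gh; rewrite HM// -ler_norml.
apply: le_trans (cabs_fourier_le z cphi phiM) _.
rewrite ler_wpM2l ?mulr_ge0// ler_expR ler_wpM2r ?cabs_ge0//.
by rewrite lerDl ltW.
Qed.

(** Differentiation under the integral: the second-order Taylor bound of the exponential, uniform
    for |g| <= h, leaves a quadratic error. *)
Lemma entire_fourier phi : ccont phi -> entire (fourier phi).
Proof.
move=> cphi; apply/entireP => z.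
pose e w g := cexp (- ((2 * pi)%:C * 'i * w) * g%:C) : R[i].
pose d := cintegral mu I (fun g : R => phi g * e z g * (- ((2 * pi)%:C * 'i) * g%:C)).
have [M [M0 HM]] := ccont_bounded (- h) h (ccont_fourier_integrand z cphi).
have phiM g : `|g| <= h -> cabs (phi g * e z g) <= M by move=> gh; rewrite HM// -ler_norml.
have ce w : ccont (e w) by apply: ccont_cexp; exact: ccont_lin.
pose L : R := 2 * pi * h.
have L0 : 0 <= L by rewrite !mulr_ge0 ?pi_ge0.
exists d; apply: (@cdiff_quad _ _ _ _ (2 * h * (M * (L ^+ 2 / 2 * expR L))) 1) => // w wz.
have i1 w' : cintegrable mu I (fun g : R => phi g * e w' g).
  by apply: ccont_integrable; exact: ccont_fourier_integrand.
have id_ : cintegrable mu I (fun g : R => phi g * e z g * (- ((2 * pi)%:C * 'i) * g%:C)).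
  apply: ccont_integrable; apply: ccontM; last exact: ccont_lin.
  exact: ccont_fourier_integrand.
rewrite mulrC /d -cintegralZl// /fourier.
rewrite -(cintegralB _ (i1 w) (i1 z))// -cintegralB//; last 2 first.
- exact: cintegrableB.
- exact: cintegrableZl.
have -> : 2 * h * (M * (L ^+ 2 / 2 * expR L)) * cabs (w - z) ^+ 2 =
    Rintegral mu I (fun=> M * (L ^+ 2 / 2 * expR L) * cabs (w - z) ^+ 2).
  by rewrite Rintegral_itv_cst//; ring.
apply: cabs_cintegral => //.
- apply: ccont_cmeas => //; apply: ccontB.
    by apply: ccontB; exact: ccont_fourier_integrand.
  apply: ccontM; first exact: ccont_cst.
  by apply: ccontM; [exact: ccont_fourier_integrand|exact: ccont_lin].
- exact: integrable_itv_cst.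
- move=> g; rewrite /= in_itv /= -ler_norml => gh.
  pose u : R[i] := - ((2 * pi)%:C * 'i * (w - z)) * g%:C.
  have -> : phi g * e w g - phi g * e z g - (w - z) * (phi g * e z g * (- ((2 * pi)%:C * 'i) * g%:C)) =
      phi g * e z g * (cexp u - cexp_poly 2 u).
    have -> : e w g = e z g * cexp u by rewrite /e -cexpD; congr cexp; rewrite /u; ring.
    by rewrite /cexp_poly !big_ord_recl big_ord0 /= expr0 expr1 /u !factS fact0; field.
  rewrite cabsM -mulrA; apply: ler_pM; rewrite ?cabs_ge0 ?phiM//.
  have uL : cabs u <= L * cabs (w - z).
    by rewrite /u cabsM cpi cabs_real [leRHS]mulrAC ler_wpM2l// !mulr_ge0 ?pi_ge0// cabs_ge0.
  have uL1 : cabs u <= L by rewrite (le_trans uL)// ler_piMr// ltW.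
  apply: le_trans (cexp_taylor 2 u) _.
  rewrite [leRHS]mulrAC; apply: ler_pM.
  + by rewrite divr_ge0 ?sqr_ge0 ?ler0n.
  + exact: expR_ge0.
  + rewrite [leRHS]mulrAC -exprMn ler_wpM2r ?invr_ge0 ?ler0n// lerXn2r// nnegrE ?cabs_ge0//.
    by rewrite mulr_ge0// cabs_ge0.
  + by rewrite ler_expR.
Qed.

(** Integration by parts: - 2 pi i x times the transform equals boundary terms minus the transform
    of [phi']. The constant involves only bounds of phi and phi' on the window, hence is uniform
    over families with common bounds. *)
Lemma fourier_decay phi phi' M M' x : (forall g, cder phi g (phi' g)) -> ccont phi' ->
  (forall g, `|g| <= h -> cabs (phi g) <= M) -> (forall g, `|g| <= h -> cabs (phi' g) <= M') ->
  cabs (fourier phi x%:C) <= (2 * h * M + (2 * M + 2 * h * M') / (2 * pi)) / (1 + `|x|).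
Proof.
move=> dphi cphi' phiM phiM'; have cphi := cder_ccont dphi.
pose p : R[i] := - ((2 * pi)%:C * 'i * x%:C).
pose e (g : R) : R[i] := cexp (p * g%:C).
have e1 g : cabs (e g) = 1.
  rewrite /e (_ : p * g%:C = 'i * (- (2 * pi) * x * g)%:C) ?cabs_cexp_i//.
  by rewrite /p !rmorphM rmorphN rmorphM /=; ring.
have ce : ccont e by apply: ccont_cexp; exact: ccont_lin.
have M0 : 0 <= M by apply: le_trans (cabs_ge0 _) (phiM 0 _); rewrite normr0.
have M'0 : 0 <= M' by apply: le_trans (cabs_ge0 _) (phiM' 0 _); rewrite normr0.
have bnd (psi : R -> R[i]) N : ccont psi -> (forall g, `|g| <= h -> cabs (psi g) <= N) ->
    cabs (cintegral mu I (fun g : R => psi g * e g)) <= 2 * h * N.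
  move=> cpsi psiN.
  have -> : 2 * h * N = Rintegral mu I (fun=> N) by rewrite Rintegral_itv_cst//; ring.
  apply: cabs_cintegral => //.
  - by apply: ccont_cmeas => //; exact: ccontM.
  - exact: integrable_itv_cst.
  - move=> g; rewrite /= in_itv /= -ler_norml => gh; rewrite cabsM e1 mulr1; exact: psiN.
have p2 : 0 < 2 * pi :> R by rewrite mulr_gt0 ?pi_gt0.
apply: cabs_le_decay.
- by rewrite !mulr_ge0.
- by rewrite divr_ge0 ?addr_ge0 ?mulr_ge0 ?pi_ge0.
- exact: bnd.
rewrite ler_pdivlMr//.
have -> : cabs (fourier phi x%:C) * `|x| * (2 * pi) = cabs (p * fourier phi x%:C).
  by rewrite cabsM /p cpi cabs_real; move: (cabs _) => F; ring.
have de g : cder e g (p * e g) by exact: cder_cexp (cder_lin p g).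
have := @cintegral_FTC _ (fun g => phi g * e g) (fun g => phi' g * e g + phi g * (p * e g)) _ _ Nhh.
have cpe : ccont (fun g => phi g * (p * e g)).
  by apply: ccontM => //; apply: ccontM => //; exact: ccont_cst.
have cp'e : ccont (fun g => phi' g * e g) by exact: ccontM.
move=> /(_ (ccontD cp'e cpe) (fun g => cderM (dphi g) (de g))).
rewrite cintegralD//; [|exact: ccont_integrable..].
have -> : cintegral mu I (fun g : R => phi g * (p * e g)) = p * fourier phi x%:C.
  rewrite /fourier -cintegralZl//; last by apply: ccont_integrable; exact: ccont_fourier_integrand.
  by apply: eq_cintegral => g _; rewrite -/p -/(e g); ring.
move=> E; have {}E : p * fourier phi x%:C = phi h * e h - phi (- h) * e (- h) -
    cintegral mu I (fun g : R => phi' g * e g).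
  by rewrite -E addrAC subrr add0r.
rewrite E; apply: le_trans (cabsB _ _) _; apply: lerD; last exact: bnd.
apply: le_trans (cabsB _ _) _; rewrite !(cabsM (phi _)) !e1 !mulr1 mulr_natl mulr2n.
by apply: lerD; apply: phiM; rewrite ?normrN ger0_norm.
Qed.

Lemma fourier_decay_ex phi phi' : (forall g, cder phi g (phi' g)) -> ccont phi' ->
  exists2 C, 0 <= C & forall x, cabs (fourier phi x%:C) <= C / (1 + `|x|).
Proof.
move=> df cf'; have cf := cder_ccont df.
have [N [N0 HN]] := ccont_bounded (- h) h cf; have [N' [N'0 HN']] := ccont_bounded (- h) h cf'.
exists (2 * h * N + (2 * N + 2 * h * N') / (2 * pi)).
  have p2 : 0 <= 2 * pi :> R by rewrite mulr_ge0 ?pi_ge0.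
  have k1 := mulr_ge0 (mulr_ge0 (ler0n R 2) h0) N0.
  have k2 := mulr_ge0 (mulr_ge0 (ler0n R 2) h0) N'0.
  exact: addr_ge0 k1 (divr_ge0 (addr_ge0 (mulr_ge0 (ler0n R 2) N0) k2) p2).
by move=> x; apply: (fourier_decay x df cf') => g gh; rewrite ?HN ?HN' -?ler_norml.
Qed.

End WindowedTransform.

(* Inside a product or a sum [z^*] is parsed in [ring_scope], as [Num.conj z]. *)
Lemma Num_conjE {R : realType} (z : R[i]) : Num.conj z = conjc z.
Proof. by []. Qed.

Lemma conjcM {R : realType} (z w : R[i]) : (z * w)^*%C = z^*%C * w^*%C.
Proof. exact: rmorphM. Qed.

Lemma conjcD {R : realType} (z w : R[i]) : (z + w)^*%C = z^*%C + w^*%C.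
Proof. exact: rmorphD. Qed.

Lemma trig_conj {R : realType} (psi : R -> R[i]) (B H s x : R) :
  cmeas setT (psi : measurableTypeR R -> R[i]) -> (forall g, cabs (psi g) <= B) ->
  (forall g, H < `|g| -> psi g = 0) ->
  (trig_transform psi s x)^* = trig_transform (fun g => (psi g)^*) (- s) x.
Proof.
move=> mpsi psiB psiH; have i := trig_integrable mpsi psiB psiH s x.
rewrite /trig_transform -(cintegral_conj measurableT i); apply: eq_cintegral => g _.
rewrite conjcM -cexp_conj; congr (_ * cexp _).
by apply: complex_ext; rewrite ?Re_iM ?Im_iM /= ?Re_iM ?Im_iM /=; ring.
Qed.

(** * Convolution with the measure and the inner product *)

Section Convolution.
Context {R : realType}.
Notation mu := (@lebesgue_measure R).
Notation T := (measurableTypeR R).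
Variables (Delta c1 c2 c3 : R) (nu : {measure set T -> \bar R}).
Hypotheses (D0 : 0 < Delta) (c10 : 0 < c1) (c20 : 0 < c2) (c30 : 0 < c3).
Notation h := (Delta / 2).
Notation I := (`[- h, h]%classic : set T).
Notation w := (density c2 c3).
Notation tail := (tail_density Delta c2 c3).
Implicit Types (phi : R -> R[i]) (x g b s : R).

Let h0 : 0 <= h. Proof. by rewrite divr_ge0// ltW. Qed.

Let mtail := cmeas_tail_density Delta c2 c3.
Let taille := tail_density_le D0 c20 c30.
Let tailout := @tail_density_supp _ Delta c2 c3.

Lemma tail_density_in g : `|g| <= Delta -> tail g = (w g)%:C.
Proof. by move=> gD; rewrite /tail_density indicE mem_set ?mulr1// /= in_itv /= -ler_norml. Qed.

Lemma trig_shift b s x : trig_transform (fun g => tail (g - b)) s x =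
  cexp ('i * (s * (x * b))%:C) * trig_transform tail s x.
Proof.
pose v g : R[i] := (w (g - b))%:C * cexp ('i * (s * (x * g))%:C).
have cv : ccont v.
  apply: ccontM.
    apply: ccont_real => g; apply: (@continuous_comp _ _ _ (fun g => g - b) w).
      by apply: cvgB; [exact: cvg_id|exact: cvg_cst].
    exact: continuous_density.
  by have := ccont_cexp_i (s * x); under eq_fun do rewrite -mulrA.
have DD : - Delta <= Delta by rewrite (le_trans _ (ltW D0))// oppr_le0 ltW.
transitivity (cintegral mu `[- Delta + b, Delta + b] v).
  rewrite [RHS]cintegral_mkcond; apply: eq_cintegral => g _.
  rewrite /tail_density /v rmorphM !indicE.
  suff -> : ((g - b : T) \in (`[- Delta, Delta]%classic : set T)) =
            ((g : T) \in (`[- Delta + b, Delta + b]%classic : set T)) by ring.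
  by apply/idP/idP; rewrite !inE /= !in_itv /= lerBrDr lerBlDr.
rewrite -(cintegral_shift _ cv DD) cintegral_mkcond.
rewrite /trig_transform -cintegralZl//; last exact: trig_integrable mtail taille tailout s x.
apply: eq_cintegral => g _; rewrite /v addrK /tail_density.
have -> : cexp ('i * (s * (x * (g + b)))%:C) = cexp ('i * (s * (x * b))%:C) * cexp ('i * (s * (x * g))%:C) :> R[i].
  by rewrite -cexpD; congr cexp; rewrite -mulrDr -rmorphD; congr ('i * _%:C); ring.
ring.
Qed.

(** The whole-line convolution of the windowed [phi] with the absolutely continuous part of nu. If
    |g| and |b| are at most h, then |g - b| <= Delta, so on the window the truncation of the density
    is invisible. *)
Definition window_conv phi g : R[i] := cintegral mu setT (fun b => windowed h phi b * tail (g - b)).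

Variable phi : R -> R[i].
Hypothesis cphi : ccont phi.

Let M_ : {M | 0 <= M & forall g, cabs (windowed h phi g) <= M}.
Proof. by apply: cid2; exact: windowed_bounded. Qed.

Let M := s2val M_.
Let M0 : 0 <= M := s2valP M_.
Let phiM : forall g, cabs (windowed h phi g) <= M := s2valP' M_.

Let a (b : R) : R := M * \1_I b.
(** Supports in [-h, h] and [-Delta, Delta] add up to [-(h + Delta), h + Delta]. Together with [a]
    this gives the product bound required by Fubini. *)
Let e (g : R) : R := c2 * Delta * \1_(`[- (h + Delta), h + Delta]%classic : set T) g.

Let ia : mu.-integrable setT (EFin \o a). Proof. exact: integrable_indic_itv. Qed.
Let ie : mu.-integrable setT (EFin \o e). Proof. exact: integrable_indic_itv. Qed.

Let c2D : 0 <= c2 * Delta. Proof. by rewrite mulr_ge0// ltW. Qed.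

Let windowed_a b : cabs (windowed h phi b) <= a b.
Proof.
rewrite /a indicE; have [bh|bh] := leP `|b| h.
  by rewrite mem_set ?mulr1// /= in_itv /= -ler_norml.
by rewrite windowed_out// cabs0 mulr_ge0.
Qed.

Let bound b g : cabs (windowed h phi b * tail (g - b)) <= a b * e g.
Proof.
rewrite cabsM; have [bh|bh] := leP `|b| h; last first.
  by rewrite windowed_out// cabs0 mul0r mulr_ge0// mulr_ge0// indicE ler0n.
apply: ler_pM; rewrite ?cabs_ge0 ?windowed_a//.
have [gD|gD] := leP `|g - b| Delta; last first.
  by rewrite tailout// cabs0 mulr_ge0// indicE ler0n.
rewrite /e indicE mem_set ?mulr1 ?taille//= in_itv /= -ler_norml.
by rewrite -[g](subrK b) (le_trans (ler_normD _ _))// addrC lerD.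
Qed.

Let mtail_comp d (S : measurableType d) (j : S -> T) : measurable_fun setT j ->
  cmeas setT (fun z => tail (j z)).
Proof.
move=> mj; have [tr ti] := mtail.
by split; [exact: measurableT_comp tr mj|exact: measurableT_comp ti mj].
Qed.

Let mker d (S : measurableType d) (i j : S -> T) : measurable_fun setT i -> measurable_fun setT j ->
  cmeas setT (fun z => windowed h phi (i z) * tail (j z - i z)).
Proof.
move=> mi mj; apply: cmeasM; last by apply: mtail_comp; exact: measurable_funB.
have [wr wi] := cmeas_windowed h cphi.
by split; [exact: measurableT_comp wr mi|exact: measurableT_comp wi mi].
Qed.

Let iker g : cintegrable mu setT (fun b : T => windowed h phi b * tail (g - b)).
Proof.
apply: (cintegrable_dom _ _ (integrable_scale (c2 * Delta) measurableT ia)) => //.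
  exact: (mker (@measurable_id _ _ setT) (measurable_cst g)).
move=> b _; rewrite cabsM mulrC; apply: ler_pM; rewrite ?cabs_ge0//; exact: taille.
Qed.

Let itail b s x : cintegrable mu setT (fun g : T => tail (g - b) * cexp ('i * (s * (x * g))%:C)).
Proof.
apply: (@trig_integrable _ (fun g => tail (g - b)) (c2 * Delta) (Delta + `|b|)).
- apply: mtail_comp; exact: measurable_funB.
- by move=> g; exact: taille.
- move=> g gb; apply: tailout; rewrite -(ltrD2r `|b|) (lt_le_trans gb)//.
  by rewrite -{1}[g](subrK b) ler_normD.
Qed.

Lemma cmeas_window_conv : cmeas setT (window_conv phi : T -> R[i]).
Proof.
pose F (g b : R) := windowed h phi b * tail (g - b).
have [||||//] := @cfubini _ F e a.
- exact: (mker measurable_snd measurable_fst).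
- exact: ie.
- exact: ia.
- by move=> g b; rewrite mulrC; exact: bound.
Qed.

Lemma window_conv_bounded : exists B, forall g, cabs (window_conv phi g) <= B.
Proof.
exists (Rintegral mu setT (fun b => c2 * Delta * a b)) => g.
apply: cabs_cintegral => //.
- exact: cintegrable_meas (iker g).
- exact: integrable_scale.
- move=> b _; rewrite cabsM mulrC; apply: ler_pM; rewrite ?cabs_ge0//; exact: taille.
Qed.

Lemma window_conv_supp g : h + Delta < `|g| -> window_conv phi g = 0.
Proof.
move=> gh; rewrite /window_conv (_ : (fun b => _) = (fun=> 0 * 0)).
  by rewrite cintegralZl ?mul0r//; split => /=; exact: integrable0.
apply/funext => b; rewrite mulr0; have [bh|bh] := leP `|b| h; last by rewrite windowed_out// mul0r.
rewrite tailout ?mulr0// ltNge; apply/negP => gb; move: gh; rewrite ltNge => /negP; apply.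
by rewrite -[g](subrK b) (le_trans (ler_normD _ _))// addrC lerD.
Qed.

Lemma window_conv_in g : `|g| <= h ->
  window_conv phi g = cintegral mu I (fun b => phi b * (w (g - b))%:C).
Proof.
move=> gh; rewrite [RHS]cintegral_mkcond; apply: eq_cintegral => b _.
rewrite /windowed -mulrA; have [bI|bI] := boolP ((b : T) \in I); last by rewrite indicE (negbTE bI) !mul0r.
rewrite tail_density_in//; move: bI; rewrite inE /= in_itv /= -ler_norml => bI.
by rewrite (le_trans (ler_normB _ _))// (splitr Delta) lerD.
Qed.

(** The convolution theorem, by Fubini; the inner integral is a translate, whose transform is a
    modulation. *)
Lemma trig_window_conv s x : trig_transform (windowed h phi) s x * trig_transform tail s x =
  trig_transform (window_conv phi) s x.
Proof.
pose ex (g : R) : R[i] := cexp ('i * (s * (x * g))%:C).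
have ex1 g : cabs (ex g) = 1 by rewrite /ex cabs_cexp_i.
have cex : ccont ex by have := ccont_cexp_i (s * x); rewrite /ex; under eq_fun do rewrite -mulrA.
have iw : cintegrable mu setT (fun g => windowed h phi g * ex g).
  exact: trig_integrable (cmeas_windowed h cphi) phiM (@windowed_out _ h phi) s x.
pose F (b g : R) := windowed h phi b * tail (g - b) * ex g.
have step : trig_transform (windowed h phi) s x * trig_transform tail s x =
    cintegral mu setT (fun b => cintegral mu setT (F b)).
  rewrite mulrC -[trig_transform (windowed h phi) s x]/(cintegral mu setT (fun g => windowed h phi g * ex g)).
  rewrite -(cintegralZl _ measurableT iw).
  apply: eq_cintegral => b _.
  have -> : F b = fun g => windowed h phi b * (tail (g - b) * ex g).
    by apply/funext => g; rewrite /F mulrA.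
  rewrite (cintegralZl _ measurableT (itail b s x)).
  rewrite -[cintegral mu setT _]/(trig_transform (fun g => tail (g - b)) s x) trig_shift -/(ex b).
  by rewrite [RHS]mulrA [LHS]mulrC.
rewrite {}step.
have [||_ ->] := @cfubini _ F a e _ ia ie.
- apply: cmeasM; first exact: (mker measurable_fst measurable_snd).
  have [er ei] := ccont_cmeas (@measurableT _ T) cex.
  by split; [exact: measurableT_comp er measurable_snd|exact: measurableT_comp ei measurable_snd].
- by move=> b g; rewrite /F cabsM ex1 mulr1; exact: bound.
apply: eq_cintegral => g _; rewrite -/(ex g) [RHS]mulrC -(cintegralZl _ measurableT (iker g)).
by apply: eq_cintegral => b _; rewrite /F mulrC.
Qed.

Hypothesis nuP : is_nu Delta c1 c2 c3 nu.
Variables (phi' P P' : R -> R[i]).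
Hypothesis dphi : forall g, cder phi g (phi' g).
Hypothesis cphi' : ccont phi'.
Hypothesis dP : forall g, cder P g (P' g).
Hypothesis cP' : ccont P'.
Hypothesis convP : forall g, `|g| <= h ->
  c1%:C * phi g + cintegral mu I (fun b => phi b * (w (g - b))%:C) = P g.

Let cP : ccont P := cder_ccont dP.

(** The part of phi * nu that the window does not see. It vanishes for |g| < h, so only frequencies
    to which the functions of the space are orthogonal remain. *)
Let residual g : R[i] := c1%:C * windowed h phi g + window_conv phi g - windowed h P g.

Let cmeas_residual : cmeas setT (residual : T -> R[i]).
Proof.
apply: cmeasB; last exact: cmeas_windowed.
apply: cmeasD; last exact: cmeas_window_conv.
by apply: cmeasM; [exact: cmeas_cst|exact: cmeas_windowed].
Qed.

Let residual_bounded : exists B, forall g, cabs (residual g) <= B.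
Proof.
have [B HB] := window_conv_bounded; have [N N0 HN] := windowed_bounded h cP.
exists (c1 * M + B + N) => g; apply: (le_trans (cabsB _ _)); apply: lerD; last exact: HN.
apply: (le_trans (cabsD _ _)); apply: lerD; last exact: HB.
by rewrite cabsM cabs_real (gtr0_norm c10); apply: ler_wpM2l; [exact: ltW|exact: phiM].
Qed.

Let residual_out g : h + Delta < `|g| -> residual g = 0.
Proof.
move=> gh; have hg : h < `|g| by rewrite (le_lt_trans _ gh)// lerDl ltW.
by rewrite /residual !windowed_out// window_conv_supp// mulr0 addr0 subrr.
Qed.

Let residual_in g : `|g| < h -> residual g = 0.
Proof.
by move=> /ltW gh; rewrite /residual !windowed_in// window_conv_in// convP// subrr.
Qed.

Let trig_residual x : trig_transform residual (- (2 * pi)) x =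
  fourier h phi x%:C * nu_hat nu x - fourier h P x%:C.
Proof.
have [B HB] := window_conv_bounded; have [N N0 HN] := windowed_bounded h cP.
have i1 := trig_integrable (cmeas_windowed h cphi) phiM (@windowed_out _ h phi) (- (2 * pi)) x.
have i2 := trig_integrable cmeas_window_conv HB window_conv_supp (- (2 * pi)) x.
have i3 := trig_integrable (cmeas_windowed h cP) HN (@windowed_out _ h P) (- (2 * pi)) x.
rewrite (nu_hat_trig c10 c20 nuP) !fourier_windowed [X in _ = X - _]mulrDr trig_window_conv.
rewrite [_ * c1%:C]mulrC /trig_transform -(cintegralZl _ measurableT i1).
have i4 := cintegrableZl c1%:C measurableT i1.
rewrite -(cintegralD measurableT i4 i2) -(cintegralB measurableT (cintegrableD measurableT i4 i2) i3).
by apply: eq_cintegral => g _; rewrite /residual; ring.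
Qed.

Variable f : R[i] -> R[i].
Hypothesis small : c2 / c1 * Delta ^+ 2 <= 5 / 3.
Hypothesis fH : inH Delta nu f.

Let ef : entire f. Proof. by case: fH. Qed.
Let gf : exp_type_le (pi * Delta) f. Proof. by case: fH. Qed.

(** The positive lower bound of the spectral density makes the weighted norm dominate the unweighted
    one. *)
Lemma inH_L2 : L2 (fun x : R => f x%:C).
Proof.
have [d d0 Hd] := spectral_density_gt0 D0 c10 c20 c30 small; have [_ _ [iR _]] := fH.
have iR2 := integrable_scale d^-1 (@measurableT _ T) iR.
have mf : cmeas setT (fun x : T => f x%:C) by apply: ccont_cmeas => //; exact: ccont_restrict.
apply: (@integrable_dom _ _ T mu setT (fun x : R => cabs (f x%:C) ^+ 2) _ _ _ iR2) => //.
  by apply: measurable_funX; exact: cmeas_cabs.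
move=> x _; rewrite ger0_norm ?sqr_ge0//.
rewrite normC_cabs -rmorphXn (nu_hat_real D0 c10 c20 nuP) -rmorphM /=.
by rewrite ler_pdivlMl// mulrC ler_wpM2l ?sqr_ge0.
Qed.

Let sp : `|2 * pi| * h = pi * Delta :> R.
Proof. by rewrite ger0_norm ?mulr_ge0 ?pi_ge0//; field. Qed.

Let orthogonal_residual :
  cintegral mu setT (fun x : R => f x%:C * (trig_transform residual (- (2 * pi)) x)^*%C) = 0 /\
  cintegrable mu setT (fun x : R => f x%:C * (trig_transform residual (- (2 * pi)) x)^*%C).
Proof.
have [B HB] := residual_bounded.
have [C1 C10 H1] := fourier_decay_ex h0 dphi cphi'; have [C2 C20 H2] := fourier_decay_ex h0 dP cP'.
have [N HN] := nu_hat_bounded D0 c10 c20 c30 nuP.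
have N0 : 0 <= N := le_trans (cabs_ge0 _) (HN 0).
have mres : cmeas setT (fun g : T => (residual g)^*) by exact: cmeas_conj.
have resB g : cabs (residual g)^* <= B by rewrite cabs_conj.
have res_out g : h + Delta < `|g| -> (residual g)^* = 0.
  by move=> gh; rewrite residual_out// conjc0.
have res_in g : `|g| < h -> (residual g)^* = 0 by move=> gh; rewrite residual_in// conjc0.
have E x : (trig_transform residual (- (2 * pi)) x)^* = trig_transform (fun g => (residual g)^*) (2 * pi) x.
  by rewrite (trig_conj _ _ cmeas_residual HB residual_out) opprK.
(* The decay is read off from [trig_residual]: two transforms of order 1 / (1 + |x|), the first
   multiplied by the bounded [nu_hat]. *)
have dec x : cabs (trig_transform (fun g => (residual g)^*) (2 * pi) x) <= (C1 * N + C2) / (1 + `|x|).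
  rewrite -E cabs_conj trig_residual; apply: (le_trans (cabsB _ _)); rewrite mulrDl.
  apply: lerD; last exact: H2.
  by rewrite cabsM mulrAC; apply: ler_pM; rewrite ?cabs_ge0.
have C0 : 0 <= C1 * N + C2 by rewrite addr_ge0// mulr_ge0.
have gamma0 : 0 < pi * Delta by rewrite mulr_gt0 ?pi_gt0.
have mf : cmeas setT (fun x : T => f x%:C) by apply: ccont_cmeas => //; exact: ccont_restrict.
have iv := integrable_scale ((C1 * N + C2) ^+ 2) (@measurableT _ T) integrable_invD1sqr.
have mt : cmeas setT (trig_transform (fun g => (residual g)^*) (2 * pi) : T -> R[i]).
  exact: cmeas_trig mres resB res_out _ _ measurableT.
have [_ i2] := integrable_mul_L2 mf mt inH_L2 iv (fun x => decay_sqr C0 (dec x)).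
have -> : (fun x : R => f x%:C * (trig_transform residual (- (2 * pi)) x)^*%C) =
    (fun x : R => f x%:C * trig_transform (fun g => (residual g)^*) (2 * pi) x).
  by apply/funext => x; rewrite E.
split; last exact: i2.
(* The type pi Delta equals 2 pi h, so this is exactly the limiting case of the orthogonality. *)
apply: (@spectral_orthogonality _ _ B (h + Delta) mres resB res_out f (pi * Delta) h (2 * pi) _ ef gf gamma0 inH_L2 _ res_in C0 dec).
by rewrite sp.
Qed.

(** Orthogonality to the residual leaves only the values [P] of phi * nu on the window, and the
    weight [nu_hat] is absorbed into [P]. *)
Lemma inner_fourier :
  inner nu f (fourier h phi) = cintegral mu setT (fun x : R => f x%:C * (fourier h P x%:C)^*%C).
Proof.
have [orth iorth] := orthogonal_residual.
have [C2 C20 H2] := fourier_decay_ex h0 dP cP'.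
have mf : cmeas setT (fun x : T => f x%:C) by apply: ccont_cmeas => //; exact: ccont_restrict.
have iv := integrable_scale (C2 ^+ 2) (@measurableT _ T) integrable_invD1sqr.
have mP : cmeas setT (fun x : T => (fourier h P x%:C)^*).
  by apply: cmeas_conj; apply: ccont_cmeas => //; apply: ccont_restrict; exact: entire_fourier.
have decP x : cabs (fourier h P x%:C)^* <= C2 / (1 + `|x|) by rewrite cabs_conj.
have [_ iP] := integrable_mul_L2 mf mP inH_L2 iv (fun x => decay_sqr C20 (decP x)).
rewrite -[RHS]addr0 -[X in _ = _ + X]orth -(cintegralD measurableT iP iorth).
apply: eq_cintegral => x _; rewrite -mulrDr -conjcD trig_residual addrC subrK conjcM Num_conjE.
by rewrite (nu_hat_real D0 c10 c20 nuP) conjc_real mulrA.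
Qed.

End Convolution.

(** * Closed forms *)

Section PuncturedLimit.
Context {R : realType}.
Implicit Types (f g : R[i] -> R[i]) (z l d : R[i]).

Lemma punctured_cvg f z l : (forall e : R, 0 < e -> exists2 r : R, 0 < r &
    forall w, w != z -> cabs (w - z) < r -> cabs (f w - l) <= e) ->
  ((f : R[i]^o -> R[i]^o) w @[w --> (z : R[i]^o)^'] --> (l : R[i]^o)).
Proof.
move=> H; apply/cvgrPdist_le => e e0.
have eE : e = (complex.Re e)%:C by have := gtr0_real e0 => /RRe_real.
have [|r r0 Hr] := H (complex.Re e); first by rewrite eE ltcR in e0.
rewrite /dnbhs /within /=; apply/nbhs_ballP; exists r%:C; rewrite /= ?ltcR//.
move=> w; rewrite /ball /= distrC normC_cabs ltcR => wr wz.
by rewrite eE distrC normC_cabs lecR; exact: Hr.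
Qed.

(** A removable singularity: off [z] the function coincides with a differentiable [g], so its limit
    is the value of [g]. *)
Lemma limit_at_cdiff f g z d (r : R) : cdiff g z d -> 0 < r ->
  (forall w, w != z -> cabs (w - z) < r -> f w = g w) -> limit_at f z = g z.
Proof.
move=> dg r0 fg; apply: (@cvg_lim R[i]^o); first exact: norm_hausdorff.
apply: punctured_cvg => e e0; have [s s0 Hs] := cdiff_bound dg.
have d0 : 0 < cabs d + 1 by rewrite ltr_wpDl// cabs_ge0.
exists (Num.min r (Num.min s (e / (cabs d + 1)))).
  by rewrite !lt_min r0 s0 divr_gt0.
move=> w wz; rewrite !lt_min => /andP[wr /andP[ws we]]; rewrite (fg w wz wr).
by rewrite (le_trans (Hs w ws))// -ler_pdivlMl// mulrC ltW.
Qed.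

End PuncturedLimit.

Section ClosedForms.
Context {R : realType}.
Notation mu := (@lebesgue_measure R).
Notation T := (measurableTypeR R).
Implicit Types (a b g h : R) (p q eta z : R[i]).

Lemma cintegral_cexp p a b : a <= b -> p != 0 ->
  cintegral mu `[a, b] (fun x : R => cexp (p * x%:C)) = (cexp (p * b%:C) - cexp (p * a%:C)) / p.
Proof.
move=> ab p0; rewrite mulrBl.
apply: (cintegral_FTC (F := fun x : R => cexp (p * x%:C) / p) ab).
  by apply: ccont_cexp; exact: ccont_lin.
move=> x; have := cderM (cder_cexp (cder_lin p x)) (cder_cst p^-1 x).
by move=> H; apply: cder_eq H _; field.
Qed.

Lemma cintegral_idM_cexp p a b g : a <= b -> p != 0 ->
  cintegral mu `[a, b] (fun x : R => (g - x)%:C * cexp (p * x%:C)) =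
  ((g - b)%:C / p + p ^- 2) * cexp (p * b%:C) - ((g - a)%:C / p + p ^- 2) * cexp (p * a%:C).
Proof.
move=> ab p0.
apply: (cintegral_FTC (F := fun x : R => ((g - x)%:C / p + p ^- 2) * cexp (p * x%:C)) ab).
  apply: ccontM; last by apply: ccont_cexp; exact: ccont_lin.
  apply: ccont_real => x; apply: cvgB; [exact: cvg_cst|exact: cvg_id].
move=> x; have d1 : cder (fun x : R => (g - x)%:C) x (- 1).
  have := cderB (cder_cst g%:C x) (cder_id x); rewrite sub0r.
  by under eq_fun do rewrite -rmorphB.
have d2 := cderD (cderM d1 (cder_cst p^-1 x)) (cder_cst (p ^- 2) x).
have H := cderM d2 (cder_cexp (cder_lin p x)).
by apply: cder_eq H _; field.
Qed.

Lemma ccont_ccosh eta : ccont (fun g : R => ccosh (eta * g%:C)).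
Proof.
rewrite /ccosh; apply: ccontM; last exact: ccont_cst.
apply: ccontD; apply: ccont_cexp; first exact: ccont_lin.
by apply: ccontN; exact: ccont_lin.
Qed.

Lemma ccont_csinh eta : ccont (fun g : R => csinh (eta * g%:C)).
Proof.
rewrite /csinh; apply: ccontM; last exact: ccont_cst.
apply: ccontB; apply: ccont_cexp; first exact: ccont_lin.
by apply: ccontN; exact: ccont_lin.
Qed.

Lemma cder_ccosh eta g : cder (fun g : R => ccosh (eta * g%:C)) g (eta * csinh (eta * g%:C)).
Proof.
have H := cderM (cderD (cder_cexp (cder_lin eta g)) (cder_cexp (cderN (cder_lin eta g)))) (cder_cst 2^-1 g).
by apply: cder_eq H _; rewrite /csinh; field.
Qed.

Lemma cder_csinh eta g : cder (fun g : R => csinh (eta * g%:C)) g (eta * ccosh (eta * g%:C)).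
Proof.
have H := cderM (cderB (cder_cexp (cder_lin eta g)) (cder_cexp (cderN (cder_lin eta g)))) (cder_cst 2^-1 g).
by apply: cder_eq H _; rewrite /ccosh; field.
Qed.

Section Fourier.
Variable Delta : R.
Hypothesis D0 : 0 < Delta.
Notation h := (Delta / 2).

Let h0 : 0 <= h. Proof. by rewrite divr_ge0// ltW. Qed.
Let Nhh : - h <= h. Proof. by rewrite (le_trans _ h0)// oppr_le0. Qed.

Let hE : h%:C = Delta%:C / 2 :> R[i].
Proof. by rewrite rmorphM fmorphV rmorph_nat. Qed.

Let den eta z : R[i] := 4 * pi%:C ^+ 2 * z ^+ 2 + eta ^+ 2.

Let denE eta z : den eta z = (eta - (2 * pi)%:C * 'i * z) * (eta + (2 * pi)%:C * 'i * z).
Proof.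
rewrite -subr_sqr !exprMn sqrCi rmorphM rmorph_nat /den; ring.
Qed.

(** Splitting cosh into exponentials, with t = 2 pi i z, gives two integrals with denominators eta -
    t and - eta - t, whose product is minus the denominator of [Cfun_quot]. *)
Lemma fourier_ccosh eta z : den eta z != 0 ->
  fourier h (fun g : R => ccosh (eta * g%:C)) z = Cfun_quot Delta eta z.
Proof.
move=> d0; set t : R[i] := (2 * pi)%:C * 'i * z.
have /andP[p0 q0] : (eta - t != 0) && (eta + t != 0).
  by move: d0; rewrite denE mulf_eq0 negb_or.
have q'0 : - eta - t != 0 by rewrite -opprD oppr_eq0.
transitivity (2^-1 * (cintegral mu `[- h, h] (fun g : R => cexp ((eta - t) * g%:C)) +
    cintegral mu `[- h, h] (fun g : R => cexp ((- eta - t) * g%:C)))).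
  have ic p : cintegrable mu `[- h, h] (fun g : R => cexp (p * g%:C)).
    by apply: ccont_integrable; apply: ccont_cexp; exact: ccont_lin.
  rewrite -(cintegralD _ (ic _) (ic _))// -cintegralZl//; last exact: cintegrableD.
  apply: eq_cintegral => g _.
  have -> : cexp ((eta - t) * g%:C) = cexp (eta * g%:C) * cexp (- t * g%:C) by rewrite -cexpD; congr cexp; ring.
  have -> : cexp ((- eta - t) * g%:C) = cexp (- (eta * g%:C)) * cexp (- t * g%:C) by rewrite -cexpD; congr cexp; ring.
  by rewrite /ccosh -/t; field.
rewrite !cintegral_cexp// /Cfun_quot /ccosh /csinh /ccos /csin.
have sE : 'i * ((pi * Delta)%:C * z) = t * h%:C by rewrite /t hE !rmorphM rmorph_nat; field.
rewrite sE (mulrC h%:C eta).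
have e1 : cexp ((eta - t) * h%:C) = cexp (eta * h%:C) * cexp (- (t * h%:C)) by rewrite -cexpD; congr cexp; ring.
have e2 : cexp ((eta - t) * (- h)%:C) = cexp (- (eta * h%:C)) * cexp (t * h%:C).
  by rewrite -cexpD; congr cexp; rewrite rmorphN; ring.
have e3 : cexp ((- eta - t) * h%:C) = cexp (- (eta * h%:C)) * cexp (- (t * h%:C)) by rewrite -cexpD; congr cexp; ring.
have e4 : cexp ((- eta - t) * (- h)%:C) = cexp (eta * h%:C) * cexp (t * h%:C).
  by rewrite -cexpD; congr cexp; rewrite rmorphN; ring.
rewrite e1 e2 e3 e4 -/(den eta z) denE -/t.
have -> : 4 * pi%:C * z = 2 * t / 'i :> R[i].
  by rewrite /t !rmorphM rmorph_nat; field; exact: neq0Ci.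
have i0 : 'i != 0 :> R[i] by exact: neq0Ci.
have ii : 'i ^+ 2 = - 1 :> R[i] by exact: sqrCi.
move: (cexp (eta * h%:C)) (cexp (- (eta * h%:C))) (cexp (t * h%:C)) (cexp (- (t * h%:C))) => a a' b b'.
have -> : 2 * t / 'i * ((b - b') / (2 * 'i)) = - (t * (b - b')).
  have -> : 2 * t / 'i * ((b - b') / (2 * 'i)) = t * (b - b') / 'i ^+ 2 by field.
  by rewrite ii invrN1 mulrN1.
by field; rewrite p0 q0.
Qed.

Let pi4 : 4 * pi%:C ^+ 2 != 0 :> R[i].
Proof.
rewrite mulf_neq0 ?pnatr_eq0// expf_neq0// -(rmorph0 (real_complex R)) (inj_eq (@complexI R)).
by rewrite gt_eqF ?pi_gt0.
Qed.

(** The transform is entire, so it also supplies the limits by which [Cfun] is defined at the zeros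
    of the denominator. *)
Lemma Cfun_fourier eta z : Cfun Delta eta z = fourier h (fun g : R => ccosh (eta * g%:C)) z.
Proof.
rewrite /Cfun -/(den eta z); case: eqVneq => [d0|d0]; last by rewrite fourier_ccosh.
have /entireP/(_ z)[d dF] := entire_fourier h0 (ccont_ccosh eta).
have dw w : den eta w = 4 * pi%:C ^+ 2 * ((w - z) * (w + z)).
  by rewrite -[LHS]subr0 -[X in _ - X]d0 /den; ring.
(* The denominator vanishes only at z and - z, which are 2 |z| apart; for z = 0 they coincide and
   any radius serves. *)
have [r r0 Hr] : exists2 r : R, 0 < r & forall w, w != z -> cabs (w - z) < r -> den eta w != 0.
  exists (if z == 0 then 1 else cabs z); first by case: eqVneq => // z0; rewrite cabs_gt0.
  move=> w wz wr; rewrite dw mulf_neq0 ?pi4 // mulf_neq0 ?subr_eq0//.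
  apply/eqP => wzE; have {}wzE : w = - z by apply/eqP; rewrite -addr_eq0 wzE.
  move: wz wr; rewrite wzE; have [->|z0 _] := eqVneq z 0; first by rewrite oppr0 eqxx.
  rewrite -opprD cabsN -mulr2n -[z *+ 2]mulr_natl cabsM -[2]/(2%:R) -(rmorph_nat (real_complex R)) cabs_real normr_nat.
  by have := cabs_ge0 z; lra.
apply: (limit_at_cdiff dF r0) => w wz wr.
by rewrite fourier_ccosh// Hr.
Qed.

(** The case eta = 0 of [fourier_ccosh], since cosh 0 = 1; the value at z = 0 again follows from
    entireness. *)
Lemma sinc_fourier z : sinc Delta z = fourier h (fun=> 1) z.
Proof.
have quot w : w != 0 -> fourier h (fun=> 1) w = sinc_quot Delta w.
  move=> w0.
  have -> : (fun=> 1) = (fun g : R => ccosh (0 * g%:C)) :> (R -> R[i]).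
    by apply/funext => g; rewrite /ccosh mul0r oppr0 cexp0; field.
  rewrite fourier_ccosh.
    have p0 : pi%:C != 0 :> R[i] by apply: contraNneq pi4 => ->; rewrite expr0n /= mulr0.
    rewrite /Cfun_quot /sinc_quot /ccosh !mulr0 oppr0 cexp0.
    move: (csin _) (ccos _) (csinh _) => u v s; rewrite !mul0r addr0 expr0n /= addr0.
    by move: (pi%:C) p0 => P p0; field; rewrite p0 w0.
  by rewrite /den expr0n addr0 mulf_neq0// expf_neq0.
rewrite /sinc; case: eqVneq => [->|z0]; last by rewrite quot.
have /entireP/(_ 0)[d dF] := entire_fourier h0 (ccont_cst (1 : R[i])).
by apply: (limit_at_cdiff dF ltr01) => w w0 _; rewrite quot.
Qed.

End Fourier.

End ClosedForms.

Section RealEmbedding.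
Context {R : realType}.
Implicit Types x y : R.

Lemma realcM x y : (x * y)%:C = x%:C * y%:C :> R[i]. Proof. exact: rmorphM. Qed.
Lemma realcD x y : (x + y)%:C = x%:C + y%:C :> R[i]. Proof. exact: rmorphD. Qed.
Lemma realcN x : (- x)%:C = - x%:C :> R[i]. Proof. exact: rmorphN. Qed.
Lemma realcB x y : (x - y)%:C = x%:C - y%:C :> R[i]. Proof. exact: rmorphB. Qed.
Lemma realcV x : (x^-1)%:C = x%:C^-1 :> R[i]. Proof. exact: fmorphV. Qed.
Lemma realcX x n : (x ^+ n)%:C = x%:C ^+ n :> R[i]. Proof. exact: rmorphXn. Qed.
Lemma realc_nat n : (n%:R)%:C = n%:R :> R[i]. Proof. exact: rmorph_nat. Qed.
Lemma realc_eq0 x : (x%:C == 0 :> R[i]) = (x == 0).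
Proof. by rewrite -(rmorph0 (real_complex R)) (inj_eq (@complexI R)). Qed.

Definition realcE := (realcM, realcD, realcN, realcB, realcV, realcX, realc_nat).

End RealEmbedding.

(** * The convolution of hyperbolic cosines with the measure *)

Section ConvolutionFormula.
Context {R : realType}.
Notation mu := (@lebesgue_measure R).
Notation T := (measurableTypeR R).
Variables (Delta c1 c2 c3 : R).
Hypotheses (D0 : 0 < Delta) (c10 : 0 < c1) (c20 : 0 < c2) (c30 : 0 < c3).
Notation h := (Delta / 2).
Notation I := (`[- h, h]%classic : set T).
Implicit Types (g b : R) (p eta : R[i]).

Let h0 : 0 <= h. Proof. by rewrite divr_ge0// ltW. Qed.
Let Nhh : - h <= h. Proof. by rewrite (le_trans _ h0)// oppr_le0. Qed.

(* [remainder_fun] is the [R] of the introduction; it is singular only at [eta ^ 2 = c3 ^ 2],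
   which excludes the roots of [char_fun]. *)
Definition char_fun eta : R[i] :=
  eta ^+ 4 + (2 * (c2 / c1 - c3 ^+ 2))%:C * eta ^+ 2 + (c3 ^+ 2 * (2 * (c2 / c1) + c3 ^+ 2))%:C.

Definition remainder_fun eta g : R[i] :=
  (ccosh (eta * g%:C) - ccosh (c3%:C * g%:C)
   - (eta ^+ 2 - c3%:C ^+ 2) * g%:C * csinh (c3%:C * g%:C) / (2 * c3%:C)) / (eta ^+ 2 - c3%:C ^+ 2) ^+ 2.

Let c3C : c3%:C != 0 :> R[i].
Proof. by rewrite realc_eq0 gt_eqF. Qed.

Let c1C : c1%:C != 0 :> R[i].
Proof. by rewrite realc_eq0 gt_eqF. Qed.

Section Eta.
Variable eta : R[i].
Hypothesis eta_c3 : eta ^+ 2 - c3%:C ^+ 2 != 0.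
Notation p := (c3%:C + eta).
Notation q := (c3%:C - eta).
Notation U := (cexp (- (p * h%:C))).
Notation V := (cexp (- (q * h%:C))).

Let pq0 : (p != 0) && (q != 0).
Proof. by rewrite -negb_or -mulf_eq0 mulrC -subr_sqr -oppr_eq0 opprB. Qed.
Let p0 : p != 0. Proof. by case/andP: pq0. Qed.
Let q0 : q != 0. Proof. by case/andP: pq0. Qed.

Lemma cintegral_ccosh_expR_norm :
  cintegral mu I (fun b => ccosh (eta * b%:C) * (expR (- (c3 * `|b|)))%:C) = (1 - U) / p + (1 - V) / q.
Proof.
have cc : ccont (fun b : R => ccosh (eta * b%:C) * (expR (- (c3 * `|b|)))%:C).
  by apply: ccontM; [exact: ccont_ccosh|apply: ccont_real; exact: continuous_expRN_norm].
rewrite (cintegral_sym cc h0).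
transitivity (cintegral mu `[0, h] (fun b : R => cexp ((- p) * b%:C) + cexp ((- q) * b%:C))).
  apply: eq_cintegral => b; rewrite inE /= in_itv /= => /andP[b0 _].
  rewrite normrN ger0_norm// rmorphN mulrN /ccosh opprK -cexp_real rmorphN rmorphM.
  have -> : cexp (- p * b%:C) = cexp (- (c3%:C * b%:C)) * cexp (- (eta * b%:C)) by rewrite -cexpD; congr cexp; ring.
  have -> : cexp (- q * b%:C) = cexp (- (c3%:C * b%:C)) * cexp (eta * b%:C) by rewrite -cexpD; congr cexp; ring.
  by rewrite /=; field.
have ic r : cintegrable mu `[0, h] (fun b : R => cexp (r * b%:C)).
  by apply: ccont_integrable; apply: ccont_cexp; exact: ccont_lin.
rewrite (cintegralD _ (ic _) (ic _))// !cintegral_cexp ?oppr_eq0//.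
rewrite !mulr0 cexp0 !mulNr; move: U V => u v.
by field; rewrite p0 q0.
Qed.

(** The integral is split at the kink b = g of |g - b|; each piece is a linear factor times
    exponentials of rates p, q or - p, - q. *)
Lemma cintegral_ccosh_conv g : `|g| <= h ->
  cintegral mu I (fun b => ccosh (eta * b%:C) * (`|g - b| * expR (- (c3 * `|g - b|)))%:C) =
  2^-1 * (cexp (eta * g%:C) / p ^+ 2 - ((g + h)%:C / p + p ^- 2) * U * cexp (- (c3%:C * g%:C))
        + cexp (- (eta * g%:C)) / q ^+ 2 - ((g + h)%:C / q + q ^- 2) * V * cexp (- (c3%:C * g%:C))
        + cexp (- (eta * g%:C)) / p ^+ 2 - ((h - g)%:C / p + p ^- 2) * U * cexp (c3%:C * g%:C)
        + cexp (eta * g%:C) / q ^+ 2 - ((h - g)%:C / q + q ^- 2) * V * cexp (c3%:C * g%:C)).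
Proof.
rewrite ler_norml => /andP[hg gh].
have cc : ccont (fun b : R => ccosh (eta * b%:C) * (`|g - b| * expR (- (c3 * `|g - b|)))%:C).
  apply: ccontM; first exact: ccont_ccosh.
  apply: ccont_real => b; apply: (@continuous_comp _ _ _ (fun b => g - b) (fun a => `|a| * expR (- (c3 * `|a|)))).
    by apply: cvgB; [exact: cvg_cst|exact: cvg_id].
  by apply: cvgM; [exact: norm_continuous|exact: continuous_expRN_norm].
rewrite (cintegral_split cc hg gh).
have ic r a b : cintegrable mu `[a, b] (fun b : R => (g - b)%:C * cexp (r * b%:C)).
  apply: ccont_integrable; apply: ccontM; last by apply: ccont_cexp; exact: ccont_lin.
  apply: ccont_real => x; apply: cvgB; [exact: cvg_cst|exact: cvg_id].
have E1 : cintegral mu `[- h, g] (fun b => ccosh (eta * b%:C) * (`|g - b| * expR (- (c3 * `|g - b|)))%:C) =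
    2^-1 * cexp (- (c3%:C * g%:C)) *
    (cintegral mu `[- h, g] (fun b : R => (g - b)%:C * cexp (p * b%:C)) +
     cintegral mu `[- h, g] (fun b : R => (g - b)%:C * cexp (q * b%:C))).
  rewrite -(cintegralD _ (ic _ _ _) (ic _ _ _))// -cintegralZl//; last exact: cintegrableD.
  apply: eq_cintegral => b; rewrite inE /= in_itv /= => /andP[_ bg].
  rewrite ger0_norm ?subr_ge0// realcM -cexp_real.
  have -> : cexp (- (c3 * (g - b)))%:C = cexp (- (c3%:C * g%:C)) * cexp (c3%:C * b%:C).
    by rewrite -cexpD; congr cexp; rewrite !realcE; ring.
  have -> : cexp (p * b%:C) = cexp (c3%:C * b%:C) * cexp (eta * b%:C) by rewrite -cexpD; congr cexp; ring.
  have -> : cexp (q * b%:C) = cexp (c3%:C * b%:C) * cexp (- (eta * b%:C)) by rewrite -cexpD; congr cexp; ring.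
  by rewrite /ccosh /=; field.
have E2 : cintegral mu `[g, h] (fun b => ccosh (eta * b%:C) * (`|g - b| * expR (- (c3 * `|g - b|)))%:C) =
    - 2^-1 * cexp (c3%:C * g%:C) *
    (cintegral mu `[g, h] (fun b : R => (g - b)%:C * cexp (- p * b%:C)) +
     cintegral mu `[g, h] (fun b : R => (g - b)%:C * cexp (- q * b%:C))).
  rewrite -(cintegralD _ (ic _ _ _) (ic _ _ _))// -cintegralZl//; last exact: cintegrableD.
  apply: eq_cintegral => b; rewrite inE /= in_itv /= => /andP[gb _].
  rewrite distrC ger0_norm ?subr_ge0// realcM -cexp_real.
  have -> : cexp (- (c3 * (b - g)))%:C = cexp (c3%:C * g%:C) * cexp (- (c3%:C * b%:C)).
    by rewrite -cexpD; congr cexp; rewrite !realcE; ring.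
  have -> : cexp (- p * b%:C) = cexp (- (c3%:C * b%:C)) * cexp (- (eta * b%:C)) by rewrite -cexpD; congr cexp; ring.
  have -> : cexp (- q * b%:C) = cexp (- (c3%:C * b%:C)) * cexp (eta * b%:C) by rewrite -cexpD; congr cexp; ring.
  rewrite -[(b - g)%:C]opprK -realcN opprB.
  by rewrite /ccosh /=; field.
rewrite E1 E2 !cintegral_idM_cexp ?oppr_eq0//.
have -> : cexp (p * g%:C) = cexp (c3%:C * g%:C) * cexp (eta * g%:C) by rewrite -cexpD; congr cexp; ring.
have -> : cexp (q * g%:C) = cexp (c3%:C * g%:C) * cexp (- (eta * g%:C)) by rewrite -cexpD; congr cexp; ring.
have -> : cexp (- p * g%:C) = cexp (- (c3%:C * g%:C)) * cexp (- (eta * g%:C)) by rewrite -cexpD; congr cexp; ring.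
have -> : cexp (- q * g%:C) = cexp (- (c3%:C * g%:C)) * cexp (eta * g%:C) by rewrite -cexpD; congr cexp; ring.
have -> : cexp (p * (- h)%:C) = U by congr cexp; rewrite realcN mulrN.
have -> : cexp (q * (- h)%:C) = V by congr cexp; rewrite realcN mulrN.
have -> : cexp (- p * h%:C) = U by congr cexp; rewrite mulNr.
have -> : cexp (- q * h%:C) = V by congr cexp; rewrite mulNr.
have N := cexpNM (c3%:C * g%:C).
rewrite subrr opprK -[g - h]opprB [(- (h - g))%:C]realcN.
move: (g + h)%:C (h - g)%:C U V (cexp (eta * g%:C)) (cexp (- (eta * g%:C))) N p p0 q q0 => x y u v e e'.
move: (cexp (c3%:C * g%:C)) (cexp (- (c3%:C * g%:C))) => f f' N r r0 s s0.
(* The integrated terms at b = g carry the factor exp(c3 g) exp(- c3 g) = 1. It is inserted on the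
   other side as well, so that [field] may treat the exponentials as independent variables. *)
have -> : e / r ^+ 2 = e / r ^+ 2 * (f * f') by rewrite N mulr1.
have -> : e / s ^+ 2 = e / s ^+ 2 * (f * f') by rewrite N mulr1.
have -> : e' / r ^+ 2 = e' / r ^+ 2 * (f * f') by rewrite N mulr1.
have -> : e' / s ^+ 2 = e' / s ^+ 2 * (f * f') by rewrite N mulr1.
by field; rewrite r0 s0.
Qed.

Lemma AfunE : Afun Delta c1 c2 c3 eta = 1 + (c2 / c1)%:C *
  (p ^- 2 + q ^- 2 - (h%:C / p + p ^- 2) * U - (h%:C / q + q ^- 2) * V).
Proof.
rewrite /Afun /int_half; congr (1 + _ * _).
have -> : cintegral mu I (fun a => ccosh (eta * a%:C) * (`|a| * expR (- (c3 * `|a|)))%:C) =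
    cintegral mu I (fun b => ccosh (eta * b%:C) * (`|0 - b| * expR (- (c3 * `|0 - b|)))%:C).
  by apply: eq_cintegral => b _; rewrite sub0r normrN.
rewrite cintegral_ccosh_conv ?normr0// add0r subr0 !mulr0 oppr0 cexp0.
by move: U V => u v; field; rewrite p0 q0.
Qed.

Lemma BfunE : Bfun Delta c1 c2 c3 eta = eta ^+ 2 + (2 * (c2 / c1) - c3 ^+ 2)%:C
  - (2 * (c2 * c3 / c1))%:C * ((1 - U) / p + (1 - V) / q).
Proof. by rewrite /Bfun /int_half cintegral_ccosh_expR_norm. Qed.

(** With k a = |a| exp(- c3 |a|) one has (D^2 - c3^2)^2 k = 2 (D^2 + c3^2) delta, so this operator
    sends the left side, divided by c1, to chi(eta) cosh(eta x). An even solution is a combination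
    of cosh(c3 x) and x sinh(c3 x) / (2 c3) plus chi(eta) R(eta, x), where R and its second
    derivative vanish at 0; the data at 0 give the coefficients A and B. The proof compares closed
    forms, which is a rational identity in the exponentials. *)
Lemma ccosh_density_conv g : `|g| <= h ->
  c1%:C * ccosh (eta * g%:C) + cintegral mu I (fun b => ccosh (eta * b%:C) * (density c2 c3 (g - b))%:C) =
  c1%:C * (Afun Delta c1 c2 c3 eta * ccosh (c3%:C * g%:C)
    + Bfun Delta c1 c2 c3 eta * (g%:C * csinh (c3%:C * g%:C) / (2 * c3%:C))
    + char_fun eta * remainder_fun eta g).
Proof.
move=> gh.
have -> : cintegral mu I (fun b => ccosh (eta * b%:C) * (density c2 c3 (g - b))%:C) =
    c2%:C * cintegral mu I (fun b => ccosh (eta * b%:C) * (`|g - b| * expR (- (c3 * `|g - b|)))%:C).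
  rewrite -cintegralZl//; last first.
    apply: ccont_integrable; apply: ccontM; first exact: ccont_ccosh.
    apply: ccont_real => b; apply: (@continuous_comp _ _ _ (fun b => g - b) (fun a => `|a| * expR (- (c3 * `|a|)))).
      by apply: cvgB; [exact: cvg_cst|exact: cvg_id].
    by apply: cvgM; [exact: norm_continuous|exact: continuous_expRN_norm].
  by apply: eq_cintegral => b _; rewrite /density -mulrA realcM mulrCA.
rewrite cintegral_ccosh_conv// AfunE BfunE /remainder_fun /char_fun /ccosh /csinh !realcE.
move: (cexp (c3%:C * g%:C)) (cexp (- (c3%:C * g%:C))) (cexp (eta * g%:C)) (cexp (- (eta * g%:C))) => f f' e e'.
move: (cexp (- (p * _))) (cexp (- (q * _))) => u v.
move: c1%:C c2%:C c3%:C g%:C Delta%:C c1C c3C p0 q0 eta_c3 => C1 C2 C3 G DD C10 C30 p0' q0' Q0.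
by field; rewrite C10 C30 p0' q0' Q0.
Qed.

End Eta.

End ConvolutionFormula.

(** * The reproducing kernel *)

Section Reproducing.
Context {R : realType}.
Notation mu := (@lebesgue_measure R).
Notation T := (measurableTypeR R).
Variables (Delta c1 c2 c3 : R) (nu : {measure set T -> \bar R}).
Hypotheses (D0 : 0 < Delta) (c10 : 0 < c1) (c20 : 0 < c2) (c30 : 0 < c3).
Hypothesis small : c2 / c1 * Delta ^+ 2 <= 5 / 3.
Hypothesis nuP : is_nu Delta c1 c2 c3 nu.
Notation h := (Delta / 2).
Notation I := (`[- h, h]%classic : set T).
Implicit Types (phi psi : R -> R[i]) (f g : R[i] -> R[i]) (x : R) (z w : R[i]).

Let h0 : 0 <= h. Proof. by rewrite divr_ge0// ltW. Qed.

Let typeE : 2 * pi * h = pi * Delta :> R. Proof. by field. Qed.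

Lemma fourierD phi psi z : ccont phi -> ccont psi ->
  fourier h (fun a => phi a + psi a) z = fourier h phi z + fourier h psi z.
Proof.
move=> cphi cpsi; have ic chi : ccont chi -> _ :=
  fun cc => ccont_integrable (- h) h (ccont_fourier_integrand z cc).
rewrite /fourier -(cintegralD _ (ic _ cphi) (ic _ cpsi))//.
by apply: eq_cintegral => a _; rewrite mulrDl.
Qed.

Lemma fourierZ (k : R[i]) phi z : ccont phi ->
  fourier h (fun a => k * phi a) z = k * fourier h phi z.
Proof.
move=> cphi; rewrite /fourier -cintegralZl//; last by apply: ccont_integrable; exact: ccont_fourier_integrand.
by apply: eq_cintegral => a _; rewrite mulrA.
Qed.

Lemma inH_fourier phi phi' : (forall a, cder phi a (phi' a)) -> ccont phi' ->
  inH Delta nu (fourier h phi).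
Proof.
move=> dphi cphi'; have cphi := cder_ccont dphi.
have eF := entire_fourier h0 cphi; have cF := ccont_restrict eF.
have [C C0 HC] := fourier_decay_ex h0 dphi cphi'.
have [N HN] := nu_hat_bounded D0 c10 c20 c30 nuP.
split => //; first by rewrite -typeE; exact: exp_type_fourier.
have iv := integrable_scale (N * C ^+ 2) (@measurableT _ T) integrable_invD1sqr.
apply: (cintegrable_dom _ _ iv) => //.
  under eq_fun do rewrite normC_cabs -rmorphXn.
  apply: cmeasM; last by apply: ccont_cmeas => //; exact: (ccont_nu_hat D0 c10 c20 c30 nuP).
  apply: cmeas_real; apply: measurable_funX; apply: cmeas_cabs; exact: ccont_cmeas.
move=> x _; rewrite normC_cabs -rmorphXn cabsM cabs_real ger0_norm ?sqr_ge0// mulrC -mulrA.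
by apply: ler_pM; rewrite ?cabs_ge0 ?sqr_ge0//; exact: decay_sqr.
Qed.

Lemma inner_conj f g : inH Delta nu f -> inH Delta nu g -> inner nu f g = conjc (inner nu g f).
Proof.
move=> fH gH.
have Lf := inH_L2 D0 c10 c20 c30 nuP small fH; have Lg := inH_L2 D0 c10 c20 c30 nuP small gH.
have cf : ccont (fun x : R => f x%:C) by case: fH => ef _ _; exact: ccont_restrict.
have cg : ccont (fun x : R => g x%:C) by case: gH => eg _ _; exact: ccont_restrict.
have cnu := ccont_nu_hat D0 c10 c20 c30 nuP.
have [N HN] := nu_hat_bounded D0 c10 c20 c30 nuP.
have N0 : 0 <= N := le_trans (cabs_ge0 _) (HN 0).
have i1 : cintegrable mu setT (fun x : R => g x%:C * conjc (f x%:C) * nu_hat nu x).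
  apply: (cintegrable_dom _ _ (integrable_scale N measurableT (integrable_add measurableT Lg Lf))) => //.
    by apply: ccont_cmeas => //; apply: ccontM => //; apply: ccontM => //; exact: ccont_conj.
  move=> x _; rewrite cabsM mulrC; apply: ler_pM; rewrite ?cabs_ge0// cabsM cabs_conj.
  have := sqr_ge0 (cabs (g x%:C) - cabs (f x%:C)).
  have := mulr_ge0 (cabs_ge0 (g x%:C)) (cabs_ge0 (f x%:C)).
  move: (cabs (g x%:C)) (cabs (f x%:C)) => a b; rewrite sqrrB mulr2n; lra.
change (inner nu g f) with (cintegral mu setT (fun x : R => g x%:C * conjc (f x%:C) * nu_hat nu x)).
rewrite -(cintegral_conj measurableT i1); apply: eq_cintegral => x _.
by rewrite !conjcM Num_conjE conjcK (nu_hat_real D0 c10 c20 nuP) conjc_real; ring.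
Qed.

Variable K : R[i] -> R[i] -> R[i].
Hypothesis KP : is_reproducing_kernel Delta nu K.

Let KH w : inH Delta nu (K w). Proof. by case: (KP w). Qed.

Let KE w f : inH Delta nu f -> f w = conjc (inner nu (K w) f).
Proof. by move=> fH; have [KwH H] := KP w; rewrite (H _ fH) inner_conj. Qed.

Let K0E w : K 0 w = conjc (K w 0).
Proof. by rewrite (KE w (KH 0)); have [_ ->] := KP 0; last exact: KH. Qed.

(** The unweighted integral that [inner_fourier] leaves when the function of the space is K w. *)
Definition pairing w psi : R[i] :=
  cintegral mu setT (fun x : R => K w x%:C * conjc (fourier h psi x%:C)).

Let pairing_integrable w psi psi' : (forall a, cder psi a (psi' a)) -> ccont psi' ->
  cintegrable mu setT (fun x : R => K w x%:C * conjc (fourier h psi x%:C)).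
Proof.
move=> dpsi cpsi'; have cpsi := cder_ccont dpsi.
have Lf := inH_L2 D0 c10 c20 c30 nuP small (KH w).
have mf : cmeas setT (fun x : T => K w x%:C).
  by apply: ccont_cmeas => //; apply: ccont_restrict; case: (KH w).
have mP : cmeas setT (fun x : T => conjc (fourier h psi x%:C)).
  by apply: cmeas_conj; apply: ccont_cmeas => //; apply: ccont_restrict; exact: entire_fourier.
have [C C0 HC] := fourier_decay_ex h0 dpsi cpsi'.
have iv := integrable_scale (C ^+ 2) (@measurableT _ T) integrable_invD1sqr.
have dec x : cabs (conjc (fourier h psi x%:C)) <= C / (1 + `|x|) by rewrite cabs_conj.
by have [_ iP] := integrable_mul_L2 mf mP Lf iv (fun x => decay_sqr C0 (dec x)).
Qed.

(** [sinc_reproducing] with s = 2 pi, for which its constant is 1. *)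
Lemma pairing_one w : pairing w (fun=> 1) = K w 0.
Proof.
have [ef gf _] := KH w; have Lf := inH_L2 D0 c10 c20 c30 nuP small (KH w).
have hp : 0 < h by rewrite divr_gt0.
have p2 : 0 < 2 * pi :> R by rewrite mulr_gt0 ?pi_gt0.
have tau0 : 0 < pi * Delta by rewrite mulr_gt0 ?pi_gt0.
have tauh : pi * Delta <= 2 * pi * h by rewrite typeE.
have := sinc_reproducing ef gf tau0 Lf p2 hp tauh.
rewrite divff ?gt_eqF// mulr1 => <-; apply: eq_cintegral => x _; congr (_ * _).
rewrite fourier_windowed.
have [M M0 HM] := windowed_bounded h (ccont_cst (1 : R[i])).
rewrite (trig_conj _ _ (cmeas_windowed h (ccont_cst (1 : R[i]))) HM (@windowed_out _ h _)) opprK.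
apply: eq_cintegral => a _; congr (_ * _).
by rewrite /windowed /exp_profile mul0r oppr0 expR0 mul1r mulr1 conjc_real.
Qed.

(** By [fourier_decay] the transform of psi is controlled by bounds of psi and its derivative on the
    window, and K w is square integrable. That [N] precedes psi is what later makes the estimates
    uniform in eta. *)
Lemma pairing_le w : exists2 N, 0 <= N & forall psi psi' M, (forall a, cder psi a (psi' a)) -> ccont psi' ->
  (forall a, `|a| <= h -> cabs (psi a) <= M) -> (forall a, `|a| <= h -> cabs (psi' a) <= M) ->
  cabs (pairing w psi) <= N * M.
Proof.
have Lf := inH_L2 D0 c10 c20 c30 nuP small (KH w).
pose C0 : R := 2 * h + (2 + 2 * h) / (2 * pi).
have p2 : 0 < 2 * pi :> R by rewrite mulr_gt0 ?pi_gt0.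
have hh := mulr_ge0 (ler0n R 2) h0.
have C00 : 0 <= C0 := addr_ge0 hh (divr_ge0 (addr_ge0 (ler0n R 2) hh) (ltW p2)).
have i2 := integrable_add measurableT Lf (integrable_scale (1 ^+ 2) (@measurableT _ T) integrable_invD1sqr).
pose J := Rintegral mu setT (fun x : R => cabs (K w x%:C) ^+ 2 + 1 ^+ 2 * (1 + x ^+ 2)^-1).
have J0 : 0 <= J.
  apply: Rintegral_ge0 => x _; rewrite addr_ge0 ?sqr_ge0// mulr_ge0 ?sqr_ge0// invr_ge0.
  by rewrite addr_ge0 ?sqr_ge0.
exists (C0 * J); first exact: mulr_ge0.
move=> psi psi' M dpsi cpsi' H1 H2.
have M0 : 0 <= M by apply: le_trans (cabs_ge0 _) (H1 0 _); rewrite normr0.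
have CM0 : 0 <= C0 * M by rewrite mulr_ge0.
have -> : C0 * J * M = Rintegral mu setT (fun x : R => (C0 * M) * (cabs (K w x%:C) ^+ 2 + 1 ^+ 2 * (1 + x ^+ 2)^-1)).
  by rewrite [RHS]RintegralZl// mulrAC.
apply: cabs_cintegral => //.
- exact: cintegrable_meas (pairing_integrable w dpsi cpsi').
- exact: integrable_scale.
- move=> x _; rewrite cabsM cabs_conj.
  have dec := fourier_decay h0 x dpsi cpsi' H1 H2.
  have x1 : 0 < 1 + `|x| by rewrite ltr_wpDr.
  have dec1 : cabs (fourier h psi x%:C) <= (C0 * M) * (1 / (1 + `|x|)).
    rewrite [leRHS](_ : _ = (2 * h * M + (2 * M + 2 * h * M) / (2 * pi)) / (1 + `|x|))//.
    have y0 : 1 + `|x| != 0 by rewrite gt_eqF.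
    have pi0 : pi != 0 :> R by rewrite gt_eqF ?pi_gt0.
    by rewrite /C0; move: (1 + `|x|) y0 (pi : R) pi0 => y y0 P P0; field; rewrite y0 P0.
  apply: le_trans (ler_wpM2l (cabs_ge0 _) dec1) _; rewrite mulrCA; apply: ler_wpM2l => //.
  have d2 : cabs (1 / (1 + `|x|))%:C <= 1 / (1 + `|x|) by rewrite cabs_real ger0_norm// divr_ge0// ltW.
  have := decay_sqr ler01 d2; rewrite cabs_real ger0_norm; last by rewrite divr_ge0// ltW.
  have := sqr_ge0 (cabs (K w x%:C) - 1 / (1 + `|x|)).
  have := mulr_ge0 (cabs_ge0 (K w x%:C)) (divr_ge0 ler01 (ltW x1)).
  move: (cabs (K w x%:C)) (1 / (1 + `|x|)) => a b ab; rewrite sqrrB mulr2n.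
  by move: (1 ^+ 2 * _) => v; lra.
Qed.

(** T phi is evaluated at w through the kernel, and [inner_fourier] is applied to K w: the constant
    t contributes t K(0, w), while psi is the error. For t = 1 and psi = 0 this says K(0, .) = T
    phi. *)
Lemma fourier_kernel phi phi' psi psi' (t : R[i]) w :
  (forall a, cder phi a (phi' a)) -> ccont phi' -> (forall a, cder psi a (psi' a)) -> ccont psi' ->
  (forall a, `|a| <= h ->
    c1%:C * phi a + cintegral mu I (fun b => phi b * (density c2 c3 (a - b))%:C) = t + psi a) ->
  fourier h phi w = t * K 0 w + conjc (pairing w psi).
Proof.
move=> dphi cphi' dpsi cpsi' E.
have dP a : cder (fun a => t * 1 + psi a) a (t * 0 + psi' a).
  exact: cderD (cderZ t (cder_cst 1 a)) (dpsi a).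
have cP' : ccont (fun a => t * 0 + psi' a) by apply: ccontD => //; exact: ccont_cst.
have E' a : `|a| <= h -> c1%:C * phi a + cintegral mu I (fun b => phi b * (density c2 c3 (a - b))%:C) = t * 1 + psi a.
  by rewrite mulr1; exact: E.
rewrite (KE w (inH_fourier dphi cphi')).
rewrite (inner_fourier D0 c10 c20 c30 (cder_ccont dphi) nuP dphi cphi' dP cP' E' small (KH w)).
have c1c := ccont_cst (1 : R[i]).
have d1 a : cder (fun=> 1) a 0 := cder_cst (1 : R[i]) a.
have i1 := pairing_integrable w d1 (ccont_cst 0).
have i2 := pairing_integrable w dpsi cpsi'.
have -> : cintegral mu setT (fun x : R => K w x%:C * conjc (fourier h (fun a => t * 1 + psi a) x%:C)) =
    conjc t * K w 0 + pairing w psi.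
  rewrite -(pairing_one w) /pairing -(cintegralZl _ measurableT i1).
  rewrite -(cintegralD measurableT (cintegrableZl _ measurableT i1) i2); apply: eq_cintegral => x _.
  rewrite (@fourierD (fun=> t * 1) psi); [|exact: ccont_cst|exact: cder_ccont dpsi].
  by rewrite (fourierZ t _ c1c) conjcD conjcM; ring.
by rewrite conjcD conjcM conjcK K0E.
Qed.

End Reproducing.

(** * Error bounds for combinations of hyperbolic cosines *)

Section KernelCombination.
Context {R : realType}.
Notation mu := (@lebesgue_measure R).
Notation T := (measurableTypeR R).
Variables (Delta c1 c2 c3 : R) (nu : {measure set T -> \bar R}).
Hypotheses (D0 : 0 < Delta) (c10 : 0 < c1) (c20 : 0 < c2) (c30 : 0 < c3).
Hypothesis small : c2 / c1 * Delta ^+ 2 <= 5 / 3.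
Hypothesis nuP : is_nu Delta c1 c2 c3 nu.
Variable K : R[i] -> R[i] -> R[i].
Hypothesis KP : is_reproducing_kernel Delta nu K.
Notation h := (Delta / 2).
Notation I := (`[- h, h]%classic : set T).
Notation A := (Afun Delta c1 c2 c3).
Notation B := (Bfun Delta c1 c2 c3).
Notation C := (Cfun Delta).
Notation chi := (char_fun c1 c2 c3).
Notation m := ((mu_coef c1 c2 c3)%:C : R[i]).
Implicit Types (a b : R) (eta w : R[i]).

Let h0 : 0 <= h. Proof. by rewrite divr_ge0// ltW. Qed.

Let Q eta : R[i] := eta ^+ 2 - c3%:C ^+ 2.
Let ch a : R[i] := ccosh (c3%:C * a%:C).
Let ch' a : R[i] := c3%:C * csinh (c3%:C * a%:C).
Let sg a : R[i] := a%:C * csinh (c3%:C * a%:C) / (2 * c3%:C).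
Let sg' a : R[i] := (csinh (c3%:C * a%:C) + a%:C * (c3%:C * ccosh (c3%:C * a%:C))) / (2 * c3%:C).
Let rm eta a : R[i] := remainder_fun c3 eta a.
Let rm' eta a : R[i] := (eta * csinh (eta * a%:C) - ch' a - Q eta * sg' a) / Q eta ^+ 2.

Let c3C : c3%:C != 0 :> R[i]. Proof. by rewrite realc_eq0 gt_eqF. Qed.
Let c1C : c1%:C != 0 :> R[i]. Proof. by rewrite realc_eq0 gt_eqF. Qed.

Let dch a : cder ch a (ch' a). Proof. exact: cder_ccosh. Qed.

Let dsg a : cder sg a (sg' a).
Proof.
have H := cderM (cderM (cder_id a) (cder_csinh c3%:C a)) (cder_cst (2 * c3%:C)^-1 a).
by apply: cder_eq H _; rewrite mulr0 addr0 mul1r.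
Qed.

Let rmE eta a : rm eta a = (ccosh (eta * a%:C) - ch a - Q eta * sg a) / Q eta ^+ 2.
Proof. by rewrite /rm /remainder_fun /sg !mulrA. Qed.

Let drm eta a : cder (rm eta) a (rm' eta a).
Proof.
have -> : rm eta = fun a => (ccosh (eta * a%:C) - ch a - Q eta * sg a) / Q eta ^+ 2.
  by apply/funext => b; exact: rmE.
have H := cderM (cderB (cderB (cder_ccosh eta a) (dch a)) (cderZ (Q eta) (dsg a))) (cder_cst (Q eta ^- 2) a).
by apply: cder_eq H _; rewrite mulr0 addr0.
Qed.

Let cch' : ccont ch'. Proof. by apply: ccontM; [exact: ccont_cst|exact: ccont_csinh]. Qed.

Let csg' : ccont sg'.
Proof.
apply: ccontM; last exact: ccont_cst.
apply: ccontD; first exact: ccont_csinh.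
apply: ccontM; first exact: cder_ccont cder_id.
by apply: ccontM; [exact: ccont_cst|exact: ccont_ccosh].
Qed.

Let crm' eta : ccont (rm' eta).
Proof.
apply: ccontM; last exact: ccont_cst.
apply: ccontB; last by apply: ccontM => //; exact: ccont_cst.
by apply: ccontB => //; apply: ccontM; [exact: ccont_cst|exact: ccont_csinh].
Qed.

Let cexp_bound eta a L : cabs eta <= L -> `|a| <= h ->
  cabs (cexp (eta * a%:C)) <= expR (L * h) /\ cabs (cexp (- (eta * a%:C))) <= expR (L * h).
Proof.
move=> eL ah; have k : cabs (eta * a%:C) <= L * h.
  by rewrite cabsM cabs_real; apply: ler_pM; rewrite ?cabs_ge0.
by split; apply: le_trans (cabs_cexp_le _) _; rewrite ler_expR ?cabsN.
Qed.

Let half_le (x y : R[i]) X : cabs x <= X -> cabs y <= X -> cabs ((x + y) / 2) <= X.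
Proof.
move=> xX yX; rewrite cabsM cabsV -realc_nat cabs_real normr_nat ler_pdivrMr//.
by apply: le_trans (cabsD _ _) _; lra.
Qed.

Lemma cabs_ccosh_le eta a L : cabs eta <= L -> `|a| <= h -> cabs (ccosh (eta * a%:C)) <= expR (L * h).
Proof. by move=> eL ah; have [k1 k2] := cexp_bound eL ah; exact: half_le. Qed.

Lemma cabs_csinh_le eta a L : cabs eta <= L -> `|a| <= h -> cabs (csinh (eta * a%:C)) <= expR (L * h).
Proof. by move=> eL ah; have [k1 k2] := cexp_bound eL ah; apply: half_le => //; rewrite cabsN. Qed.

Let base_bound : exists2 M, 0 <= M & forall a, `|a| <= h ->
  [/\ cabs (ch a) <= M, cabs (ch' a) <= M, cabs (sg a) <= M & cabs (sg' a) <= M].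
Proof.
have [M1 [M10 H1]] := ccont_bounded (- h) h (cder_ccont dch).
have [M2 [M20 H2]] := ccont_bounded (- h) h cch'.
have [M3 [M30 H3]] := ccont_bounded (- h) h (cder_ccont dsg).
have [M4 [M40 H4]] := ccont_bounded (- h) h csg'.
exists (M1 + M2 + M3 + M4); first by rewrite !addr_ge0.
move=> a; rewrite ler_norml => ah.
by have := H1 _ ah; have := H2 _ ah; have := H3 _ ah; have := H4 _ ah; split; lra.
Qed.

(** The division by Q(eta)^2 is harmless where |Q(eta)| >= k; the bound is then common to all eta
    with |eta| <= L, as the passage to a double root requires. *)
Let rm_bound L k : 0 < k -> exists2 M, 0 <= M & forall eta a, cabs eta <= L -> k <= cabs (Q eta) -> `|a| <= h ->
  cabs (rm eta a) <= M /\ cabs (rm' eta a) <= M.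
Proof.
move=> k0; have [M M0 HM] := base_bound.
have [L0|L0] := ltP L 0.
  by exists 0 => // eta a eL; have := le_trans (cabs_ge0 _) eL; rewrite leNgt L0.
pose X := expR (L * h); have X0 : 0 <= X := expR_ge0 _.
pose q := L ^+ 2 + c3 ^+ 2; have q0 : 0 <= q by rewrite addr_ge0 ?sqr_ge0.
have LX := mulr_ge0 L0 X0; have qM := mulr_ge0 q0 M0.
exists ((X + L * X + M + q * M) / k ^+ 2).
  by rewrite divr_ge0 ?sqr_ge0// !addr_ge0.
move=> eta a eL kQ ah; have [h1 h2 h3 h4] := HM a ah.
have Qq : cabs (Q eta) <= q.
  apply: le_trans (cabsB _ _) _; rewrite !cabsX cabs_real (gtr0_norm c30); apply: lerD => //.
  by rewrite lerXn2r// nnegrE ?cabs_ge0.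
have gen (x y z : R[i]) : cabs x <= X + L * X -> cabs y <= M -> cabs z <= M ->
    cabs ((x - y - Q eta * z) / Q eta ^+ 2) <= (X + L * X + M + q * M) / k ^+ 2.
  move=> hx hy hz; rewrite cabsM cabsV cabsX.
  apply: ler_pM; rewrite ?cabs_ge0 ?invr_ge0 ?exprn_ge0 ?cabs_ge0//.
    apply: le_trans (cabsB _ _) _; apply: lerD.
      by apply: le_trans (cabsB _ _) _; exact: lerD.
    by rewrite cabsM; apply: ler_pM; rewrite ?cabs_ge0.
  rewrite lef_pV2 ?posrE ?exprn_gt0//; last exact: lt_le_trans kQ.
  by rewrite lerXn2r// nnegrE ?cabs_ge0// ltW.
split.
  rewrite rmE; apply: gen => //; apply: le_trans (cabs_ccosh_le eL ah) _.
  by rewrite lerDl.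
apply: gen => //; rewrite cabsM; apply: (@le_trans _ _ (L * X)); last by rewrite lerDr.
by apply: ler_pM; rewrite ?cabs_ge0// cabs_csinh_le.
Qed.

Lemma ccosh0 (z : R[i]) : ccosh (0 * z) = 1.
Proof. by rewrite /ccosh mul0r oppr0 cexp0; field. Qed.

(** For the combination a1 cosh(e1 x) + a2 cosh(e2 x) + t m, the two defects are the coefficients of
    cosh(c3 x) and x sinh(c3 x) / (2 c3) in its convolution with nu, divided by c1, once the target
    t is split off. Both vanish for the Cramer solution with t = 1; the case t = 0 serves the
    determinant. *)
Definition cosh_defect (e1 e2 a1 a2 t : R[i]) : R[i] := a1 * A e1 + a2 * A e2 + t * (m * A 0 - (c1^-1)%:C).
Definition sinh_defect (e1 e2 a1 a2 t : R[i]) : R[i] := a1 * B e1 + a2 * B e2 + t * (m * B 0 + (c3 ^+ 2 / c1)%:C).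

Let window_formula (e1 e2 a1 a2 t : R[i]) a : Q e1 != 0 -> Q e2 != 0 -> `|a| <= h ->
  let phi b := a1 * ccosh (e1 * b%:C) + a2 * ccosh (e2 * b%:C) + t * m * 1 in
  c1%:C * phi a + cintegral mu I (fun b => phi b * (density c2 c3 (a - b))%:C) =
  t + c1%:C * (cosh_defect e1 e2 a1 a2 t * ch a + sinh_defect e1 e2 a1 a2 t * sg a +
               a1 * chi e1 * rm e1 a + a2 * chi e2 * rm e2 a).
Proof.
move=> Q1 Q2 ah phi.
have ic eta : cintegrable mu I (fun b => ccosh (eta * b%:C) * (density c2 c3 (a - b))%:C).
  apply: ccont_integrable; apply: ccontM; first exact: ccont_ccosh.
  apply: ccont_real => b; apply: (@continuous_comp _ _ _ (fun b => a - b) (density c2 c3)).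
    by apply: cvgB; [exact: cvg_cst|exact: cvg_id].
  exact: continuous_density.
pose Z eta := cintegral mu I (fun b => ccosh (eta * b%:C) * (density c2 c3 (a - b))%:C).
have -> : cintegral mu I (fun b => phi b * (density c2 c3 (a - b))%:C) =
    a1 * Z e1 + a2 * Z e2 + t * m * Z 0.
  have mI : measurable I by [].
  rewrite /Z -(cintegralZl a1 mI (ic e1)) -(cintegralZl a2 mI (ic e2)) -(cintegralZl (t * m) mI (ic 0)).
  have j1 := cintegrableZl a1 mI (ic e1); have j2 := cintegrableZl a2 mI (ic e2).
  rewrite -(cintegralD mI j1 j2) -(cintegralD mI (cintegrableD mI j1 j2) (cintegrableZl (t * m) mI (ic 0))).
  by apply: eq_cintegral => b _; rewrite /phi ccosh0; ring.
have Q0 : Q 0 != 0 by rewrite /Q expr0n /= sub0r oppr_eq0 expf_neq0.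
have E eta (q : Q eta != 0) := ccosh_density_conv c2 D0 c10 c30 q ah.
have := E _ Q1; have := E _ Q2; have := E _ Q0.
rewrite -/(Z e1) -/(Z e2) -/(Z 0) -/(ch a) -/(sg a) -/(rm e1 a) -/(rm e2 a) -/(rm 0 a) ccosh0.
move=> E0 E2 E1.
have -> : c1%:C * phi a + (a1 * Z e1 + a2 * Z e2 + t * m * Z 0) =
    a1 * (c1%:C * ccosh (e1 * a%:C) + Z e1) + a2 * (c1%:C * ccosh (e2 * a%:C) + Z e2) + t * m * (c1%:C * 1 + Z 0).
  by rewrite /phi; ring.
rewrite {}E0 {}E1 {}E2.
have den0 : 2 * c2 + c3 ^+ 2 * c1 != 0 by rewrite gt_eqF// addr_gt0 ?mulr_gt0 ?exprn_gt0.
(* The origin of mu: it makes m c1 chi(0) = c3^4 = Q(0)^2, so the remainder of the constant function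
   enters with its bare numerator. This supplies the target 1 and the terms in 1 / c1 and c3^2 / c1
   of the two defects. *)
have key : m * c1%:C * chi 0 * rm 0 a = 1 - ch a + c3%:C ^+ 2 * sg a.
  have QE : Q 0 = - c3%:C ^+ 2 by rewrite /Q expr0n /= sub0r.
  have chiE : chi 0 = (c3 ^+ 2 * (2 * (c2 / c1) + c3 ^+ 2))%:C.
    by rewrite /char_fun !expr0n /= mulr0 !add0r.
  rewrite rmE ccosh0 QE chiE /mu_coef.
  have den1 : 2 * c2%:C + c3%:C ^+ 2 * c1%:C != 0 :> R[i] by rewrite -!realcE realc_eq0.
  rewrite !realcE; move: c1%:C c2%:C c3%:C c1C c3C den1 => C1 C2 C3 n1 n3 nd.
  by field; rewrite n1 n3 nd.
rewrite /cosh_defect /sinh_defect realcV [(c3 ^+ 2 / c1)%:C]realcM realcX realcV.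
have -> : t * m * (c1%:C * (A 0 * ch a + B 0 * sg a + chi 0 * rm 0 a)) =
    t * m * c1%:C * (A 0 * ch a + B 0 * sg a) + t * (m * c1%:C * chi 0 * rm 0 a) by ring.
rewrite key; move: (A 0) (B 0) (A e1) (B e1) (A e2) (B e2) (chi e1) (chi e2) (rm e1 a) (rm e2 a) (ch a) (sg a) m.
move=> A0 B0 A1 B1 A2 B2 x1 x2 r1 r2 u v M.
by move: c1%:C c3%:C c1C => C1 C3 n1; field.
Qed.

(** [fourier_kernel] applied to the combination: the error is a sum of uniformly bounded functions
    weighted by the two defects and by a1 chi(e1), a2 chi(e2). As [N] precedes all these parameters,
    exact roots and nearby points are treated alike. *)
Theorem kernel_combination w L k : 0 < k -> exists2 N : R, 0 <= N & forall e1 e2 a1 a2 t : R[i],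
  cabs e1 <= L -> cabs e2 <= L -> k <= cabs (Q e1) -> k <= cabs (Q e2) ->
  cabs (a1 * C e1 w + a2 * C e2 w + t * m * sinc Delta w - t * K 0 w) <=
  N * (cabs (cosh_defect e1 e2 a1 a2 t) + cabs (sinh_defect e1 e2 a1 a2 t) +
       cabs (a1 * chi e1) + cabs (a2 * chi e2)).
Proof.
move=> k0; have [N N0 HN] := pairing_le D0 c10 c20 c30 small nuP KP w.
have [M M0 HM] := base_bound; have [M' M'0 HM'] := rm_bound L k0.
exists (N * (c1 * (M + M'))); first by rewrite !mulr_ge0 ?addr_ge0// ltW.
move=> e1 e2 a1 a2 t L1 L2 k1 k2.
have Q1 : Q e1 != 0 by rewrite -cabs_gt0 (lt_le_trans k0).
have Q2 : Q e2 != 0 by rewrite -cabs_gt0 (lt_le_trans k0).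
set x := cosh_defect e1 e2 a1 a2 t; set y := sinh_defect e1 e2 a1 a2 t.
pose phi b := a1 * ccosh (e1 * b%:C) + a2 * ccosh (e2 * b%:C) + t * m * 1.
pose phi' b := a1 * (e1 * csinh (e1 * b%:C)) + a2 * (e2 * csinh (e2 * b%:C)) + t * m * 0.
pose psi b := c1%:C * (x * ch b + y * sg b + a1 * chi e1 * rm e1 b + a2 * chi e2 * rm e2 b).
pose psi' b := c1%:C * (x * ch' b + y * sg' b + a1 * chi e1 * rm' e1 b + a2 * chi e2 * rm' e2 b).
have dphi b : cder phi b (phi' b).
  exact: cderD (cderD (cderZ a1 (cder_ccosh e1 b)) (cderZ a2 (cder_ccosh e2 b))) (cderZ (t * m) (cder_cst 1 b)).
have cZ (z : R[i]) (f : R -> R[i]) : ccont f -> ccont (fun b => z * f b).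
  by move=> cf; apply: ccontM => //; exact: ccont_cst.
have cphi' : ccont phi'.
  apply: ccontD; last exact: ccont_cst.
  by apply: ccontD; apply: (cZ); apply: (cZ); exact: ccont_csinh.
have dpsi b : cder psi b (psi' b).
  apply: cderZ; apply: cderD (cderZ _ (drm e2 b)); apply: cderD (cderZ _ (drm e1 b)).
  exact: cderD (cderZ x (dch b)) (cderZ y (dsg b)).
have cpsi' : ccont psi'.
  apply: (cZ); apply: ccontD (cZ _ _ (crm' e2)); apply: ccontD (cZ _ _ (crm' e1)).
  exact: ccontD (cZ x _ cch') (cZ y _ csg').
have W a (ah : `|a| <= h) := window_formula a1 a2 t Q1 Q2 ah.
have FE : fourier h phi w = a1 * C e1 w + a2 * C e2 w + t * m * sinc Delta w.
  rewrite !(Cfun_fourier D0) (sinc_fourier D0).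
  have cc eta := ccont_ccosh eta.
  rewrite /phi (@fourierD _ Delta (fun b => a1 * ccosh (e1 * b%:C) + a2 * ccosh (e2 * b%:C)) (fun=> t * m * 1)).
  - rewrite (@fourierD _ Delta (fun b => a1 * ccosh (e1 * b%:C)) (fun b => a2 * ccosh (e2 * b%:C))); [|exact: cZ..].
    by rewrite (fourierZ Delta a1 w (cc e1)) (fourierZ Delta a2 w (cc e2)) (fourierZ Delta (t * m) w (ccont_cst 1)).
  - by apply: ccontD; exact: (cZ).
  - exact: ccont_cst.
rewrite -FE (fourier_kernel D0 c10 c20 c30 small nuP KP w dphi cphi' dpsi cpsi' W).
rewrite addrAC subrr add0r cabs_conj -mulrA.
set S := (_ + _ + _ + _ : R).
have bnd (u1 u2 u3 u4 : R[i]) : cabs u1 <= M -> cabs u2 <= M -> cabs u3 <= M' -> cabs u4 <= M' ->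
    cabs (c1%:C * (x * u1 + y * u2 + a1 * chi e1 * u3 + a2 * chi e2 * u4)) <= c1 * (M + M') * S.
  move=> b1 b2 b3 b4; rewrite cabsM cabs_real (gtr0_norm c10) -[leRHS]mulrA; apply: ler_wpM2l; first exact: ltW.
  have g (z u : R[i]) : cabs u <= M + M' -> cabs (z * u) <= (M + M') * cabs z.
    by move=> uM; rewrite cabsM mulrC; apply: ler_wpM2r => //; exact: cabs_ge0.
  rewrite /S !mulrDr; do 3 (apply: le_trans (cabsD _ _) _; apply: lerD; last by apply: g; lra).
  by apply: g; lra.
apply: (HN psi psi' _ dpsi cpsi') => a ah; have [h1 h2 h3 h4] := HM a ah.
  by have [r1 _] := HM' e1 a L1 k1 ah; have [r2 _] := HM' e2 a L2 k2 ah; exact: bnd.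
by have [_ r1] := HM' e1 a L1 k1 ah; have [_ r2] := HM' e2 a L2 k2 ah; exact: bnd.
Qed.

End KernelCombination.

(** * The determinant and the kernel formula *)

Section Separation.
Context {R : realType}.
Notation mu := (@lebesgue_measure R).
Notation T := (measurableTypeR R).
Implicit Types (eta w z : R[i]).

Lemma cexp_2pi_nat (n : nat) (x : R) : cexp ('i * (x + 2 * pi * n%:R)%:C) = cexp ('i * x%:C).
Proof.
have -> : x + 2 * pi * n%:R = x + pi *+ 2 *+ n by rewrite -[pi *+ 2 *+ n]mulr_natr -[pi *+ 2]mulr_natr; ring.
by rewrite !cexp_i !(periodicn (@cosD2pi R)) !(periodicn (@sinD2pi R)).
Qed.

Lemma cexp_ipihalf : cexp ('i * (pi / 2)%:C) = ('i : R[i])%R.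
Proof. by rewrite cexp_i cos_pihalf sin_pihalf. Qed.

(* Eliminating the unknown ratio [b * s1 / (a * s)] between two nodes. *)
Lemma two_point (L t1 t2 : R) (k1 k2 : R[i]) : 0 <= L -> L ^+ 2 < t1 -> L ^+ 2 < t2 -> t1 != t2 ->
  k1 != 0 -> k2 != 0 -> exists2 N : R, 0 <= N & forall (e e1 a b s s1 : R[i]) (E : R),
  cabs e <= L -> cabs e1 <= L ->
  cabs (a * (k1 * s / (t1%:C + e ^+ 2)) - b * (k1 * s1 / (t1%:C + e1 ^+ 2))) <= E ->
  cabs (a * (k2 * s / (t2%:C + e ^+ 2)) - b * (k2 * s1 / (t2%:C + e1 ^+ 2))) <= E ->
  cabs a * cabs s * cabs (e ^+ 2 - e1 ^+ 2) <= N * E.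
Proof.
move=> L0 Lt1 Lt2 t12 k10 k20; have L2 := sqr_ge0 L.
pose X := t1 + t2 + L ^+ 2; pose G := (cabs k1)^-1 + (cabs k2)^-1.
have t10 := le_lt_trans L2 Lt1; have t20 := le_lt_trans L2 Lt2.
have X0 : 0 <= X by rewrite /X; lra.
have G0 : 0 <= G by rewrite addr_ge0 ?invr_ge0 ?cabs_ge0.
have d0 : 0 < `|t1 - t2| by rewrite normr_gt0 subr_eq0.
have W0 : 0 <= X * (2 * (X ^+ 2 * G)) + `|t1 - t2| * (X ^+ 2 * G).
  by rewrite addr_ge0 ?mulr_ge0 ?sqr_ge0.
exists ((X * (2 * (X ^+ 2 * G)) + `|t1 - t2| * (X ^+ 2 * G)) / `|t1 - t2|).
  exact: divr_ge0 W0 (ltW d0).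
move=> e e1 a b s s1 E eL e1L H1 H2.
have E0 := le_trans (cabs_ge0 _) H1.
have sq (z : R[i]) : cabs z <= L -> cabs (z ^+ 2) <= L ^+ 2.
  by move=> zL; rewrite cabsX lerXn2r// nnegrE ?cabs_ge0.
have up t (z : R[i]) : 0 < t -> t <= t1 + t2 -> cabs z <= L -> cabs (t%:C + z ^+ 2) <= X.
  move=> t0 tt zL; apply: le_trans (cabsD _ _) _; rewrite cabs_real gtr0_norm//.
  by have := sq z zL; rewrite /X; lra.
have nz t (z : R[i]) : L ^+ 2 < t -> cabs z <= L -> t%:C + z ^+ 2 != 0.
  move=> Lt zL; rewrite addr_eq0; apply/eqP => tz.
  have := sq z zL; rewrite -cabsN -tz cabs_real => h.
  by have := le_lt_trans (le_trans (ler_norm _) h) Lt; rewrite ltxx.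
pose Tj (t : R) := a * s * (t%:C + e1 ^+ 2) - b * s1 * (t%:C + e ^+ 2).
have TE t (k : R[i]) : L ^+ 2 < t -> t <= t1 + t2 -> k != 0 -> (cabs k)^-1 <= G ->
    cabs (a * (k * s / (t%:C + e ^+ 2)) - b * (k * s1 / (t%:C + e1 ^+ 2))) <= E ->
    cabs (Tj t) <= X ^+ 2 * G * E.
  move=> Lt tt k0 kG; set v := (_ - _ : R[i]) => hv.
  have -> : Tj t = (t%:C + e ^+ 2) * (t%:C + e1 ^+ 2) * k^-1 * v.
    by rewrite /v /Tj; have := nz t e Lt eL; have := nz t e1 Lt e1L => n1 n2; field; rewrite n1 n2 k0.
  rewrite 3!cabsM cabsV; apply: ler_pM => //; rewrite ?cabs_ge0 ?mulr_ge0 ?cabs_ge0 ?invr_ge0 ?cabs_ge0//.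
  apply: ler_pM; rewrite ?mulr_ge0 ?invr_ge0 ?cabs_ge0// expr2.
  have t0 := le_lt_trans L2 Lt.
  by apply: ler_pM; rewrite ?cabs_ge0//; apply: up.
have T1 : cabs (Tj t1) <= X ^+ 2 * G * E.
  by apply: (TE t1 k1 Lt1 _ k10 _ H1); [lra|rewrite lerDl invr_ge0 cabs_ge0].
have T2 : cabs (Tj t2) <= X ^+ 2 * G * E.
  by apply: (TE t2 k2 Lt2 _ k20 _ H2); [lra|rewrite lerDr invr_ge0 cabs_ge0].
rewrite [leRHS]mulrAC ler_pdivlMr// -!cabsM -cabs_real -cabsM.
(* The values of the affine function [Tj] at the two nodes are combined so that the terms in b s1
   cancel. *)
have -> : a * s * (e ^+ 2 - e1 ^+ 2) * (t1 - t2)%:C =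
    (t2%:C + e ^+ 2) * (Tj t1 - Tj t2) - (t1 - t2)%:C * Tj t2.
  by rewrite realcB /Tj; ring.
apply: le_trans (cabsB _ _) _; rewrite [leRHS]mulrDl (cabsM (t2%:C + _)) (cabsM (t1 - t2)%:C); apply: lerD.
  rewrite -[leRHS]mulrA; apply: ler_pM; rewrite ?cabs_ge0//; first by apply: up; lra.
  by apply: le_trans (cabsB _ _) _; lra.
by rewrite -[leRHS]mulrA; apply: ler_wpM2l => //; exact: cabs_ge0.
Qed.

Variables (Delta c1 c2 c3 : R) (nu : {measure set T -> \bar R}).
Hypotheses (D0 : 0 < Delta) (c10 : 0 < c1) (c20 : 0 < c2) (c30 : 0 < c3).
Hypothesis small : c2 / c1 * Delta ^+ 2 <= 5 / 3.
Hypothesis nuP : is_nu Delta c1 c2 c3 nu.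
Variable K : R[i] -> R[i] -> R[i].
Hypothesis KP : is_reproducing_kernel Delta nu K.
Notation h := (Delta / 2).
Notation A := (Afun Delta c1 c2 c3).
Notation B := (Bfun Delta c1 c2 c3).
Notation C := (Cfun Delta).
Notation chi := (char_fun c1 c2 c3).
Notation D := (kernel_denom Delta c1 c2 c3).
Notation m := ((mu_coef c1 c2 c3)%:C : R[i]).
Notation Q eta := (eta ^+ 2 - c3%:C ^+ 2).

(** Up to a nonzero factor independent of eta, the numerator of C(eta, x) at real x with cos(pi
    Delta x) = 1; [cosh_value] plays the same part where sin(pi Delta x) = 1. *)
Definition sinh_value eta : R[i] := 2 * eta * csinh (h%:C * eta).
Definition cosh_value eta : R[i] := ccosh (h%:C * eta).

Let freq (x : R) : R := 4 * pi ^+ 2 * x ^+ 2.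

Let freqE x : (freq x)%:C = 4 * pi%:C ^+ 2 * x%:C ^+ 2 :> R[i].
Proof. by rewrite /freq (realcM (4 * pi ^+ 2)) (realcM 4) !realcX (realc_nat 4). Qed.

(** The neutral [0 +] and [1 *] are kept so that the statement fits [cexp_2pi_nat] and
    [two_point]. *)
Lemma Cfun_node_even (n : nat) (x : R) eta : pi * Delta * x = 0 + 2 * pi * n%:R ->
  (freq x)%:C + eta ^+ 2 != 0 ->
  C eta x%:C = 1 * sinh_value eta / ((freq x)%:C + eta ^+ 2).
Proof.
move=> xE; rewrite freqE => d0.
have E : cexp ('i * ((pi * Delta)%:C * x%:C)) = 1.
  by rewrite -realcM xE cexp_2pi_nat mulr0 cexp0.
rewrite /Cfun (negbTE d0) /Cfun_quot; congr (_ / _).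
rewrite /csin /ccos cexpN E invr1 subrr mul0r mulr0 mul0r add0r mul1r /sinh_value.
by move: (csinh _) => s; field.
Qed.

Lemma Cfun_node_odd (n : nat) (x : R) eta : pi * Delta * x = pi / 2 + 2 * pi * n%:R ->
  (freq x)%:C + eta ^+ 2 != 0 ->
  C eta x%:C = (4 * pi * x)%:C * cosh_value eta / ((freq x)%:C + eta ^+ 2).
Proof.
move=> xE; rewrite freqE => d0.
have E : cexp ('i * ((pi * Delta)%:C * x%:C)) = ('i : R[i])%R.
  by rewrite -realcM xE cexp_2pi_nat cexp_ipihalf.
rewrite /Cfun (negbTE d0) /Cfun_quot; congr (_ / _).
rewrite /csin /ccos cexpN E /cosh_value (realcM (4 * pi)) (realcM 4) (realc_nat 4).
have i0 : ('i != 0 :> R[i])%R by exact: neq0Ci.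
have ii : ('i ^-1 = - 'i :> R[i])%R by exact: invCi.
rewrite ii subrr mul0r mulr0 mul0r addr0 opprK.
by move: (ccosh _) pi%:C ('i)%R i0 => s p i i0; field.
Qed.

(** Two nodes of equal phase (y = 0 or 1/2), as [two_point] requires. They lie beyond L, so that the
    denominators freq x + eta^2 do not vanish for |eta| <= L. *)
Let nodes (L y : R) : 0 <= L -> 0 <= y -> exists n1 n2 x1 x2,
  [/\ pi * Delta * x1 = pi * y + 2 * pi * n1%:R, pi * Delta * x2 = pi * y + 2 * pi * n2%:R,
   L ^+ 2 < freq x1, L ^+ 2 < freq x2 & 0 < x1 /\ 0 < x2 /\ freq x1 != freq x2].
Proof.
move=> L0 y0; have LD : 0 <= L * Delta by rewrite mulr_ge0// ltW.
pose n := Num.bound (L * Delta); have nP : L * Delta < n%:R by rewrite archi_boundP.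
pose node (j : nat) : R := (2 * j%:R + y) / Delta.
have n0 : 0 <= n%:R :> R := ler0n _ _.
have nodeL j : (n <= j)%N -> L < node j.
  rewrite -(ler_nat R) => nj; rewrite /node ltr_pdivlMr//; lra.
have pi1 : 1 <= 4 * pi ^+ 2 :> R by have := pi_ge2 R; nra.
have freqL x : L < x -> L ^+ 2 < freq x.
  move=> Lx; rewrite /freq; have : L ^+ 2 < x ^+ 2 by rewrite ltrXn2r// ?nnegrE// (le_trans L0)// ltW.
  have := sqr_ge0 x; move: (4 * pi ^+ 2) pi1 => p p1 x2 Lx2; nra.
have nodeE j : pi * Delta * node j = pi * y + 2 * pi * j%:R.
  by rewrite /node; field; rewrite gt_eqF.
have l1 := nodeL n (leqnn n); have l2 := nodeL n.+1 (leqnSn n).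
exists n, n.+1, (node n), (node n.+1); split => //; [exact: freqL|exact: freqL|].
split; first exact: le_lt_trans l1.
split; first exact: le_lt_trans l2.
have lt12 : node n < node n.+1 by rewrite /node ltr_pM2r ?invr_gt0// ltrD2r ltr_pM2l// ltr_nat.
have sq : node n ^+ 2 < node n.+1 ^+ 2.
  by rewrite !expr2; apply: ltr_pM => //; apply: ltW; exact: le_lt_trans l1.
by rewrite lt_eqF// /freq ltr_pM2l// (lt_le_trans ltr01).
Qed.

(** Weights - A(e), A(e1) remove the term in cosh(c3 x) and leave the determinant as the other
    coefficient; weights - B(e), B(e1) exchange the roles. *)
Let cosh_defectA e1 e : cosh_defect Delta c1 c2 c3 e1 e (- A e) (A e1) 0 = 0.
Proof. by rewrite /cosh_defect; move: (A e) (A e1) (m * A 0 - _) => a b d; ring. Qed.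

Let sinh_defectA e1 e : sinh_defect Delta c1 c2 c3 e1 e (- A e) (A e1) 0 = D e1 e.
Proof.
rewrite /sinh_defect /kernel_denom.
by move: (A e) (A e1) (B e) (B e1) (m * B 0 + _) => a b d f g; ring.
Qed.

Let cosh_defectB e1 e : cosh_defect Delta c1 c2 c3 e1 e (- B e) (B e1) 0 = - D e1 e.
Proof.
rewrite /cosh_defect /kernel_denom.
by move: (A e) (A e1) (B e) (B e1) (m * A 0 - _) => a b d f g; ring.
Qed.

Let sinh_defectB e1 e : sinh_defect Delta c1 c2 c3 e1 e (- B e) (B e1) 0 = 0.
Proof. by rewrite /sinh_defect; move: (B e) (B e1) (m * B 0 + _) => a b d; ring. Qed.

(** For t = 0 the kernel drops out of [kernel_combination], which then says that A(e1) C(e, .) -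
    A(e) C(e1, .), and likewise with B, is small when the determinant and chi(e) are. At the nodes,
    [two_point] turns this into a bound on |e^2 - e1^2|. *)
Lemma kernel_separation (L k : R) : 0 <= L -> 0 < k -> exists2 N : R, 0 <= N & forall e1 e : R[i],
  cabs e1 <= L -> cabs e <= L -> k <= cabs (Q e1) -> k <= cabs (Q e) -> chi e1 = 0 ->
  (cabs (A e1) + cabs (B e1)) * (cabs (sinh_value e) + cabs (cosh_value e)) * cabs (e ^+ 2 - e1 ^+ 2) <=
  N * (cabs (D e1 e) + (cabs (A e1) + cabs (B e1)) * cabs (chi e)).
Proof.
move=> L0 k0.
have sum (p a b c d : R) : 0 <= p -> 0 <= a -> 0 <= b -> 0 <= c ->
    p * (d + a * c) + p * (d + b * c) <= 2 * p * (d + (a + b) * c).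
  by move=> p0 a0 b0 c0; have := mulr_ge0 p0 (mulr_ge0 (addr_ge0 a0 b0) c0); lra.
have four (a b c d : R) : 0 <= a -> 0 <= b -> 0 <= c -> 0 <= d ->
    [/\ a <= a + b + c + d, b <= a + b + c + d, c <= a + b + c + d & d <= a + b + c + d].
  by move=> a0 b0 c0 d0; split; lra.
have [n1 [n2 [x1 [x2 [E1 E2 Lx1 Lx2 [x10 [x20 f12]]]]]]] := nodes L0 (lexx 0).
have half0 : 0 <= 2^-1 :> R by rewrite invr_ge0.
have [n3 [n4 [x3 [x4 [E3 E4 Lx3 Lx4 [x30 [x40 f34]]]]]]] := nodes L0 half0.
rewrite mulr0 in E1 E2.
have comb w := kernel_combination D0 c10 c20 c30 small nuP KP w L k0.
have [M1 M10 H1] := comb x1%:C; have [M2 M20 H2] := comb x2%:C.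
have [M3 M30 H3] := comb x3%:C; have [M4 M40 H4] := comb x4%:C.
have o10 : 1 != 0 :> R[i] := oner_neq0 _.
have p0 x : 0 < x -> (4 * pi * x)%:C != 0 :> R[i].
  by move=> x0; rewrite realc_eq0 gt_eqF// mulr_gt0// mulr_gt0// pi_gt0.
have [N5 N50 H5] := two_point L0 Lx1 Lx2 f12 o10 o10.
have [N6 N60 H6] := two_point L0 Lx3 Lx4 f34 (p0 _ x30) (p0 _ x40).
pose M := M1 + M2 + M3 + M4.
have M0 : 0 <= M by rewrite !addr_ge0.
exists (2 * ((N5 + N6) * M)); first by rewrite !mulr_ge0 ?addr_ge0.
move=> e1 e e1L eL k1 k2 chi1.
have nz x (z : R[i]) : L ^+ 2 < freq x -> cabs z <= L -> (freq x)%:C + z ^+ 2 != 0.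
  move=> Lx zL; rewrite addr_eq0; apply/eqP => tz.
  have zz : cabs (z ^+ 2) <= L ^+ 2 by rewrite cabsX lerXn2r// nnegrE ?cabs_ge0.
  have := zz; rewrite -cabsN -tz cabs_real => l.
  by have := le_lt_trans (le_trans (ler_norm _) l) Lx; rewrite ltxx.
have main (a b : R[i]) :
    cabs (cosh_defect Delta c1 c2 c3 e1 e (- b) a 0) + cabs (sinh_defect Delta c1 c2 c3 e1 e (- b) a 0) = cabs (D e1 e) ->
    cabs a * (cabs (sinh_value e) + cabs (cosh_value e)) * cabs (e ^+ 2 - e1 ^+ 2) <=
    (N5 + N6) * M * (cabs (D e1 e) + cabs a * cabs (chi e)).
  move=> dE.
  set E := cabs (D e1 e) + cabs a * cabs (chi e).
  have E0 : 0 <= E by rewrite addr_ge0 ?mulr_ge0 ?cabs_ge0.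
  have at_node (Mj : R) (w : R[i]) : 0 <= Mj -> Mj <= M -> (forall f1 f2 a1 a2 t : R[i],
      cabs f1 <= L -> cabs f2 <= L -> k <= cabs (Q f1) -> k <= cabs (Q f2) ->
      cabs (a1 * C f1 w + a2 * C f2 w + t * m * sinc Delta w - t * K 0 w) <=
      Mj * (cabs (cosh_defect Delta c1 c2 c3 f1 f2 a1 a2 t) + cabs (sinh_defect Delta c1 c2 c3 f1 f2 a1 a2 t) +
        cabs (a1 * chi f1) + cabs (a2 * chi f2))) ->
      cabs (a * C e w - b * C e1 w) <= M * E.
    move=> Mj0 MjM /(_ e1 e (- b) a 0 e1L eL k1 k2); rewrite dE chi1 mulr0 cabs0 addr0 !mul0r subr0 addr0.
    rewrite mulNr [- _ + _]addrC (cabsM a (chi e)) -/E => l; apply: le_trans l _.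
    exact: ler_wpM2r.
  have [MM1 MM2 MM3 MM4] := four _ _ _ _ M10 M20 M30 M40.
  have G1 := at_node M1 x1%:C M10 MM1 H1; have G2 := at_node M2 x2%:C M20 MM2 H2.
  have G3 := at_node M3 x3%:C M30 MM3 H3; have G4 := at_node M4 x4%:C M40 MM4 H4.
  rewrite !(Cfun_node_even E1) ?nz// in G1; rewrite !(Cfun_node_even E2) ?nz// in G2.
  rewrite !(Cfun_node_odd E3) ?nz// in G3; rewrite !(Cfun_node_odd E4) ?nz// in G4.
  have F5 := H5 e e1 a b _ _ _ eL e1L G1 G2; have F6 := H6 e e1 a b _ _ _ eL e1L G3 G4.
  by rewrite [cabs a * (_ + _)]mulrDr [leLHS]mulrDl -[leRHS]mulrA [leRHS]mulrDl; exact: lerD F5 F6.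
have mA := main (A e1) (A e); rewrite cosh_defectA sinh_defectA cabs0 add0r in mA.
have mB := main (B e1) (B e); rewrite cosh_defectB sinh_defectB cabs0 addr0 cabsN in mB.
have {}mA := mA erefl; have {}mB := mB erefl.
rewrite -mulrA mulrDl !mulrA; apply: le_trans (lerD mA mB) _.
have NM0 : 0 <= (N5 + N6) * M by rewrite mulr_ge0 ?addr_ge0.
rewrite -[2 * _ * M]mulrA; exact: sum _ _ _ _ _ NM0 (cabs_ge0 _) (cabs_ge0 _) (cabs_ge0 _).
Qed.

Lemma root_neq0 e : chi e = 0 -> e != 0.
Proof.
move=> ce; apply/eqP => e0; move: ce; rewrite e0 /char_fun !expr0n /= mulr0 !add0r => /eqP.
apply/negP; rewrite realc_eq0 gt_eqF// mulr_gt0 ?exprn_gt0// addr_gt0 ?exprn_gt0//.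
by rewrite mulr_gt0// divr_gt0.
Qed.

(** In terms of Q = e^2 - c3^2, chi is Q^2 + 2 (c2 / c1) Q + 4 (c2 / c1) c3^2, with nonzero constant
    term. *)
Lemma root_sqr_neq e : chi e = 0 -> Q e != 0.
Proof.
move=> ce; apply/eqP => Q0; have c1C : c1%:C != 0 :> R[i] by rewrite realc_eq0 gt_eqF.
have : chi e = (4 * (c2 / c1) * c3 ^+ 2)%:C.
  have -> : chi e = Q e ^+ 2 + (2 * (c2 / c1))%:C * Q e + (4 * (c2 / c1) * c3 ^+ 2)%:C.
    rewrite /char_fun (realcM 2) (realcB (c2 / c1)) (realcM _ (c3 ^+ 2)) (realcM (c3 ^+ 2)) (realcD _ (c3 ^+ 2)).
    by rewrite !(realcM _ (c2 / c1)) (realc_nat 2) (realc_nat 4) realcX; move: (c2 / c1)%:C => r; ring.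
  by rewrite Q0 expr0n /= mulr0 !add0r.
rewrite ce => /esym/eqP; apply/negP; rewrite realc_eq0 gt_eqF//.
by rewrite mulr_gt0 ?exprn_gt0// mulr_gt0// divr_gt0.
Qed.

(** cosh + sinh is an exponential, so the two cannot vanish together. *)
Lemma values_gt0 e : e != 0 -> 0 < cabs (sinh_value e) + cabs (cosh_value e).
Proof.
move=> e0; rewrite lt_neqAle eq_sym paddr_eq0 ?cabs_ge0// addr_ge0 ?cabs_ge0// andbT.
have e2 : 2 * e != 0 by rewrite mulf_neq0// pnatr_eq0.
apply/negP => /andP[]; rewrite !cabs_eq0 /sinh_value /cosh_value mulf_eq0 (negbTE e2) /= => /eqP s0 /eqP c0.
have : cexp (h%:C * e) = ccosh (h%:C * e) + csinh (h%:C * e) by rewrite /ccosh /csinh; field.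
by rewrite s0 c0 addr0 => /eqP; rewrite (negbTE (cexp_neq0 _)).
Qed.

(** Otherwise cosh(e x) has zero convolution with nu on the window, hence C(e, .) = 0, whereas its
    values at the two kinds of nodes are nonzero multiples of [sinh_value] and [cosh_value]. *)
Lemma AB_gt0 e : chi e = 0 -> 0 < cabs (A e) + cabs (B e).
Proof.
move=> ce; rewrite lt_neqAle eq_sym paddr_eq0 ?cabs_ge0// addr_ge0 ?cabs_ge0// andbT.
apply/negP => /andP[]; rewrite !cabs_eq0 => /eqP A0 /eqP B0.
have C0 w : C e w = 0.
  have k0 : 0 < cabs (Q e) by rewrite cabs_gt0 root_sqr_neq.
  have [N N0 /(_ e e 1 0 0 (lexx _) (lexx _) (lexx _) (lexx _))] :=
    kernel_combination D0 c10 c20 c30 small nuP KP w (cabs e) k0.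
  rewrite /cosh_defect /sinh_defect A0 B0 ce !mulr0 !mul0r !addr0 cabs0 !addr0 mulr0 mul1r subr0 => H.
  by apply/eqP; rewrite -cabs_eq0 eq_le H cabs_ge0.
have [n1 [_ [x1 [_ [E1 _ Lx1 _ _]]]]] := nodes (cabs_ge0 e) (lexx 0).
have half0 : 0 <= 2^-1 :> R by rewrite invr_ge0.
have [n2 [_ [x2 [_ [E2 _ Lx2 _ [x20 _]]]]]] := nodes (cabs_ge0 e) half0.
rewrite mulr0 in E1.
have nz x : cabs e ^+ 2 < freq x -> (freq x)%:C + e ^+ 2 != 0.
  move=> Lx; rewrite addr_eq0; apply/eqP => tz.
  move: Lx; rewrite -cabsX -cabsN -tz cabs_real => Lx.
  by have := lt_le_trans Lx (ler_norm _); rewrite ltxx.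
have d1 := nz _ Lx1; have d2 := nz _ Lx2.
have p0 : (4 * pi * x2)%:C != 0 :> R[i].
  by rewrite realc_eq0 gt_eqF// mulr_gt0// mulr_gt0// pi_gt0.
have := values_gt0 (root_neq0 ce).
have := Cfun_node_even E1 d1; rewrite C0 => /esym/eqP; rewrite mulf_eq0 invr_eq0 (negbTE d1) orbF mul1r => /eqP ->.
have := Cfun_node_odd E2 d2; rewrite C0 => /esym/eqP; rewrite mulf_eq0 invr_eq0 (negbTE d2) orbF mulf_eq0 (negbTE p0) /= => /eqP ->.
by rewrite cabs0 addr0 ltxx.
Qed.

(** With D = 0 and chi(e2) = 0, [kernel_separation] would bound a product of positive factors by
    0. *)
Lemma kernel_denom_neq0 e1 e2 : chi e1 = 0 -> chi e2 = 0 -> e1 ^+ 2 != e2 ^+ 2 -> D e1 e2 != 0.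
Proof.
move=> ch1 ch2 e12; apply/eqP => D12.
have q1 : 0 < cabs (Q e1) by rewrite cabs_gt0 root_sqr_neq.
have q2 : 0 < cabs (Q e2) by rewrite cabs_gt0 root_sqr_neq.
have k0 : 0 < Num.min (cabs (Q e1)) (cabs (Q e2)) by rewrite lt_min q1.
have L0 : 0 <= Num.max (cabs e1) (cabs e2) by rewrite le_max cabs_ge0.
have [N N0 H] := kernel_separation L0 k0.
have := H e1 e2; rewrite !le_max !lexx orbT !ge_min !lexx orbT D12 ch2 cabs0 mulr0 addr0 mulr0.
move=> /(_ isT isT isT isT ch1); apply/negP; rewrite -ltNge.
apply: mulr_gt0; last by rewrite cabs_gt0 subr_eq0 eq_sym.
by apply: mulr_gt0; [exact: AB_gt0|exact: values_gt0 (root_neq0 ch2)].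
Qed.

(** With [cramer2], the solution of the linear system that both defects vanish for t = 1. *)
Definition cramer1 e1 e2 : R[i] :=
  (((1 / c1)%:C - A 0 * m) * B e2 + ((c3 ^+ 2 / c1)%:C + B 0 * m) * A e2) / D e1 e2.

Definition cramer2 e1 e2 : R[i] :=
  - (((1 / c1)%:C - A 0 * m) * B e1 + ((c3 ^+ 2 / c1)%:C + B 0 * m) * A e1) / D e1 e2.

Lemma kernel_formulaE e1 e2 z : kernel_formula Delta c1 c2 c3 e1 e2 z =
  cramer1 e1 e2 * C e1 z + cramer2 e1 e2 * C e2 z + 1 * m * sinc Delta z.
Proof.
rewrite /kernel_formula /cramer1 /cramer2.
move: (A 0) (B 0) (A e1) (A e2) (B e1) (B e2) (C e1 z) (C e2 z) (D e1 e2)^-1 m (sinc Delta z) => a b c d e f g i j k l.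
by move: (1 / c1)%:C (c3 ^+ 2 / c1)%:C => u v; ring.
Qed.

Lemma cramer_cosh e1 e2 : D e1 e2 != 0 ->
  cosh_defect Delta c1 c2 c3 e1 e2 (cramer1 e1 e2) (cramer2 e1 e2) 1 = 0.
Proof.
rewrite /cosh_defect -[in X in _ * (_ - X)%R](div1r c1) /cramer1 /cramer2 /kernel_denom.
move: (A 0) (B 0) (A e1) (A e2) (B e1) (B e2) m => a b c d e f k.
by move: (1 / c1)%:C (c3 ^+ 2 / c1)%:C => u v D0'; field.
Qed.

Lemma cramer_sinh e1 e2 : D e1 e2 != 0 ->
  sinh_defect Delta c1 c2 c3 e1 e2 (cramer1 e1 e2) (cramer2 e1 e2) 1 = 0.
Proof.
rewrite /sinh_defect /cramer1 /cramer2 /kernel_denom.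
move: (A 0) (B 0) (A e1) (A e2) (B e1) (B e2) m => a b c d e f k.
by move: (1 / c1)%:C (c3 ^+ 2 / c1)%:C => u v D0'; field.
Qed.

Lemma kernel_formula_distinct e1 e2 z : chi e1 = 0 -> chi e2 = 0 -> e1 ^+ 2 != e2 ^+ 2 ->
  K 0 z = kernel_formula Delta c1 c2 c3 e1 e2 z.
Proof.
move=> ch1 ch2 e12; have D12 := kernel_denom_neq0 ch1 ch2 e12.
have q1 : 0 < cabs (Q e1) by rewrite cabs_gt0 root_sqr_neq.
have q2 : 0 < cabs (Q e2) by rewrite cabs_gt0 root_sqr_neq.
have k0 : 0 < Num.min (cabs (Q e1)) (cabs (Q e2)) by rewrite lt_min q1.
have [N N0 H] := kernel_combination D0 c10 c20 c30 small nuP KP z (Num.max (cabs e1) (cabs e2)) k0.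
have := H e1 e2 (cramer1 e1 e2) (cramer2 e1 e2) 1; rewrite !le_max !lexx orbT !ge_min !lexx orbT.
move=> /(_ isT isT isT isT); rewrite cramer_cosh// cramer_sinh// ch1 ch2 !mulr0 cabs0 !addr0 mulr0 -kernel_formulaE.
rewrite mul1r => H'; apply/esym/eqP; rewrite -subr_eq0 -cabs_eq0 eq_le cabs_ge0 andbT.
exact: H'.
Qed.

(** chi is a quadratic in eta^2. A square root of its second root y is again a root of chi, hence e
    or - e; so y = e^2 and the quadratic is a square. *)
Lemma char_fun_double_root e : chi e = 0 -> (forall eta, chi eta = 0 -> eta = e \/ eta = - e) ->
  forall eta, chi eta = (eta ^+ 2 - e ^+ 2) ^+ 2.
Proof.
rewrite /char_fun; move: (2 * (c2 / c1 - c3 ^+ 2))%:C (c3 ^+ 2 * (2 * (c2 / c1) + c3 ^+ 2))%:C => b c ce H eta.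
pose y := - b - e ^+ 2; have yE : sqrtC y ^+ 2 = y := sqrtCK y.
have cE : c = - (e ^+ 4 + b * e ^+ 2) by rewrite -[c](addKr (e ^+ 4 + b * e ^+ 2)) ce addr0.
have ey : e ^+ 2 = y.
  have [] := H (sqrtC y); last 2 first.
  - by move=> s; rewrite -yE s.
  - by move=> s; rewrite -yE s sqrrN.
  rewrite (_ : sqrtC y ^+ 4 = (sqrtC y ^+ 2) ^+ 2); last by rewrite -exprM.
  by rewrite yE cE /y; ring.
have bE : b = - (2 * e ^+ 2).
  have -> : b = - (y + e ^+ 2) by rewrite /y; ring.
  by rewrite -ey; ring.
by rewrite cE bE; ring.
Qed.

Lemma values_lower e : e != 0 -> exists2 r : R, 0 < r & forall eta, cabs (eta - e) < r ->
  (cabs (sinh_value e) + cabs (cosh_value e)) / 2 <= cabs (sinh_value eta) + cabs (cosh_value eta).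
Proof.
move=> e0; have s0 := values_gt0 e0; set s := cabs _ + cabs _ in s0 *.
have dE z : cdiff (fun z => cexp (h%:C * z)) z (h%:C * cexp (h%:C * z)).
  have := cdiff_comp_lin (f := cexp) (a := h%:C) (b := 0) (z := z) (cdiff_cexp _).
  by rewrite addr0; under eq_fun do rewrite addr0.
have dE' z : cdiff (fun z => cexp (- (h%:C * z))) z (- h%:C * cexp (- (h%:C * z))).
  have := cdiff_comp_lin (f := cexp) (a := - h%:C) (b := 0) (z := z) (cdiff_cexp _).
  have -> : (fun w => cexp (- h%:C * w + 0)) = (fun w => cexp (- (h%:C * w))) :> (R[i] -> R[i]).
    by apply/funext => w; rewrite addr0 mulNr.
  by rewrite addr0 [- h%:C * z]mulNr.
have dN f (z d : R[i]) : cdiff f z d -> exists d', cdiff (fun z => - f z) z d'.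
  move=> df; have := cdiffM (cdiff_cst z (-1)) df; under eq_fun do rewrite mulN1r.
  by move=> ?; eexists; eassumption.
have [d1 Hd1] : exists d, cdiff cosh_value e d.
  by eexists; exact: (cdiffM (cdiffD (dE e) (dE' e)) (cdiff_cst e 2^-1)).
have [d2 Hd2] : exists d, cdiff sinh_value e d.
  have [d' Hd'] := dN _ _ _ (dE' e).
  have l : cdiff (fun z : R[i] => 2 * z) e 2.
    by have := cdiff_lin e 2 0; under eq_fun do rewrite addr0.
  by eexists; exact: (cdiffM l (cdiffM (cdiffD (dE e) Hd') (cdiff_cst e 2^-1))).
have [r1 r10 H1] := cdiff_bound Hd1; have [r2 r20 H2] := cdiff_bound Hd2.
pose M := cabs d1 + 1 + (cabs d2 + 1).
have M0 : 0 < M by rewrite /M; have := cabs_ge0 d1; have := cabs_ge0 d2; lra.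
exists (Num.min (Num.min r1 r2) (s / 2 / M)).
  by rewrite !lt_min r10 r20 !divr_gt0.
move=> eta; rewrite !lt_min => /andP[/andP[/H1 k1 /H2 k2]]; rewrite ltr_pdivlMr// => k3.
have t1 := cabsD (cosh_value eta) (cosh_value e - cosh_value eta); rewrite addrC subrK in t1.
have t2 := cabsD (sinh_value eta) (sinh_value e - sinh_value eta); rewrite addrC subrK in t2.
rewrite cabsBC in k1; rewrite cabsBC in k2.
have sE : s = cabs (sinh_value e) + cabs (cosh_value e) by [].
rewrite /M mulrDr in k3.
by rewrite ![_ * cabs (eta - e)]mulrC in k1 k2; lra.
Qed.

(** With Cramer coefficients both defects vanish and chi(e) = 0, so the error is governed by
    [cramer2] times chi(eta) = d^2, where d = eta^2 - e^2. The numerator of [cramer2] depends on e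
    alone and its denominator is at least c |d|, so the error is O(|d|). *)
Lemma kernel_formula_double e z : chi e = 0 -> (forall eta, chi eta = (eta ^+ 2 - e ^+ 2) ^+ 2) ->
  forall eps : R, 0 < eps -> exists2 r : R, 0 < r & forall eta, eta != e -> cabs (eta - e) < r ->
  cabs (kernel_formula Delta c1 c2 c3 e eta z - K 0 z) <= eps.
Proof.
move=> ce chiE eps eps0; have e0 := root_neq0 ce; have ae0 : 0 < cabs e by rewrite cabs_gt0.
have q0 : 0 < cabs (Q e) by rewrite cabs_gt0 root_sqr_neq.
pose L := cabs e + 1; pose k := cabs (Q e) / 2.
have k0 : 0 < k by rewrite divr_gt0.
have L0 : 0 < L by rewrite /L; lra.
have [N N0 HN] := kernel_combination D0 c10 c20 c30 small nuP KP z L k0.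
have [N' N'0 HN'] := kernel_separation (ltW L0) k0.
have [rs rs0 Hs] := values_lower e0.
have s0 := values_gt0 e0.
pose AB := cabs (A e) + cabs (B e); have AB0 : 0 < AB := AB_gt0 ce.
pose sig := (cabs (sinh_value e) + cabs (cosh_value e)) / 2.
have sig0 : 0 < sig by rewrite divr_gt0.
pose G := cabs (((1 / c1)%:C - A 0 * m) * B e + ((c3 ^+ 2 / c1)%:C + B 0 * m) * A e).
have G0 : 0 <= G := cabs_ge0 _.
(* The factor 1/2 leaves room to absorb the term AB |d|^2 of [kernel_separation]; N' + 1 avoids a
   division by zero. *)
pose c := AB * sig / (2 * (N' + 1)).
have N'1 : 0 < N' + 1 by lra.
have cc0 : 0 < c by rewrite divr_gt0 ?mulr_gt0.
have NG0 : 0 < N * G + 1 by have := mulr_ge0 N0 G0; lra.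
(* The three bounds on |d| keep |Q(eta)| >= k, allow that absorption, and make the final error at
   most eps. *)
pose dm := Num.min k (Num.min (sig / (2 * (N' + 1))) (eps * c / (N * G + 1))).
have two0 : 0 < 2 :> R by [].
have dm1 : 0 < sig / (2 * (N' + 1)) := divr_gt0 sig0 (mulr_gt0 two0 N'1).
have dm2 : 0 < eps * c / (N * G + 1) := divr_gt0 (mulr_gt0 eps0 cc0) NG0.
have dm0 : 0 < dm by rewrite !lt_min k0 dm1 dm2.
(* Since |d| = |eta - e| |eta + e| <= 2 L |eta - e|, the last entry gives |d| <= dm; the entry |e|
   excludes eta = - e, where d would vanish. *)
exists (Num.min (Num.min 1 (cabs e)) (Num.min rs (dm / (2 * L)))).
  by rewrite !lt_min ltr01 ae0 rs0 (divr_gt0 dm0 (mulr_gt0 two0 L0)).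
move=> eta etae; rewrite !lt_min => /andP[/andP[r1 re] /andP[/Hs sge]].
rewrite ltr_pdivlMr ?mulr_gt0// => rd.
set d := eta ^+ 2 - e ^+ 2.
have etaL : cabs eta <= L.
  by rewrite -[eta](subrK e) /L addrC (le_trans (cabsD _ _))// lerD// ltW.
have eL : cabs e <= L by rewrite /L lerDl.
have dle : cabs d <= dm.
  rewrite /d subr_sqr cabsM; apply: le_trans _ (ltW rd); apply: ler_wpM2l; first exact: cabs_ge0.
  by apply: le_trans (cabsD _ _) _; rewrite mulr_natl mulr2n; exact: lerD.
have d0 : 0 < cabs d.
  rewrite cabs_gt0 /d subr_sqr mulf_neq0 ?subr_eq0//; apply/eqP => s.
  have ee : eta = - e by apply/eqP; rewrite -addr_eq0 s.
  move: re; rewrite ee -opprD cabsN; have -> : e + e = 2 * e by rewrite mulr_natl mulr2n.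
  by rewrite cabsM -realc_nat cabs_real normr_nat; lra.
move: (dle); rewrite /dm !le_min => /andP[dk /andP[ds de]].
have kQ : k <= cabs (Q eta).
  have := cabsB (Q eta) d; rewrite (_ : Q eta - d = Q e); last by rewrite /d; ring.
  by rewrite /k; move: dk; rewrite /k; lra.
have keQ : k <= cabs (Q e) by rewrite /k ler_pdivrMr// ler_peMr ?cabs_ge0// ler1n.
have chid : cabs (chi eta) = cabs d ^+ 2 by rewrite chiE cabsX.
have := HN' e eta eL etaL keQ kQ ce; rewrite chid -/d -/AB => sep.
have Dl : c * cabs d <= cabs (D e eta).
  have lo : AB * sig * cabs d <= N' * (cabs (D e eta) + AB * cabs d ^+ 2).
    apply: le_trans _ sep; apply: ler_wpM2r; first exact: cabs_ge0.
    by apply: ler_wpM2l => //; exact: ltW.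
  rewrite /c mulrAC ler_pdivrMr ?mulr_gt0//.
  rewrite ler_pdivlMr ?mulr_gt0// in ds.
  have k1 := mulr_ge0 (mulr_ge0 (ltW AB0) (ltW d0)) (_ : 0 <= sig - cabs d * (2 * (N' + 1))).
  rewrite subr_ge0 in k1; have {}k1 := k1 ds.
  have k2 := mulr_ge0 (ltW AB0) (sqr_ge0 (cabs d)).
  have k3 := cabs_ge0 (D e eta).
  move: (cabs (D e eta)) (cabs d) lo k1 k2 k3 => x y; nra.
have cd0 : 0 < c * cabs d := mulr_gt0 cc0 d0.
have Dn0 : D e eta != 0 by rewrite -cabs_gt0 (lt_le_trans cd0).
have := HN e eta (cramer1 e eta) (cramer2 e eta) 1 eL etaL keQ kQ.
rewrite -kernel_formulaE mul1r (cramer_cosh Dn0) (cramer_sinh Dn0) cabs0 ce mulr0 cabs0 !add0r => H.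
apply: le_trans H _; rewrite cabsM chid /cramer2 cabsM cabsN cabsV -/G.
apply: (@le_trans _ _ (N * (G / (c * cabs d) * cabs d ^+ 2))).
  apply: ler_wpM2l => //; apply: ler_wpM2r; first exact: sqr_ge0.
  by apply: ler_wpM2l => //; rewrite lef_pV2 ?posrE// cabs_gt0.
rewrite ler_pdivlMr// in de.
have dn : cabs d != 0 by rewrite gt_eqF.
have cn : c != 0 by rewrite gt_eqF.
have -> : N * (G / (c * cabs d) * cabs d ^+ 2) = N * G * cabs d / c by field; rewrite dn cn.
rewrite ler_pdivrMr//; apply: le_trans _ de; rewrite [leRHS]mulrC; apply: ler_wpM2r; first exact: ltW.
by rewrite lerDl.
Qed.

End Separation.

(** For equal etas the condition on the roots expresses a double root, where the error is of the
    order of chi(eta) over the determinant, that is of |eta - eta1|. The limit fixes the first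
    argument and moves the second. *)
Theorem theorem7 (R : realType) (Delta c1 c2 c3 : R)
    (nu : {measure set (measurableTypeR R) -> \bar R})
    (eta1 eta2 : R[i]) (K : R[i] -> R[i] -> R[i]) :
  0 < Delta -> 0 < c1 -> 0 < c2 -> 0 < c3 ->
  c2 / c1 * Delta ^+ 2 <= 5 / 3 ->
  is_nu Delta c1 c2 c3 nu ->
  char_eq c1 c2 c3 eta1 -> char_eq c1 c2 c3 eta2 ->
  eta1 + eta2 != 0 ->
  (eta1 = eta2 ->
    forall eta, char_eq c1 c2 c3 eta -> eta = eta1 \/ eta = - eta1) ->
  is_reproducing_kernel Delta nu K ->
  forall z : R[i],
    (eta1 != eta2 ->
      kernel_denom Delta c1 c2 c3 eta1 eta2 != 0 /\
      K 0 z = kernel_formula Delta c1 c2 c3 eta1 eta2 z) /\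
    (eta1 = eta2 ->
      (kernel_formula Delta c1 c2 c3 eta1 eta z : R[i]^o)
        @[eta --> (eta1 : R[i]^o)^'] --> (K 0 z : R[i]^o)).
Proof.
move=> D0 c10 c20 c30 small nuP ch1 ch2 e12 dbl KP z; split=> [ne|ee].
  (* A, B and C are even in eta, so the determinant only distinguishes squares; eta1 + eta2 != 0
     makes these differ. *)
  have sq : eta1 ^+ 2 != eta2 ^+ 2.
    by rewrite -subr_eq0 subr_sqr mulf_neq0// subr_eq0.
  split; first exact: (kernel_denom_neq0 D0 c10 c20 c30 small nuP KP ch1 ch2 sq).
  exact: (kernel_formula_distinct D0 c10 c20 c30 small nuP KP z ch1 ch2 sq).
apply: punctured_cvg => eps eps0.
apply: (kernel_formula_double D0 c10 c20 c30 small nuP KP z ch1 _ eps0).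
by apply: char_fun_double_root ch1 _ => eta; exact: dbl.
Qed.
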